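(* Let $\nu,\mu$ be normal weights on $\mathbb D$, let $\alpha>-1$ and let $\omega$ be a weight function such that $\{\nu,\omega\}$ is a normal pair with $\nu(r)\omega(r)=(1-r^2)^\alpha$ for $0\le r<1$. Let $g\in\mathcal H^0_{(1-|z|^2)\mu(z)}$ and let $\phi$ be an analytic self-map of $\mathbb D$ such that $S_g^\phi:\mathcal H^\infty_\nu\to\mathcal H^\infty_\mu$ is bounded. Then the following statements are equivalent. (a) $S_g^\phi:\mathcal H^0_\nu\to\mathcal H^\infty_\mu$ is nuclear. (b) $S_g^\phi:\mathcal H^\infty_\nu\to\mathcal H^\infty_\mu$ is nuclear. (c) $S_g^\phi:\mathcal H^0_\nu\to\mathcal H^0_\mu$ is nuclear. (d) $S_g^\phi:\mathcal H^\infty_\nu\to\mathcal H^0_\mu$ is nuclear. (e) $$\int_{\mathbb D}\left[\sup_{z\in\mathbb D}\frac{(1-|z|^2)\mu(z)|g(z)|}{|1-\bar\zeta\phi(z)|^{\alpha+3}}\right]\frac{(1-|\zeta|^2)^\alpha}{\nu(\zeta)}\,dA(\zeta)<\infty.$$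
   Context: $\mathbb D$ is the open unit disk in $\mathbb C$, $H(\mathbb D)$ the space of analytic functions on $\mathbb D$, and $dA$ normalized Lebesgue measure on $\mathbb D$. For $g\in H(\mathbb D)$ and an analytic map $\phi:\mathbb D\to\mathbb D$, $(S_g^\phi f)(z)=\int_0^z f'(\phi(\zeta))g(\zeta)\,d\zeta$ for $f\in H(\mathbb D)$, $z\in\mathbb D$. A radial weight is a continuous positive function $\nu$ on $\mathbb D$ with $\nu(z)=\nu(|z|)$, non-increasing in $|z|$. It is normal if: (I) there is $\beta>0$ such that $r\mapsto\nu(r)/(1-r^2)^\beta$ is almost increasing on $[0,1)$; and (II) there is $\gamma>0$ such that $r\mapsto\nu(r)/(1-r^2)^\gamma$ is almost decreasing on $[0,1)$. (A function $h$ is almost increasing if there is $C>0$ with $h(r)\le C h(s)$ for all $r\le s$; almost decreasing if $h(s)\le C h(r)$ for all $r\le s$.) $\{\nu,\omega\}$ is a normal pair if $\nu$ is normal, $\omega$ is radial, positive and continuous with $\int_0^1\omega(r)\,dr<\infty$, and $\nu(r)\omega(r)=(1-r^2)^\alpha$, $0\le r<1$, for some $\alpha>\beta-1$, where $\beta>0$ is an exponent as in (I) for $\nu$. For a weight $\nu$: $\mathcal H^\infty_\nu=\{f\in H(\mathbb D):\|f\|_{\mathcal H^\infty_\nu}=\sup_{z\in\mathbb D}\nu(z)|f(z)|<\infty\}$ and $\mathcal H^0_\nu=\{f\in H(\mathbb D):\lim_{|z|\to1^-}\nu(z)|f(z)|=0\}$, with the norm of $\mathcal H^\infty_\nu$.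 In particular $\mathcal H^0_{(1-|z|^2)\mu(z)}=\{f\in H(\mathbb D):\lim_{|z|\to1^-}(1-|z|^2)\mu(z)|f(z)|=0\}$. A linear operator $T:X\to Y$ between Banach spaces is nuclear if there are sequences $(x_k')\subset X'$ (the dual of $X$) and $(y_k)\subset Y$ with $\sum_k\|x_k'\|\|y_k\|<\infty$ and $Tx=\sum_k x_k'(x)y_k$ for all $x\in X$. *)

(* Defs.v *)
From HB Require Import structures.
From mathcomp Require Import all_boot all_order all_algebra.
From mathcomp Require Import complex.
From mathcomp Require Import all_classical all_reals all_analysis.

Set Implicit Arguments.
Unset Strict Implicit.
Unset Printing Implicit Defensive.

Import Order.TTheory GRing.Theory Num.Theory.
Import numFieldNormedType.Exports.
Import ComplexField.Normc.

Local Open Scope classical_set_scope.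
Local Open Scope complex_scope.
Local Open Scope ring_scope.

(* [R[i]] as a normed space over itself; its norm [`|z|] is the element
   [(normc z)%:C] of [R[i]], while [normc z] is the modulus as an element of
   [R]. *)
HB.instance Definition _ (R : rcfType) := NormedModule.copy R[i] R[i]^o.

Section HolomorphicFunctions.
Context {R : realType}.
Local Notation C := R[i].

Definition disk : set C := [set z | normc z < 1].

(* Functions on the disk are total functions [C -> C] of which only the values
   on [disk] are relevant. *)
Definition analytic (f : C -> C) := forall z, disk z -> derivable f z 1.

Definition self_map (phi : C -> C) :=
  analytic phi /\ forall z, disk z -> disk (phi z).

(* integral from [0] to [z] along the segment [t |-> t z], [0 <= t <= 1] *)
Definition segment_integral (h : C -> C) (z : C) : C :=
  let integrand (t : R) := h (t%:C * z) * z in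
  (\int[lebesgue_measure]_(t in `[0, 1]) complex.Re (integrand t)) +i*
  (\int[lebesgue_measure]_(t in `[0, 1]) complex.Im (integrand t)).

Definition S_op (g phi f : C -> C) (z : C) : C :=
  segment_integral (fun zeta => derive1 f (phi zeta) * g zeta) z.

End HolomorphicFunctions.

Section Weights.
Context {R : realType}.
Local Notation C := R[i].

(* Only the values of a weight on [disk] are relevant. *)
Definition radial_pos_cont (w : C -> R) :=
  [/\ {within disk, continuous w},
      forall z, disk z -> 0 < w z
    & forall z, disk z -> w z = w (normc z)%:C].

Record weight := Weight {
  weight_fun :> C -> R;
  weight_rpc : radial_pos_cont weight_fun;
  weight_noninc : forall z z', disk z' -> normc z <= normc z' ->
    weight_fun z' <= weight_fun z }.

Definition almost_increasing (h : R -> R) :=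
  exists2 c, 0 < c & forall r s, 0 <= r -> r <= s -> s < 1 -> h r <= c * h s.

Definition almost_decreasing (h : R -> R) :=
  exists2 c, 0 < c & forall r s, 0 <= r -> r <= s -> s < 1 -> h s <= c * h r.

Definition normal_exp_I (nu : C -> R) (beta : R) :=
  0 < beta /\ almost_increasing (fun r => nu r%:C / (1 - r ^+ 2) `^ beta).

Definition normal_exp_II (nu : C -> R) (gamma : R) :=
  0 < gamma /\ almost_decreasing (fun r => nu r%:C / (1 - r ^+ 2) `^ gamma).

Definition normal (nu : weight) :=
  (exists beta, normal_exp_I nu beta) /\ (exists gamma, normal_exp_II nu gamma).

Definition normal_pair (nu : weight) (omega : C -> R) (alpha : R) :=
  [/\ normal nu,
      radial_pos_cont omega,
      (\int[lebesgue_measure]_(r in `[0%R, 1%R[) (omega r%:C)%:E < +oo)%E,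
      forall r, 0 <= r -> r < 1 ->
        nu r%:C * omega r%:C = (1 - r ^+ 2) `^ alpha
    & exists2 beta, normal_exp_I nu beta & beta - 1 < alpha].

End Weights.
Arguments weight : clear implicits.

Section WeightedSpaces.
Context {R : realType}.
Local Notation C := R[i].

Definition weighted_values (w : C -> R) (f : C -> C) : set R :=
  [set w z * normc (f z) | z in disk].

Definition weighted_norm (w : C -> R) (f : C -> C) : R :=
  sup (weighted_values w f).

Definition in_Hinf (w : C -> R) (f : C -> C) :=
  analytic f /\ has_ubound (weighted_values w f).

Definition in_H0 (w : C -> R) (f : C -> C) :=
  analytic f /\
  forall e, 0 < e -> exists2 r, r < 1 &
    forall z, r < normc z -> normc z < 1 -> w z * normc (f z) < e.

(* A linear space of functions on which the [w]-weighted sup-norm is finite. *)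
Record weighted_space := WeightedSpace {
  space_weight : weight R;
  space_mem : (C -> C) -> Prop;
  space_mem0 : space_mem 0;
  space_memP : forall a f h, space_mem f -> space_mem h ->
    space_mem (a *: f + h);
  space_bounded : forall f, space_mem f ->
    has_ubound (weighted_values space_weight f) }.

(* A function on the disk is represented by its extension by 0. *)
Definition space_pred (E : weighted_space) : {pred C -> C} :=
  mem [set f | space_mem E f /\ forall z, ~ disk z -> f z = 0].

Lemma space_pred_submod E : submod_closed (space_pred E).
Proof.
split; first by rewrite inE; split => //; exact: space_mem0.
move=> a f h; rewrite !inE => -[Ef f0] [Eh h0]; split; first exact: space_memP.
by move=> z dz; rewrite /= !fctE f0// h0// scaler0 addr0.
Qed.

HB.instance Definition _ (E : weighted_space) :=
  GRing.isSubmodClosed.Build C (C -> C) (space_pred E) (space_pred_submod E).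

Record elements (E : weighted_space) := Elements {
  elements_fun :> C -> C;
  elementsP : elements_fun \in space_pred E }.

End WeightedSpaces.
Arguments weighted_space : clear implicits.

Section WeightedSpacesNorm.
Context {R : realType} (E : weighted_space R).
Local Notation C := R[i].

HB.instance Definition _ := [isSub for @elements_fun R E].
HB.instance Definition _ := [Choice of elements E by <:].
HB.instance Definition _ := [SubChoice_isSubLmodule of elements E by <:].

Local Notation w := (space_weight E).

Local Lemma weighted_values_le f z : space_mem E f -> disk z ->
  w z * normc (f z) <= weighted_norm w f.
Proof.
by move=> Ef dz; apply: ub_le_sup; [exact: space_bounded|exists z].
Qed.

Lemma disk0 : disk (0 : C).
Proof. by have := @ltr01 R; rewrite -[X in X < _](normc0 R). Qed.

Lemma normcE (z : C) : `|z| = (normc z)%:C.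
Proof. by []. Qed.

Lemma normc_leD (x y : C) : normc (x + y) <= normc x + normc y.
Proof. by have := ler_normD x y; rewrite !normcE -rmorphD /= lecR. Qed.

Lemma normc_ge0 (x : C) : 0 <= normc x.
Proof. by case: x => a b /=; rewrite sqrtr_ge0. Qed.

Lemma weight_gt0 (nu : weight R) z : disk z -> 0 < nu z.
Proof. by case: (weight_rpc nu) => _ + _; exact. Qed.

Lemma elements_mem (f : elements E) : space_mem E f.
Proof. by have := elementsP f; rewrite inE => -[]. Qed.

Lemma elements_out (f : elements E) z : ~ disk z -> f z = 0.
Proof. by have := elementsP f; rewrite inE => -[_]; exact. Qed.

Lemma weighted_norm_le f b :
  (forall z, disk z -> w z * normc (f z) <= b) -> weighted_norm w f <= b.
Proof.
move=> fb; apply: sup_le_ub; last by move=> _ [z dz <-]; exact: fb.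
by exists (w 0 * normc (f 0)), 0 => //; exact: disk0.
Qed.

Definition elements_norm (f : elements E) : C := (weighted_norm w f)%:C.
Local Notation norm := elements_norm.

Local Lemma elements_normD (f h : elements E) : norm (f + h) <= norm f + norm h.
Proof.
rewrite -rmorphD /= lecR; apply: weighted_norm_le => z dz.
apply: (@le_trans _ _ (w z * (normc (f z) + normc (h z)))).
  by rewrite ler_wpM2l ?normc_leD// ltW// weight_gt0.
by rewrite mulrDr lerD// weighted_values_le//; exact: elements_mem.
Qed.

Local Lemma elements_normZ_le (a : C) (f : elements E) :
  weighted_norm w (a *: f) <= normc a * weighted_norm w f.
Proof.
apply: weighted_norm_le => z dz.
rewrite [(a *: f) z]/(a * f z) normcM mulrCA ler_wpM2l ?normc_ge0//.
by apply: weighted_values_le => //; exact: elements_mem.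
Qed.

Local Lemma elements_normZ (a : C) (f : elements E) :
  norm (a *: f) = `|a| * norm f.
Proof.
rewrite normcE -rmorphM /norm; congr (_%:C).
apply/eqP; rewrite eq_le elements_normZ_le /=.
have [->|a0] := eqVneq a 0.
  rewrite normc0 mul0r; apply: le_trans (weighted_values_le _ disk0).
    by rewrite mulr_ge0 ?normc_ge0// ltW// weight_gt0//; exact: disk0.
  exact: (elements_mem (0 *: f)).
have na : 0 < normc a.
  rewrite lt_neqAle normc_ge0 andbT eq_sym.
  by apply: contra_neq a0; exact: eq0_normc.
have := elements_normZ_le a^-1 (a *: f); rewrite scalerA mulVf// scale1r normcV.
by rewrite ler_pdivlMl.
Qed.

Local Lemma elements_norm_eq0 (f : elements E) : norm f = 0 -> f = 0.
Proof.
move=> [f0]; apply/val_inj/funext => z /=.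
have [dz|ndz] := pselect (disk z); last by rewrite elements_out.
have := weighted_values_le (elements_mem f) dz; rewrite f0 => wf.
apply: eq0_normc; apply/eqP; rewrite eq_le normc_ge0 andbT.
by rewrite -(pmulr_rle0 _ (weight_gt0 w dz)).
Qed.

HB.instance Definition _ :=
  Lmodule_isNormed.Build C (elements E)
    elements_normD elements_normZ elements_norm_eq0.

End WeightedSpacesNorm.

Section Spaces.
Context {R : realType}.
Local Notation C := R[i].

Lemma analytic0 : analytic (0 : C -> C).
Proof. by move=> z _; exact: derivable_cst. Qed.

Lemma analyticP (a : C) f h : analytic f -> analytic h -> analytic (a *: f + h).
Proof.
move=> af ah z dz; apply: derivableD; last exact: ah.
by apply: derivableZ; exact: af.
Qed.

Lemma analytic_continuous (f : C -> C) z :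
  analytic f -> disk z -> {for z, continuous f}.
Proof.
by move=> /[apply] /derivable1_diffP; exact: differentiable_continuous.
Qed.

Lemma normc_real (x : R) : normc x%:C = `|x|.
Proof. by rewrite /= expr0n addr0 sqrtr_sqr. Qed.

Lemma normc_continuous : continuous (@normc R).
Proof.
move=> x; apply/(@cvgrPdist_le _ _ _ (nbhs x)) => e e0.
have /(@cvgrPdist_le _ _ _ (nbhs x))/(_ e%:C) :
    (id : C -> C) @ x --> x by exact: cvg_id.
rewrite ltcR => /(_ e0); apply: filterS => y /= xye.
have := le_trans (ler_dist_dist x y) xye.
by rewrite !normcE -rmorphB lecR normc_real.
Qed.

Lemma disk_compact (r : R) : compact [set z : C | normc z <= r].
Proof.
pose c (p : R * R) : C := p.1 +i* p.2.
have cc : continuous c.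
  move=> p; apply/(@cvgrPdist_le _ _ _ (nbhs p)) => /= e.
  case: e => e e'; rewrite ltcE /= => /andP[/eqP -> e0].
  near=> q.
  rewrite normcE lecR.
  apply: (@le_trans _ _ (`|p.1 - q.1| + `|p.2 - q.2|)).
    have -> : c p - c q = (p.1 - q.1)%:C + 'i * (p.2 - q.2)%:C.
      by rewrite /c; apply/eqP; rewrite eq_complex /=;
        rewrite !mul0r !mul1r !subr0 !addr0 !add0r !eqxx.
    apply: le_trans (normc_leD _ _) _.
    rewrite normcM /= !expr0n /= !addr0 !expr1n add0r.
    by rewrite !sqrtr_sqr sqrtr1 mul1r.
  rewrite (splitr e) lerD//.
    near: q; apply: cvgr_dist_le; first exact: cvg_fst.
    by rewrite divr_gt0.
  near: q; apply: cvgr_dist_le; first exact: cvg_snd.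
  by rewrite divr_gt0.
  Unshelve. all: end_near.
have -> : [set z : C | normc z <= r] =
    c @` ((`[- r, r] `*` `[- r, r]) `&` [set p | normc (c p) <= r]).
  apply/seteqP; split=> [[a b] /= abr|_ [p [_ pr] <-] //].
  have ra (x y : R) : Num.sqrt (x ^+ 2 + y ^+ 2) <= r -> - r <= x <= r.
    rewrite -ler_norml -sqrtr_sqr; apply: le_trans.
    by rewrite ler_wsqrtr// lerDl sqr_ge0.
  exists (a, b) => //; split => //; split; rewrite /= in_itv/=.
    exact: ra abr.
  by apply: ra (a) _; rewrite addrC.
apply: continuous_compact; first exact/continuous_subspaceT.
apply: compact_closedI.
  by apply: compact_setX; exact: segment_compact.
apply: (preimage_closed _ (@closed_le _ r)) => p _.
apply: (@continuous_comp _ _ _ c (@normc R)); first exact: cc.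
exact: normc_continuous.
Qed.

Lemma H0_bounded (w : weight R) f :
  in_H0 w f -> has_ubound (weighted_values w f).
Proof.
move=> [af f0].
have [r r1 fr] := f0 1 ltr01.
have : compact ((fun z => normc (f z)) @` [set z : C | normc z <= r]).
  apply: continuous_compact; last exact: disk_compact.
  apply: continuous_in_subspaceT => z; rewrite inE /= => zr.
  apply: (@continuous_comp _ _ _ f (@normc R)); last exact: normc_continuous.
  by apply: analytic_continuous => //; exact: le_lt_trans zr r1.
move=> /compact_bounded[M [_ /(_ (M + 1))]]; rewrite ltrDl ltr01 => /(_ isT) fM.
have w0 : 0 < w 0 := weight_gt0 w (@disk0 R).
exists (1 + w 0 * `|M + 1|) => _ [z dz <-].
have [zr|rz] := leP (normc z) r; last first.
  by rewrite (le_trans (ltW (fr z rz dz)))// lerDl mulr_ge0// ltW.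
rewrite ler_wpDl// ler_pM ?normc_ge0//; first exact/ltW/weight_gt0.
  by apply: weight_noninc => //; rewrite [normc 0](normc0 R) normc_ge0.
rewrite (le_trans _ (ler_norm _))// (le_trans (ler_norm _))//.
by apply: fM; exists z.
Qed.

Lemma in_Hinf0 (w : weight R) : in_Hinf w (0 : C -> C).
Proof.
split; first exact: analytic0.
by exists 0 => _ [z dz <-]; rewrite [normc _](normc0 R) mulr0.
Qed.

Lemma in_HinfP (w : weight R) a f h :
  in_Hinf w f -> in_Hinf w h -> in_Hinf w (a *: f + h).
Proof.
move=> [af [b fb]] [ah [d hd]]; split; first exact: analyticP.
exists (normc a * b + d) => _ [z dz <-].
apply: (@le_trans _ _ (normc a * (w z * normc (f z)) + w z * normc (h z))).
  rewrite mulrCA -mulrDr ler_wpM2l ?(ltW (weight_gt0 w dz))//.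
  by rewrite -normcM; exact: normc_leD.
by rewrite lerD// ?ler_wpM2l ?normc_ge0//; [apply: fb|apply: hd]; exists z.
Qed.

Lemma in_H00 (w : weight R) : in_H0 w (0 : C -> C).
Proof.
split; first exact: analytic0.
by move=> e e0; exists 0 => // z _ _; rewrite [normc _](normc0 R) mulr0.
Qed.

Lemma in_H0P (w : weight R) a f h :
  in_H0 w f -> in_H0 w h -> in_H0 w (a *: f + h).
Proof.
move=> [af f0] [ah h0]; split; first exact: analyticP.
move=> e e0; have a1 : 0 < normc a + 1 by rewrite ltr_wpDl// normc_ge0.
have e2 : 0 < e / 2 by rewrite divr_gt0.
have [r r1 fr] := f0 (e / 2 / (normc a + 1)) (divr_gt0 e2 a1).
have [s s1 hs] := h0 (e / 2) e2.
exists (Num.max r s); first by rewrite gt_max r1.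
move=> z; rewrite gt_max => /andP[rz sz] dz.
apply: (@le_lt_trans _ _ (normc a * (w z * normc (f z)) + w z * normc (h z))).
  rewrite mulrCA -mulrDr ler_wpM2l ?(ltW (weight_gt0 w dz))//.
  by rewrite -normcM; exact: normc_leD.
rewrite (splitr e) ler_ltD//; last exact: hs.
have := fr z rz dz; rewrite ltr_pdivlMr// => /ltW; apply: le_trans.
rewrite mulrC ler_wpM2l ?lerDl// mulr_ge0 ?normc_ge0//.
exact/ltW/weight_gt0.
Qed.

Definition Hinf (w : weight R) : weighted_space R :=
  @WeightedSpace R w (in_Hinf w) (in_Hinf0 w) (@in_HinfP w)
    (fun _ => @proj2 _ _).

Definition H0 (w : weight R) : weighted_space R :=
  @WeightedSpace R w (in_H0 w) (in_H00 w) (@in_H0P w) (@H0_bounded w).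

End Spaces.

Section Operators.
Context {R : realType}.
Local Notation C := R[i].

Definition bounded_operator (X Y : normedModType C) (T : X -> Y) :=
  exists M : R, forall x, `|T x| <= M%:C * `|x|.

(* [`|v|] lies in [R[i]]; [complex.Re `|v|] is the same number in [R]. *)
Definition dual_norm (X : normedModType C) (x' : {scalar X}) : \bar R :=
  ereal_sup [set (complex.Re `|x' x|)%:E | x in [set x : X | `|x| <= 1]].

Definition nuclear (X Y : normedModType C) (T : X -> Y) :=
  exists (x' : nat -> {scalar X}) (y : nat -> Y),
    [/\ forall k, continuous (x' k),
        (\sum_(k <oo) (dual_norm (x' k) * (complex.Re `|y k|)%:E) < +oo)%E
      & forall x, [series x' k x *: y k]_k @ \oo --> T x].

(* [T] is the transformation [S] of functions on the disk, regarded as a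
   linear operator from [E] to [F]. *)
Definition induces (S : (C -> C) -> C -> C) (E F : weighted_space R)
    (T : {linear elements E -> elements F}) :=
  forall f z, disk z -> T f z = S f z.

Definition bounded_between (S : (C -> C) -> C -> C) (E F : weighted_space R) :=
  exists2 T : {linear elements E -> elements F},
    induces S T & bounded_operator T.

Definition nuclear_between (S : (C -> C) -> C -> C) (E F : weighted_space R) :=
  exists2 T : {linear elements E -> elements F},
    induces S T & nuclear T.

(* integral over the disk against area measure normalized to total mass 1 *)
Definition disk_integral (h : C -> \bar R) : \bar R :=
  ((pi^-1)%R%:E * \int[lebesgue_measure \x lebesgue_measure]_(p in
     [set p : R * R | disk (p.1 +i* p.2)]) h (p.1 +i* p.2))%E.

End Operators.

(* Main.v *)
(** Let r_m = 1 - 2^-m, let c_mk = r_m exp(2 i pi k / 2^m) for k < 2^m, put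
    G_s(zeta) = sup_z (1 - |z|^2) mu(z) |g(z)| / |1 - zeta^* phi(z)|^s and
    E_s = sum_m sum_k 2^(-m (s - 1)) G_s(c_mk) / nu(r_m).  Comparing G_s on squares
    around the c_mk, the integral condition is E_(alpha + 3) < oo; by normality of
    nu the finiteness of E_s does not depend on s > beta + 2, so that it amounts
    to E_(N + 3) < oo for an integer N >= alpha.

    Necessity: (1 - |z|^2) mu(z) |(T f)'(z)| is bounded by a multiple of ||T f||,
    so that G_(N + 3)(c) is bounded by the norm of the image of
    f_c(z) = (1 - c^* z)^-(N + 2).  For T = sum_j x'_j (.) y_j, the sum of the weighted
    norms ||T f_(c_mk)|| is at most sum_j ||x'_j|| ||y_j|| times the supremum of the
    norms of unimodular combinations of the weighted f_(c_mk), which are bounded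
    by averaging the Poisson kernel over the roots of unity, together with normality.

    Sufficiency: h = f' is recovered at u as the limit of the Richardson
    extrapolations of the dilations h(r_j u).  Applied to the Cauchy kernel
    1 / (1 - t x), the increments of the extrapolation of order N + 1 are
    multiples of 2^(-j (N + 2)) x^(N + 2) / prod_(i <= N + 2) (1 - r_(j + i) x), which is
    the decay measured by G_(N + 3).  Writing these increments as discrete averages of
    h over circles, refined dyadically, expresses h(phi(z)) as an absolutely summable
    sum of rank one terms, and integration against g gives a nuclear
    representation with values in the little space.

    Cauchy's theory is obtained from Goursat's lemma and from averages over the
    2^m-th roots of unity instead of contour integrals. *)
Require Import Defs.
From HB Require Import structures.
From mathcomp Require Import all_boot all_order all_algebra.
From mathcomp Require Import complex.
From mathcomp Require Import all_classical all_reals all_analysis.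
From mathcomp Require Import measurable_realfun.
From mathcomp Require Import ring lra zify.
Import Order.TTheory GRing.Theory Num.Theory.
Import numFieldNormedType.Exports.
Import ComplexField.Normc.
Local Open Scope classical_set_scope.
Local Open Scope complex_scope.
Local Open Scope ring_scope.
Set Implicit Arguments.
Unset Strict Implicit.
Unset Printing Implicit Defensive.

(** * Modulus, limits and complex derivatives *)

Section ComplexNorm.
Context {R : realType}.
Local Notation C := R[i].
Implicit Types x y z : C.

(** The exponent alpha + 3 is real, while the test functions and the extrapolated kernels have
    integer exponents, so that no complex powers occur; the independence of E_s from s bridges the
    gap, and the condition s > beta + 2 is exactly alpha > beta - 1 for s = alpha + 3. The integral
    is bounded below by step functions on disjoint squares around the c_mk, and above by a series of
    indicators of overlapping squares.

    A nuclear representation is a sum, so circle averages of h times a kernel have to be replaced by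
    sums over fixed nodes. Passing from 2^(n + i) to 2^(n + i + 1) nodes produces terms h' k' - h k
    at adjacent nodes; the averaging weight and the smoothness each gain 2^-i against the 2^i nodes
    that descend from one c_nk, which leaves a geometric series in i. A single Cauchy kernel decays
    only like |1 - zeta^* u|^-1, too little for E_(N + 3); extrapolation replaces it by a product of
    N + 3 comparable factors. *)

Lemma normc_gt0 x : (0 < normc x) = (x != 0).
Proof.
rewrite lt_neqAle normc_ge0 andbT eq_sym; congr (~~ _); apply/eqP/eqP => [|->].
  exact: eq0_normc.
exact: normc0.
Qed.

Lemma normcB_le x y : normc (x - y) <= normc x + normc y.
Proof. by rewrite -(normcN y); exact: normc_leD. Qed.

Lemma normc_distC x y : normc (x - y) = normc (y - x).
Proof. by rewrite -normcN opprB. Qed.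

Lemma normc_dist_trans y x z : normc (x - z) <= normc (x - y) + normc (y - z).
Proof.
by apply: le_trans (normc_leD _ _); rewrite [x - y + _]addrA subrK.
Qed.

Lemma normc_lerB x y : normc x - normc y <= normc (x - y).
Proof. by rewrite lerBlDr -{1}[x](subrK y) normc_leD. Qed.

Lemma normcX x n : normc (x ^+ n) = normc x ^+ n.
Proof. by elim: n => [|n IHn]; rewrite ?normc1// !exprS normcM IHn. Qed.

Lemma normcr (a : R) : 0 <= a -> normc a%:C = a.
Proof. by move=> a0; rewrite normc_real ger0_norm. Qed.

Lemma normc_nat n : normc (n%:R : C) = n%:R.
Proof. by rewrite -(rmorph_nat (real_complex R)) normcr. Qed.

Lemma normcJ x : normc x^* = normc x.
Proof. by case: x => a b /=; rewrite sqrrN. Qed.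

Lemma mulcJ x : x * x^* = (normc x ^+ 2)%:C.
Proof.
case: x => a b /=; rewrite sqr_sqrtr ?addr_ge0 ?sqr_ge0//.
by apply/eqP; rewrite eq_complex /=; apply/andP; split; apply/eqP; ring.
Qed.

Lemma normc_Re x : `|complex.Re x| <= normc x.
Proof. by case: x => a b /=; rewrite -sqrtr_sqr ler_wsqrtr// lerDl sqr_ge0. Qed.

Lemma normc_Im x : `|complex.Im x| <= normc x.
Proof. by case: x => a b /=; rewrite -sqrtr_sqr ler_wsqrtr// lerDr sqr_ge0. Qed.

Lemma normc_le_ReIm x : normc x <= `|complex.Re x| + `|complex.Im x|.
Proof.
case: x => a b /=; rewrite -[leRHS]ger0_norm ?addr_ge0// -sqrtr_sqr ler_wsqrtr//.
rewrite sqrrD !real_normK ?num_real// -addrA [_ *+ 2 + _]addrC addrA.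
by rewrite lerDl mulrn_wge0// mulr_ge0.
Qed.

Lemma normc_sum (I : Type) (r : seq I) (P : pred I) (F : I -> C) :
  normc (\sum_(i <- r | P i) F i) <= \sum_(i <- r | P i) normc (F i).
Proof.
elim/big_rec2: _ => [|i a b _ ab]; first by rewrite normc0.
by rewrite (le_trans (normc_leD _ _))// lerD2l.
Qed.

End ComplexNorm.

Section ComplexSequences.
Context {R : realType}.
Local Notation C := R[i].

(** Convergence with real epsilons: those of the topology of [R[i]] lie in [R[i]] and would have to
    be converted at each use. *)
Definition cvs (u : nat -> C) (l : C) := forall e : R, 0 < e ->
  exists N, forall n, (N <= n)%N -> normc (u n - l) <= e.

Lemma cvs_cst (l : C) : cvs (fun=> l) l.
Proof. by move=> e e0; exists 0%N => n _; rewrite subrr normc0 ltW. Qed.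

Lemma cvsD u v (l m : C) : cvs u l -> cvs v m -> cvs (fun n => u n + v n) (l + m).
Proof.
move=> ul vm e e0; have e2 : 0 < e / 2 by rewrite divr_gt0.
have [N uN] := ul _ e2; have [M vM] := vm _ e2.
exists (maxn N M) => n; rewrite geq_max => /andP[Nn Mn].
by rewrite opprD addrACA (le_trans (normc_leD _ _))// (splitr e) lerD ?uN ?vM.
Qed.

Lemma cvsZ u (a l : C) : cvs u l -> cvs (fun n => a * u n) (a * l).
Proof.
move=> ul e e0; have a1 : 0 < normc a + 1 by rewrite ltr_wpDl// normc_ge0.
have [N uN] := ul (e / (normc a + 1)) (divr_gt0 e0 a1).
exists N => n Nn; rewrite -mulrBr normcM.
apply: (@le_trans _ _ ((normc a + 1) * (e / (normc a + 1)))).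
  by rewrite ler_pM ?normc_ge0 ?lerDl// uN.
by rewrite mulrCA divff ?mulr1// gt_eqF.
Qed.

Lemma cvsB u v (l m : C) : cvs u l -> cvs v m -> cvs (fun n => u n - v n) (l - m).
Proof.
move=> ul vm; rewrite -mulN1r; under [X in cvs X]eq_fun do rewrite -mulN1r.
exact/cvsD/cvsZ.
Qed.

Lemma cvs_ext u v (l : C) : u =1 v -> cvs u l -> cvs v l.
Proof. by move=> /funext ->. Qed.

Lemma cvs_sum n (u : nat -> nat -> C) (l : nat -> C) :
  (forall i, (i < n)%N -> cvs (u i) (l i)) ->
  cvs (fun k => \sum_(i < n) u i k) (\sum_(i < n) l i).
Proof.
elim: n => [|n IHn] ul.
  by rewrite big_ord0; under [X in cvs X]eq_fun do rewrite big_ord0; exact: cvs_cst.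
rewrite big_ord_recr; under [X in cvs X]eq_fun do rewrite big_ord_recr.
by apply: cvsD; [apply: IHn => i ni; apply/ul/ltnW|exact: ul].
Qed.

Lemma cvs_shift k u (l : C) : cvs u l -> cvs (fun n => u (k + n)%N) l.
Proof.
move=> ul e /ul[N uN]; exists N => n Nn; apply/uN/(leq_trans Nn)/leq_addl.
Qed.

(** The bound is asked eventually and up to every [e], because Riemann sums obey their estimates
    only up to a vanishing error. *)
Lemma cvs_le (u : nat -> C) (l a : C) (M : R) : cvs u l ->
  (forall e, 0 < e -> exists N, forall n, (N <= n)%N -> normc (u n - a) <= M + e) ->
  normc (l - a) <= M.
Proof.
move=> ul uM; apply/ler_addgt0Pr => e e0.
have e2 : 0 < e / 2 by rewrite divr_gt0.
have [N uN] := ul _ e2; have [K vK] := uM _ e2.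
rewrite (le_trans (normc_dist_trans (u (maxn N K)) _ _))//.
rewrite (splitr e) addrCA lerD//; first by rewrite normc_distC uN ?leq_maxl.
exact/vK/leq_maxr.
Qed.

Lemma cvs_uniq u (l m : C) : cvs u l -> cvs u m -> l = m.
Proof.
move=> ul um; apply/eqP; rewrite -subr_eq0; apply/eqP/eq0_normc/eqP.
rewrite eq_le normc_ge0 andbT; apply: (cvs_le ul) => e e0.
by have [N uN] := um e e0; exists N => n; rewrite add0r; exact: uN.
Qed.

Lemma cvs_norm_le u (l : C) M : cvs u l -> (forall n, normc (u n) <= M) ->
  normc l <= M.
Proof.
move=> ul uM; rewrite -[l]subr0; apply: (cvs_le ul) => e e0.
by exists 0%N => n _; rewrite subr0 (le_trans (uM n))// lerDl ltW.
Qed.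

(** Completeness is inherited from [R] through the real and imaginary parts, which do not increase
    distances. *)
Lemma cvs_cauchy (u : nat -> C) :
  (forall e : R, 0 < e -> exists N, forall n m, (N <= n)%N -> (N <= m)%N ->
    normc (u n - u m) <= e) -> exists l, cvs u l.
Proof.
move=> cu.
have cvgp (p : {linear Rcomplex R -> R}) :
    (forall x : C, `|p x| <= normc x) -> cvgn (fun n => p (u n) : R^o).
  move=> px; apply: cauchy_cvg; apply/cauchy_exP => e e0.
  have [N uN] := cu _ (divr_gt0 e0 (ltr0n R 2)).
  exists (p (u N)); exists N => // n /= Nn; rewrite /ball /= -raddfB.
  rewrite (le_lt_trans (px _))// (le_lt_trans (uN _ _ _ _))//.
  by rewrite ltr_pdivrMr// ltr_pMr// ltr1n.
pose a := limn (fun n => complex.Re (u n) : R^o).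
pose b := limn (fun n => complex.Im (u n) : R^o).
have ca : (fun n => complex.Re (u n) : R^o) @ \oo --> a.
  by apply: (cvgp (@complex.Re R)); exact: normc_Re.
have cb : (fun n => complex.Im (u n) : R^o) @ \oo --> b.
  by apply: (cvgp (@complex.Im R)); exact: normc_Im.
exists (a +i* b) => e e0; have e2 : 0 < e / 2 by rewrite divr_gt0.
have /cvgrPdist_le/(_ _ e2)[N _ uN] := ca.
have /cvgrPdist_le/(_ _ e2)[M _ vM] := cb.
exists (maxn N M) => n; rewrite geq_max => /andP[Nn Mn].
rewrite (le_trans (normc_le_ReIm _))// (splitr e).
have := uN n Nn; have := vM n Mn; case: (u n) => x y /=.
by rewrite ![`|_ - x|]distrC ![`|_ - y|]distrC => h1 h2; rewrite lerD.
Qed.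

End ComplexSequences.

Section ComplexDerivative.
Context {R : realType}.
Local Notation C := R[i].
Implicit Types (f g : C -> C) (z d : C).

(** The derivative as a first-order expansion. The case [h = 0] is included, so estimates need
    neither quotients nor punctured neighbourhoods. *)
Definition hasd f z d := forall e : R, 0 < e -> exists2 r : R, 0 < r &
  forall h, normc h < r -> normc (f (z + h) - f z - d * h) <= e * normc h.

Lemma nbhs_normcP (z : C) (P : C -> Prop) :
  (\forall w \near z, P w) <->
  exists2 r : R, 0 < r & forall w, normc (w - z) < r -> P w.
Proof.
split=> [/nbhs_ballP[[e e'] /=]|[r r0 rP]].
  rewrite ltcE /= => /andP[/eqP -> e0] eP; exists e => // w wz.
  apply: eP; rewrite -ball_normE /=.
  by have : (normc (z - w))%:C < e%:C :> C by rewrite ltcR normc_distC.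
apply/nbhs_ballP; exists r%:C; first by rewrite /= ltcR.
move=> w; rewrite -ball_normE /= => zw; apply: rP; rewrite normc_distC -ltcR.
exact: zw.
Qed.

Lemma is_derive_hasd f z d : is_derive z 1 f d <-> hasd f z d.
Proof.
have E (h : C) (e : R) : h != 0 ->
    (normc (d - h^-1 *: (f (h *: 1 + z) - f z)) <= e) =
    (normc (f (z + h) - f z - d * h) <= e * normc h).
  move=> h0; rewrite [h *: 1]mulr1 -ler_pdivrMr ?normc_gt0//.
  rewrite -normcV -normcM mulrBl mulfK// normc_distC (addrC h).
  by rewrite -[h^-1 *: _]/(h^-1 * _) [h^-1 * _]mulrC.
split=> [[df dfE]|fd].
  move=> e e0; move: df => /cvg_ex[l fl].
  have dl : d = l by rewrite -dfE; apply: cvg_lim fl.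
  have /(cvgrPdist_le _ _).1/(_ e%:C) := fl.
  rewrite ltcR => /(_ e0); rewrite /dnbhs/= /within/= => /nbhs_normcP[r r0 rP].
  exists r => // h hr; have [->|h0] := eqVneq h 0.
    by rewrite addr0 mulr0 !subrr normc0 mulr0.
  have := rP h; rewrite subr0 => /(_ hr h0).
  by rewrite -dl => H; rewrite -E// -lecR; exact: H.
have lim : (fun h : C => h^-1 *: ((f \o shift z) (h *: 1) - f z)) @ 0^' --> d.
  apply/(cvgrPdist_le _ _).2 => -[e e']; rewrite ltcE /= => /andP[/eqP -> e0].
  have [r r0 rP] := fd _ e0.
  rewrite near_withinE; apply/nbhs_normcP; exists r => // h.
  rewrite subr0 => hr h0.
  have : (normc (d - h^-1 *: (f (h%:A + z) - f z)))%:C <= e%:C :> C.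
    by rewrite lecR E//; exact: rP.
  exact.
by split; [apply/cvg_ex; exists d|exact: cvg_lim lim].
Qed.

Lemma derivable_hasd f z : derivable f z 1 -> hasd f z (derive1 f z).
Proof. by move=> df; apply/is_derive_hasd; rewrite derive1E; exact/derivableP. Qed.

Lemma hasd_derivable f z d : hasd f z d -> derivable f z 1.
Proof. by move=> /is_derive_hasd[]. Qed.

Lemma hasd_derive1 f z d : hasd f z d -> derive1 f z = d.
Proof. by move=> /is_derive_hasd[_]; rewrite derive1E. Qed.

Lemma hasd_eq f g z d r : 0 < r -> (forall w, normc (w - z) < r -> f w = g w) ->
  hasd f z d -> hasd g z d.
Proof.
move=> r0 fg fd e /fd[s s0 sP]; exists (Num.min r s); first by rewrite lt_min r0.
move=> h; rewrite lt_min => /andP[hr hs].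
by rewrite -!fg ?subrr ?normc0//; [exact: sP|rewrite addrC addKr].
Qed.

Lemma hasd_cst a z : hasd (fun=> a) z 0.
Proof. by apply/is_derive_hasd; exact: is_derive_cst. Qed.

Lemma hasd_id z : hasd id z 1.
Proof. by apply/is_derive_hasd; exact: is_derive_id. Qed.

Lemma hasdD f g z a b : hasd f z a -> hasd g z b ->
  hasd (fun w => f w + g w) z (a + b).
Proof.
by move=> /is_derive_hasd ? /is_derive_hasd ?; apply/is_derive_hasd; exact: is_deriveD.
Qed.

Lemma hasdM f g z a b : hasd f z a -> hasd g z b ->
  hasd (fun w => f w * g w) z (f z * b + g z * a).
Proof.
by move=> /is_derive_hasd ? /is_derive_hasd ?; apply/is_derive_hasd; exact: is_deriveM.
Qed.

Lemma hasdZ c f z a : hasd f z a -> hasd (fun w => c * f w) z (c * a).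
Proof.
by move=> fa; have := hasdM (hasd_cst c z) fa; rewrite mulr0 addr0.
Qed.

Lemma hasdB f g z a b : hasd f z a -> hasd g z b ->
  hasd (fun w => f w - g w) z (a - b).
Proof.
move=> fa gb; rewrite -mulN1r.
have := hasdD fa (hasdZ (-1) gb).
by under [X in hasd X _ _]eq_fun do rewrite mulN1r.
Qed.

Lemma hasd_sum n (f : nat -> C -> C) (a : nat -> C) z :
  (forall i, (i < n)%N -> hasd (f i) z (a i)) ->
  hasd (fun w => \sum_(i < n) f i w) z (\sum_(i < n) a i).
Proof.
elim: n => [|n IHn] fa.
  by rewrite big_ord0; under [X in hasd X _ _]eq_fun do rewrite big_ord0; exact: hasd_cst.
rewrite big_ord_recr; under [X in hasd X _ _]eq_fun do rewrite big_ord_recr.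
apply: (@hasdD (fun w => \sum_(i < n) f i w) (f n)); last exact: fa.
by apply: IHn => i ni; apply/fa/ltnW.
Qed.

Lemma hasdV f z a : hasd f z a -> f z != 0 ->
  hasd (fun w => (f w)^-1) z (- a / f z ^+ 2).
Proof.
move=> /is_derive_hasd[fd fE] fz0; apply/is_derive_hasd.
split; first exact: derivableV.
by rewrite deriveV// fE [LHS]mulrC mulrN mulNr.
Qed.

Lemma hasdX f z a n : hasd f z a ->
  hasd (fun w => f w ^+ n) z (n%:R * f z ^+ n.-1 * a).
Proof.
move=> fa; elim: n => [|n IHn]; first by rewrite !mul0r; exact: hasd_cst.
have := hasdM fa IHn; under [X in hasd X _ _]eq_fun do rewrite -exprS.
move: IHn; case: n => [|n] _ /=; rewrite ?mul0r ?mulr0 ?add0r; congr hasd.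
  by rewrite expr0 !mul1r.
by rewrite exprS -[n.+2]addn1 natrD; ring.
Qed.

Lemma hasd_lip f z d : hasd f z d -> exists2 r : R, 0 < r &
  forall h, normc h < r -> normc (f (z + h) - f z) <= (normc d + 1) * normc h.
Proof.
move=> fd; have [r r0 rP] := fd 1 ltr01; exists r => // h /rP; rewrite mul1r => H.
rewrite mulrDl mul1r -normcM -lerBlDl.
by apply: le_trans H; exact: normc_lerB.
Qed.

Lemma hasd_continuous f z d : hasd f z d -> forall e : R, 0 < e ->
  exists2 r : R, 0 < r & forall w, normc (w - z) < r -> normc (f w - f z) < e.
Proof.
move=> /hasd_lip[r r0 rP] e e0.
have d1 : 0 < normc d + 1 by rewrite ltr_wpDl// normc_ge0.
exists (Num.min r (e / (normc d + 1))); first by rewrite lt_min r0 divr_gt0.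
move=> w; rewrite lt_min => /andP[/rP + he]; rewrite [z + _]addrC subrK => H.
by apply: le_lt_trans H _; rewrite mulrC -ltr_pdivlMr.
Qed.

Lemma hasd_comp f g z a b : hasd f z a -> hasd g (f z) b ->
  hasd (fun w => g (f w)) z (b * a).
Proof.
move=> fa gb e e0; have [r r0 rP] := hasd_lip fa.
have a1 : 0 < normc a + 1 by rewrite ltr_wpDl// normc_ge0.
have b1 : 0 < normc b + 1 by rewrite ltr_wpDl// normc_ge0.
have e1 : 0 < e / 2 / (normc a + 1) by rewrite !divr_gt0.
have e2 : 0 < e / 2 / (normc b + 1) by rewrite !divr_gt0.
have [s s0 sP] := gb _ e1; have [t t0 tP] := fa _ e2.
exists (Num.min (Num.min r t) (s / (normc a + 1))).
  by rewrite !lt_min r0 t0 divr_gt0.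
move=> h; rewrite !lt_min => /andP[/andP[/rP fr /tP ft] hs].
have fs : normc (f (z + h) - f z) < s.
  by rewrite (le_lt_trans fr)// mulrC -ltr_pdivlMr.
have := sP _ fs; rewrite addrCA subrr addr0 => gs.
have -> : g (f (z + h)) - g (f z) - b * a * h =
  (g (f (z + h)) - g (f z) - b * (f (z + h) - f z)) +
  b * (f (z + h) - f z - a * h) by ring.
rewrite (le_trans (normc_leD _ _))// [e]splitr mulrDl lerD//.
  rewrite (le_trans gs)// -mulrA ler_wpM2l ?divr_ge0 ?(ltW e0)//.
  by rewrite mulrC ler_pdivrMr// mulrC.
rewrite normcM (le_trans (ler_wpM2l (normc_ge0 _) ft))// mulrA.
rewrite ler_wpM2r ?normc_ge0// mulrCA ler_piMr ?divr_ge0 ?(ltW e0)//.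
by rewrite ler_pdivrMr// mul1r lerDl.
Qed.

Lemma hasd_affine f a b z d : hasd f (a + b * z) d ->
  hasd (fun w => f (a + b * w)) z (b * d).
Proof.
move=> fd; rewrite mulrC; apply: (@hasd_comp (fun w => a + b * w)) => //.
rewrite -[b in hasd _ _ b]add0r -[b in 0 + b]mulr1.
exact: hasdD (hasd_cst _ _) (hasdZ _ (hasd_id _)).
Qed.

End ComplexDerivative.

(** * The mean value inequality *)

Section MeanValue.
Context {R : realType}.
Local Notation C := R[i].
Implicit Types (f : C -> C).

Lemma real_is_derive (p : R -> R) (t l : R) :
  (forall e : R, 0 < e -> exists2 r : R, 0 < r & forall h : R, `|h| < r ->
    `|p (t + h) - p t - l * h| <= e * `|h|) -> is_derive t 1 p l.
Proof.
move=> pl.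
have lim : (fun h : R => h^-1 *: ((p \o shift t) (h *: 1) - p t)) @ 0^' --> l.
  apply/(cvgrPdist_le _ _).2 => e e0; have [r r0 rP] := pl _ e0.
  rewrite near_withinE; apply/nbhs_ballP; exists r => // h.
  rewrite /ball/= sub0r normrN => hr h0.
  have -> : l - h^-1 *: ((p \o shift t) (h *: 1) - p t) =
      - ((p (t + h) - p t - l * h) / h).
    rewrite /= [h *: 1]mulr1 mulrBl mulfK// opprB addrC [h + t]addrC.
    by rewrite [_ *: _]mulrC addrC.
  by rewrite normrN normrM normfV ler_pdivrMr ?normr_gt0// rP.
by split; [apply/cvg_ex; exists l|exact: cvg_lim lim].
Qed.

(* [p] stands for the real part of multiplication by a complex number of
   modulus at most 1. *)
Lemma seg_is_derive f (a b d : C) (t : R) (p : C -> R) :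
  {morph p : x y / x - y} ->
  (forall x, `|p x| <= normc x) -> (forall (r : R) x, p (r%:C * x) = r * p x) ->
  hasd f (a + t%:C * (b - a)) d ->
  is_derive t 1 (fun s : R => p (f (a + s%:C * (b - a)))) (p (d * (b - a))).
Proof.
move=> pB p1 pZ fd; apply: real_is_derive => e e0.
have ba0 : 0 < normc (b - a) + 1 by rewrite ltr_wpDl// normc_ge0.
have [r r0 rP] := fd _ (divr_gt0 e0 ba0).
exists (r / (normc (b - a) + 1)); first exact: divr_gt0.
move=> h hr.
have hr' : normc (h%:C * (b - a)) < r.
  rewrite normcM normc_real; apply: le_lt_trans (_ : `|h| * (normc (b - a) + 1) < _).
    by rewrite ler_wpM2l// lerDl.
  by rewrite -ltr_pdivlMr.
have := rP _ hr'; set X := f _ - _ - _ => XP.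
have -> : p (f (a + (t + h)%:C * (b - a))) - p (f (a + t%:C * (b - a))) -
   p (d * (b - a)) * h = p X.
  rewrite /X !pB rmorphD mulrDl addrA; congr (_ - _).
  by rewrite mulrC -pZ mulrCA.
rewrite (le_trans (p1 _))// (le_trans XP)//.
rewrite normcM normc_real mulrCA mulrC ler_wpM2r// mulrAC ler_pdivrMr//.
by rewrite ler_wpM2l ?lerDl ?ltW.
Qed.

(** Reduction to the real mean value theorem: the unimodular [c] turns [f b - f a] into its modulus,
    and the theorem is applied to the real part of [c * f] along the segment. *)
Lemma mean_value_le f (d : C -> C) (a b : C) (M : R) :
  (forall t : R, 0 <= t <= 1 -> hasd f (a + t%:C * (b - a)) (d (a + t%:C * (b - a)))) ->
  (forall t : R, 0 <= t <= 1 -> normc (d (a + t%:C * (b - a))) <= M) ->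
  normc (f b - f a) <= M * normc (b - a).
Proof.
move=> fd dM; have [->|fba] := eqVneq (f b) (f a).
  rewrite subrr normc0 mulr_ge0 ?normc_ge0//.
  by apply: le_trans (dM 0 _); rewrite ?normc_ge0// lexx ler01.
have n0 : 0 < normc (f b - f a) by rewrite normc_gt0 subr_eq0.
pose c := (f b - f a)^* * ((normc (f b - f a))^-1)%:C.
have c1 : normc c = 1.
  by rewrite normcM normcJ normcr ?invr_ge0 ?normc_ge0// divff// gt_eqF.
pose p (x : C) := complex.Re (c * x).
have pE x : p x = complex.Re (c * x) by [].
have pB : {morph p : x y / x - y}.
  by move=> x y; rewrite !pE mulrBr; case: (c * x); case: (c * y).
have p1 x : `|p x| <= normc x.
  by rewrite pE (le_trans (normc_Re _))// normcM c1 mul1r.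
have pZ (r : R) x : p (r%:C * x) = r * p x.
  by rewrite !pE mulrCA; case: (c * x) => u v /=; rewrite mul0r subr0.
have pd (t : R) : 0 <= t <= 1 -> is_derive t 1 (fun s : R => p (f (a + s%:C * (b - a))))
    (p (d (a + t%:C * (b - a)) * (b - a))).
  by move=> t01; apply: seg_is_derive => //; exact: fd.
have [|t|s|t t01] := @MVT R (fun s : R => p (f (a + s%:C * (b - a))))
    (fun t => p (d (a + t%:C * (b - a)) * (b - a))) 0 1.
- exact: ltr01.
- by rewrite in_itv/= => /andP[/ltW t0 /ltW t1]; apply: pd; rewrite t0.
- have : {within `[0, 1], continuous (fun s : R => p (f (a + s%:C * (b - a))))}.
    apply: derivable_within_continuous => t; rewrite in_itv/= => t01.
    by have [] := pd _ t01.
  exact.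
rewrite subr0 mulr1 rmorph1 mul1r [a + (b - a)]addrC subrK rmorph0 mul0r addr0 => E.
have -> : normc (f b - f a) = p (f b - f a).
  rewrite pE /c mulrAC [_^* * _]mulrC mulcJ -rmorphM/= expr2 mulfK//.
  by rewrite gt_eqF.
rewrite pB E (le_trans (ler_norm _))// (le_trans (p1 _))// normcM.
rewrite ler_wpM2r ?normc_ge0// dM//.
by move: t01; rewrite in_itv/= => /andP[/ltW -> /ltW ->].
Qed.

End MeanValue.

Section Disk.
Context {R : realType}.
Local Notation C := R[i].
Implicit Types (f h : C -> C).

Lemma normc_seg (a b : C) (r t : R) : normc a <= r -> normc b <= r ->
  0 <= t <= 1 -> normc (a + t%:C * (b - a)) <= r.
Proof.
move=> ar br /andP[t0 t1].
have -> : a + t%:C * (b - a) = (1 - t)%:C * a + t%:C * b by rewrite rmorphB/=; ring.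
rewrite (le_trans (normc_leD _ _))// !normcM !normcr ?subr_ge0//.
rewrite (_ : r = (1 - t) * r + t * r); last by ring.
by rewrite lerD// ler_wpM2l// subr_ge0.
Qed.

Lemma analytic_hasd h z : analytic h -> disk z -> hasd h z (derive1 h z).
Proof. by move=> ha dz; apply/derivable_hasd/ha. Qed.

Lemma hasd_analytic h (d : C -> C) : (forall z, disk z -> hasd h z (d z)) ->
  analytic h.
Proof. by move=> hd z dz; apply/hasd_derivable/hd. Qed.

Lemma disk_open (z : C) : disk z ->
  exists2 r : R, 0 < r & forall w, normc (w - z) < r -> disk w.
Proof.
move=> dz; exists (1 - normc z) => [|w wz]; first by rewrite subr_gt0.
rewrite /disk/= -[w](subrK z) (le_lt_trans (normc_leD _ _))//.
by rewrite -ltrBrDr.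
Qed.

(** Heine's argument on the compact disk of radius [r]; only [z] is confined to that disk, [w] may
    leave it. *)
Lemma analytic_unif_cont h (r : R) : analytic h -> r < 1 ->
  forall e : R, 0 < e -> exists2 d : R, 0 < d & forall z w,
    normc z <= r -> normc (w - z) < d -> normc (h w - h z) <= e.
Proof.
move=> ha r1 e e0.
have := @compact_near_coveringP _ [set z : C | normc z <= r].
move=> [/(_ (@disk_compact R r)) + _].
move=> /(_ R (0^'+) (fun d z => forall w, normc (w - z) < d -> normc (h w - h z) <= e) _).
case.
  move=> z zr.
  have dz : disk z by exact: le_lt_trans zr r1.
  have [s s0 sP] := hasd_continuous (analytic_hasd ha dz) (divr_gt0 e0 (ltr0n R 2)).
  exists ([set x | normc (x - z) < s / 2], [set d | d < s / 2]).
    split; last by apply: nbhs_right_lt; rewrite divr_gt0.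
    by apply/nbhs_normcP; exists (s / 2) => //; rewrite divr_gt0.
  move=> [x d] /= [xz ds] w wx.
  rewrite (le_trans (normc_dist_trans (h z) _ _))// (splitr e) lerD//.
    rewrite ltW// sP//.
    rewrite (le_lt_trans (normc_dist_trans x _ _))// (splitr s) ltrD//.
    exact: lt_trans wx ds.
  rewrite normc_distC ltW// sP// (lt_trans xz)//.
  by rewrite ltr_pdivrMr// ltr_pMr// ltr1n.
move=> d d0 dP; exists (d / 2); first by rewrite divr_gt0.
move=> z w zr; apply: (dP (d / 2)) => //=.
  by rewrite sub0r normrN gtr0_norm ?divr_gt0// ltr_pdivrMr// ltr_pMr// ltr1n.
by rewrite divr_gt0.
Qed.

End Disk.

(** * Goursat's lemma and primitives *)

Section RiemannSums.
Context {R : realType}.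
Local Notation C := R[i].
Implicit Types (h : C -> C) (a b c : C).

Definition mid a b : C := (a + b) / 2%:R.

Lemma midC a b : mid a b = mid b a.
Proof. by rewrite /mid addrC. Qed.

Lemma mid_l a b : mid a b - a = (b - a) / 2%:R.
Proof. by rewrite /mid; field. Qed.

Lemma mid_r a b : b - mid a b = (b - a) / 2%:R.
Proof. by rewrite /mid; field. Qed.

Lemma normc_half a : normc (a / 2%:R) = normc a / 2.
Proof. by rewrite normcM normcV normc_nat. Qed.

Lemma mid_ball a b p (r : R) : normc (a - p) <= r -> normc (b - p) <= r ->
  normc (mid a b - p) <= r.
Proof.
move=> ar br; have -> : mid a b - p = (a - p) / 2%:R + (b - p) / 2%:R.
  by rewrite /mid; field.
by rewrite (le_trans (normc_leD _ _))// !normc_half [r]splitr lerD// ler_pM2r.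
Qed.

(* The recursion makes the additivity of left Riemann sums under bisection
   definitional. *)
Fixpoint rsum h n a b : C := match n with
  | 0 => h a * (b - a)
  | n'.+1 => rsum h n' a (mid a b) + rsum h n' (mid a b) b
  end.

Lemma rsumB h1 h2 n a b :
  rsum (fun z => h1 z - h2 z) n a b = rsum h1 n a b - rsum h2 n a b.
Proof. by elim: n a b => [|n IHn] a b /=; rewrite ?mulrBl// !IHn; ring. Qed.

Lemma rsum_cst c n a b : rsum (fun=> c) n a b = c * (b - a).
Proof. by elim: n a b => [|n IHn] a b //=; rewrite !IHn; ring. Qed.

(** For an affine integrand the left sum differs from the midpoint value, which is the exact
    integral, by a term that is halved at each bisection. *)
Lemma rsum_affine c d n a b : rsum (fun z => c + d * z) n a b =
  (c + d * mid a b) * (b - a) - d * (b - a) ^+ 2 / 2%:R ^+ n.+1.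
Proof.
have two k : (2%:R : C) ^+ k != 0 by rewrite expf_neq0 // pnatr_eq0.
elim: n a b => [|n IHn] a b /=; first by rewrite /mid; field.
rewrite !IHn /mid !exprS; field; exact: two.
Qed.

Lemma rsum_le h n a b p (r M : R) :
  (forall z, normc (z - p) <= r -> normc (h z) <= M) ->
  normc (a - p) <= r -> normc (b - p) <= r ->
  normc (rsum h n a b) <= M * normc (b - a).
Proof.
move=> hM; elim: n a b => [|n IHn] a b ar br /=.
  by rewrite normcM ler_wpM2r ?normc_ge0// hM.
have mr := mid_ball ar br.
rewrite (le_trans (normc_leD _ _))//.
apply: le_trans (lerD (IHn _ _ ar mr) (IHn _ _ mr br)) _.
by rewrite mid_l mid_r normc_half -mulrDr -splitr.
Qed.

Section Limit.
Variables (h : C -> C) (r : R).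
Hypothesis (ha : analytic h) (r1 : r < 1).

Lemma pow2_small (d s : R) : 0 < d -> exists N, s / 2 ^+ N < d.
Proof.
move=> d0; have [N] := ubnP (Num.truncn (s / d)) => _.
exists (Num.truncn (s / d)).+1.
rewrite ltr_pdivrMr ?exprn_gt0// mulrC -ltr_pdivrMr//.
apply: lt_le_trans (truncnS_gt _) _.
by rewrite -natrX ler_nat ltnW// ltn_expl.
Qed.

(** Once the pieces are shorter than the modulus of continuity of [h], refinement hardly changes the
    sum, and the reversed path nearly cancels it, since reversal only exchanges left and right
    endpoints. *)
Lemma rsum_close (e : R) : 0 < e -> exists2 d : R, 0 < d & forall k m a b,
  normc a <= r -> normc b <= r -> normc (b - a) / 2 ^+ k < d ->
  normc (rsum h (k + m) a b - rsum h k a b) <= e * normc (b - a) /\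
  normc (rsum h k a b + rsum h k b a) <= e * normc (b - a).
Proof.
move=> e0; have [d d0 dP] := analytic_unif_cont ha r1 e0; exists d => // k m.
have mr a b : normc a <= r -> normc b <= r -> normc (mid a b) <= r.
  by move=> ar br; rewrite -[mid a b]subr0 mid_ball ?subr0.
elim: k => [|k IHk] a b ar br.
  rewrite expr0 divr1 add0n /= => ba; split.
    have := @rsum_le (fun z => h z - h a) m a b a (normc (b - a)) e.
    rewrite rsumB rsum_cst; apply => //.
      by move=> z za; apply: dP ar (le_lt_trans za ba).
    by rewrite subrr normc0 normc_ge0.
  have -> : h a * (b - a) + h b * (a - b) = - ((h b - h a) * (b - a)) by ring.
  by rewrite normcN normcM ler_wpM2r ?normc_ge0// dP.
rewrite exprS invfM mulrA addSn /= => ba.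
have [h1 h2] : normc (mid a b - a) / 2 ^+ k < d /\ normc (b - mid a b) / 2 ^+ k < d.
  by rewrite mid_l mid_r normc_half.
have [A1 A2] := IHk _ _ ar (mr _ _ ar br) h1.
have [B1 B2] := IHk _ _ (mr _ _ ar br) br h2.
have E : e * normc (b - a) = e * normc (mid a b - a) + e * normc (b - mid a b).
  by rewrite mid_l mid_r normc_half -mulrDr -splitr.
split; rewrite E.
  rewrite opprD addrACA (le_trans (normc_leD _ _))// lerD//.
rewrite [mid b a]midC addrACA [X in _ + X]addrC.
rewrite (_ : _ + _ + _ = (rsum h k a (mid a b) + rsum h k (mid a b) a) +
  (rsum h k (mid a b) b + rsum h k b (mid a b))); last by ring.
by rewrite (le_trans (normc_leD _ _))// lerD//.
Qed.

Lemma rsum_cvg a b : normc a <= r -> normc b <= r ->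
  exists l, cvs (fun n => rsum h n a b) l.
Proof.
move=> ar br; apply: cvs_cauchy => e e0.
have n1 : 0 < normc (b - a) + 1 by rewrite ltr_wpDl// normc_ge0.
have [d d0 dP] := rsum_close (divr_gt0 (divr_gt0 e0 (ltr0n R 2)) n1).
have [N Nd] := pow2_small (normc (b - a)) d0; exists N => n m Nn Nm.
have le2 : e / 2 / (normc (b - a) + 1) * normc (b - a) <= e / 2.
  by rewrite mulrAC ler_pdivrMr// ler_wpM2l ?lerDl ?divr_ge0 ?ltW.
rewrite (le_trans (normc_dist_trans (rsum h N a b) _ _))// (splitr e) lerD//.
  rewrite -(subnKC Nn); apply: le_trans le2.
  by have [] := dP N (n - N)%N _ _ ar br Nd.
rewrite normc_distC -(subnKC Nm); apply: le_trans le2.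
by have [] := dP N (m - N)%N _ _ ar br Nd.
Qed.

Lemma rsum_rev a b l : normc a <= r -> normc b <= r ->
  cvs (fun n => rsum h n a b) l -> cvs (fun n => rsum h n b a) (- l).
Proof.
move=> ar br ab.
suff : cvs (fun n => rsum h n a b + rsum h n b a) 0.
  move=> H; have := cvsB H ab; rewrite add0r; apply: cvs_ext => n; ring.
move=> e e0; have n1 : 0 < normc (b - a) + 1 by rewrite ltr_wpDl// normc_ge0.
have [d d0 dP] := rsum_close (divr_gt0 e0 n1).
have [N Nd] := pow2_small (normc (b - a)) d0; exists N => n Nn; rewrite subr0.
have [|_] := dP n 0%N _ _ ar br.
  apply: le_lt_trans Nd; rewrite ler_wpM2l ?normc_ge0//.
  by rewrite lef_pV2 ?posrE ?exprn_gt0// ler_eXn2l// ltr1n.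
move=> /le_trans; apply; rewrite mulrAC ler_pdivrMr//.
by rewrite ler_wpM2l ?lerDl// ltW.
Qed.

End Limit.

End RiemannSums.

Section Goursat.
Context {R : realType}.
Local Notation C := R[i].
Variable h : C -> C.
Hypothesis ha : analytic h.
Implicit Types (a b c p : C).

(** [xget] yields the limit of the Riemann sums if there is one and 0 otherwise; for endpoints in
    the disk the limit exists. *)
Definition segint a b : C := xget 0 [set l | cvs (fun n => rsum h n a b) l].

Lemma segintP a b : disk a -> disk b -> cvs (fun n => rsum h n a b) (segint a b).
Proof.
move=> da db; apply: (@xgetPex _ 0 [set l | cvs (fun n => rsum h n a b) l]).
apply: (@rsum_cvg _ h (Num.max (normc a) (normc b))) => //.
- by rewrite gt_max da.
- by rewrite le_max lexx.
- by rewrite le_max lexx orbT.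
Qed.

Lemma disk_mid a b : disk a -> disk b -> disk (mid a b).
Proof.
move=> da db; apply: (@le_lt_trans _ _ (Num.max (normc a) (normc b))).
  by rewrite -[mid a b]subr0 mid_ball// subr0 le_max lexx ?orbT.
by rewrite gt_max da.
Qed.

Lemma segint_mid a b : disk a -> disk b ->
  segint a b = segint a (mid a b) + segint (mid a b) b.
Proof.
move=> da db; have dm := disk_mid da db.
apply: cvs_uniq (cvs_shift 1 (segintP da db)) _.
exact: cvsD (segintP da dm) (segintP dm db).
Qed.

Lemma segint_rev a b : disk a -> disk b -> segint b a = - segint a b.
Proof.
move=> da db; apply: cvs_uniq (segintP db da) _.
apply: (@rsum_rev _ h (Num.max (normc a) (normc b))) => //.
- by rewrite gt_max da.
- by rewrite le_max lexx.
- by rewrite le_max lexx orbT.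
- exact: segintP.
Qed.

Lemma segint_affine a b p u d (r e : R) : disk a -> disk b ->
  (forall z, normc (z - p) <= r -> normc (h z - (u + d * (z - p))) <= e) ->
  normc (a - p) <= r -> normc (b - p) <= r ->
  normc (segint a b - (u + d * (mid a b - p)) * (b - a)) <= e * normc (b - a).
Proof.
move=> da db he ar br; apply: (cvs_le (segintP da db)) => t t0.
pose K := normc (d * (b - a) ^+ 2).
have [N NK] := pow2_small K t0; exists N => n Nn.
pose A z := (u - d * p) + d * z.
have := @rsum_le _ (fun z => h z - A z) n a b p r e.
rewrite rsumB rsum_affine.
have AE z : A z = u + d * (z - p) by rewrite /A; ring.
rewrite -/(A (mid a b)) AE => H.
rewrite opprB addrA in H.
have -> : rsum h n a b - (u + d * (mid a b - p)) * (b - a) =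
  (rsum h n a b + d * (b - a) ^+ 2 / 2%:R ^+ n.+1 - (u + d * (mid a b - p)) * (b - a))
    - d * (b - a) ^+ 2 / 2%:R ^+ n.+1 by ring.
rewrite (le_trans (normcB_le _ _))// lerD//.
  by apply: H => // z zr; rewrite AE he.
rewrite normcM normcV normcX normc_nat -/K; apply/ltW/le_lt_trans/NK.
rewrite ler_wpM2l ?normc_ge0// lef_pV2 ?posrE ?exprn_gt0// ler_eXn2l ?ltr1n//.
exact: leq_trans Nn _.
Qed.

Definition tri a b c := segint a b + segint b c + segint c a.
Definition perim a b c := normc (b - a) + normc (c - b) + normc (a - c).

(** The midpoints cut out four triangles; each inner edge is traversed twice, in opposite
    directions. *)
Lemma tri_split a b c : disk a -> disk b -> disk c ->
  tri a b c = tri a (mid a b) (mid c a) + tri b (mid b c) (mid a b) +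
    (tri c (mid c a) (mid b c) + tri (mid a b) (mid b c) (mid c a)).
Proof.
move=> da db dc; rewrite /tri (segint_mid da db) (segint_mid db dc) (segint_mid dc da).
have [dab dbc dca] := And3 (disk_mid da db) (disk_mid db dc) (disk_mid dc da).
rewrite (segint_rev dab dca) (segint_rev dbc dab) (segint_rev dca dbc).
ring.
Qed.

(** One of the four subtriangles carries at least a quarter of the integral. The hypotheses stand
    under the existential so that [choice] yields a total step function, which can be iterated. *)
Lemma tri_step (T : C * C * C) : exists T' : C * C * C,
  disk T.1.1 -> disk T.1.2 -> disk T.2 ->
  let r := Num.max (Num.max (normc T.1.1) (normc T.1.2)) (normc T.2) in
  [/\ [/\ normc T'.1.1 <= r, normc T'.1.2 <= r & normc T'.2 <= r],
      normc (tri T.1.1 T.1.2 T.2) <= 4 * normc (tri T'.1.1 T'.1.2 T'.2),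
      perim T'.1.1 T'.1.2 T'.2 = perim T.1.1 T.1.2 T.2 / 2 &
      normc (T'.1.1 - T.1.1) <= perim T.1.1 T.1.2 T.2].
Proof.
case: T => [[a b] c] /=.
have [da|] := pselect (disk a); last by exists (a, b, c).
have [db|] := pselect (disk b); last by exists (a, b, c).
have [dc|] := pselect (disk c); last by exists (a, b, c).
set r := Num.max _ _.
have [ar br cr] : [/\ normc a <= r, normc b <= r & normc c <= r].
  by rewrite /r !le_max !lexx !orbT.
have mr x y : normc x <= r -> normc y <= r -> normc (mid x y) <= r.
  by move=> xr yr; rewrite -[mid x y]subr0 mid_ball ?subr0.
have p0 : 0 <= perim a b c by rewrite !addr_ge0 ?normc_ge0.
have n1 : normc (b - a) <= perim a b c by rewrite /perim -addrA lerDl addr_ge0 ?normc_ge0.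
have n2 : normc (a - c) <= perim a b c by rewrite /perim lerDr addr_ge0 ?normc_ge0.
have half x : 0 <= x -> x / 2 <= x :> R.
  by move=> x0; rewrite ler_pdivrMr// ler_peMr// ler1n.
have P1 : perim a (mid a b) (mid c a) = perim a b c / 2.
  rewrite /perim mid_l mid_r normc_half.
  have -> : mid c a - mid a b = (c - b) / 2%:R by rewrite /mid; field.
  by rewrite !normc_half; ring.
have P2 : perim b (mid b c) (mid a b) = perim a b c / 2.
  rewrite /perim mid_l mid_r normc_half.
  have -> : mid a b - mid b c = (a - c) / 2%:R by rewrite /mid; field.
  by rewrite !normc_half; ring.
have P3 : perim c (mid c a) (mid b c) = perim a b c / 2.
  rewrite /perim mid_l mid_r normc_half.
  have -> : mid b c - mid c a = (b - a) / 2%:R by rewrite /mid; field.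
  by rewrite !normc_half; ring.
have P4 : perim (mid a b) (mid b c) (mid c a) = perim a b c / 2.
  rewrite /perim.
  have -> : mid b c - mid a b = - (a - c) / 2%:R by rewrite /mid; field.
  have -> : mid c a - mid b c = - (b - a) / 2%:R by rewrite /mid; field.
  have -> : mid a b - mid c a = - (c - b) / 2%:R by rewrite /mid; field.
  by rewrite !normc_half !normcN; ring.
have := tri_split da db dc.
set t1 := tri a (mid a b) _; set t2 := tri b _ _; set t3 := tri c _ _; set t4 := tri (mid a b) _ _.
set t := normc (tri a b c) => E.
have L : t <= normc t1 + normc t2 + (normc t3 + normc t4).
  by rewrite /t E (le_trans (normc_leD _ _))// lerD// normc_leD.
have [G1|L1] := leP t (4 * normc t1).
  exists (a, mid a b, mid c a) => _ _ _; split => /=; rewrite ?subrr ?normc0//.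
  by split=> //; exact: mr.
have [G2|L2] := leP t (4 * normc t2).
  exists (b, mid b c, mid a b) => _ _ _; split => //=.
  by split=> //; exact: mr.
have [G3|L3] := leP t (4 * normc t3).
  exists (c, mid c a, mid b c) => _ _ _; split => //=; last by rewrite normc_distC.
  by split=> //; exact: mr.
exists (mid a b, mid b c, mid c a) => _ _ _; split => //=.
- by split; exact: mr.
- rewrite -/t4; move: L L1 L2 L3; lra.
- by rewrite mid_l normc_half (le_trans (half _ _)) ?normc_ge0.
Qed.

Lemma goursat a b c : disk a -> disk b -> disk c -> tri a b c = 0.
Proof.
move=> da db dc; have [step stepP] := choice tri_step.
pose T n := iter n step (a, b, c).
pose r := Num.max (Num.max (normc a) (normc b)) (normc c).
have r1 : r < 1 by rewrite /r !gt_max da db.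
pose s := perim a b c; pose eta := normc (tri a b c).
have s0 : 0 <= s by rewrite !addr_ge0 ?normc_ge0.
pose A n := (T n).1.1; pose B n := (T n).1.2; pose D n := (T n).2.
have Tr n : [/\ normc (A n) <= r, normc (B n) <= r & normc (D n) <= r].
  elim: n => [|n [An Bn Dn]]; first by rewrite /A /B /D /= /r !le_max !lexx !orbT.
  have [] := stepP (T n).
  - exact: le_lt_trans An r1.
  - exact: le_lt_trans Bn r1.
  - exact: le_lt_trans Dn r1.
  move=> [h1 h2 h3] _ _ _.
  have mr : Num.max (Num.max (normc (A n)) (normc (B n))) (normc (D n)) <= r.
    by rewrite !ge_max An Bn.
  by split; [apply: le_trans h1 mr|apply: le_trans h2 mr|apply: le_trans h3 mr].
have dA n : disk (A n) by have [h1 _ _] := Tr n; exact: le_lt_trans h1 r1.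
have dB n : disk (B n) by have [_ h1 _] := Tr n; exact: le_lt_trans h1 r1.
have dD n : disk (D n) by have [_ _ h1] := Tr n; exact: le_lt_trans h1 r1.
have pT n : perim (A n) (B n) (D n) = s / 2 ^+ n.
  elim: n => [|n IHn]; first by rewrite expr0 divr1.
  have [_ _ + _] := stepP (T n) (dA n) (dB n) (dD n).
  by rewrite -/(A n) -/(B n) -/(D n) IHn exprS invfM [2^-1 * _]mulrC mulrA.
have tT n : eta <= 4 ^+ n * normc (tri (A n) (B n) (D n)).
  elim: n => [|n IHn]; first by rewrite expr0 mul1r.
  have [_ + _ _] := stepP (T n) (dA n) (dB n) (dD n).
  rewrite -/(A n) -/(B n) -/(D n) => H; apply: le_trans IHn _.
  by rewrite exprSr -mulrA ler_wpM2l// exprn_ge0.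
have AT n : normc (A n.+1 - A n) <= s / 2 ^+ n.
  by have [_ _ _] := stepP (T n) (dA n) (dB n) (dD n); rewrite pT.
clearbody A B D.
have Acau n m : normc (A (n + m)%N - A n) <= 2 * s / 2 ^+ n - 2 * s / 2 ^+ (n + m).
  elim: m => [|m IHm]; first by rewrite addn0 !subrr normc0.
  rewrite (le_trans (normc_dist_trans (A (n + m)%N) _ _))// addnS.
  apply: le_trans (lerD (AT _) IHm) _.
  have -> : 2 * s / 2 ^+ (n + m).+1 = s / 2 ^+ (n + m).
    by rewrite exprS; field; rewrite expf_neq0// pnatr_eq0.
  by rewrite -!mulrA; lra.
have Acau' n m : normc (A (n + m)%N - A n) <= 2 * s / 2 ^+ n.
  apply: le_trans (Acau n m) _; rewrite gerBl.
  by rewrite divr_ge0 ?mulr_ge0 ?exprn_ge0.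
have [p Ap] : exists p, cvs A p.
  apply: cvs_cauchy => e e0; have [N NP] := pow2_small (4 * s) e0.
  exists N => n m /subnKC <- /subnKC <-.
  apply: le_trans (normc_dist_trans (A N) _ _) _; apply/ltW/le_lt_trans/NP.
  rewrite [normc (A N - _)]normc_distC.
  apply: le_trans (lerD (Acau' _ _) (Acau' _ _)) _.
  by rewrite -mulrDl -mulrDl -natrD.
have pr : normc p <= r by apply: (cvs_norm_le Ap) => n; have [] := Tr n.
have dp : disk p by exact: le_lt_trans pr r1.
have Anp n : normc (A n - p) <= 2 * s / 2 ^+ n.
  rewrite normc_distC; apply: (cvs_le (cvs_shift n Ap)) => e e0.
  by exists 0%N => m _; rewrite (le_trans (Acau' n m))// lerDl ltW.
have s3 : s + 2 * s = 3 * s by ring.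
have Bnp n : normc (B n - p) <= 3 * s / 2 ^+ n.
  apply: le_trans (normc_dist_trans (A n) _ _) _.
  have : normc (B n - A n) <= s / 2 ^+ n.
    by rewrite -pT /perim -addrA lerDl addr_ge0 ?normc_ge0.
  by move=> /lerD/(_ (Anp n)) /le_trans; apply; rewrite -mulrDl s3.
have Dnp n : normc (D n - p) <= 3 * s / 2 ^+ n.
  apply: le_trans (normc_dist_trans (A n) _ _) _.
  have : normc (D n - A n) <= s / 2 ^+ n.
    by rewrite -pT /perim normc_distC lerDr addr_ge0 ?normc_ge0.
  by move=> /lerD/(_ (Anp n)) /le_trans; apply; rewrite -mulrDl s3.
(* [rho] bounds the distance of the [n]-th triangle's vertices to [p]; [e * rho * perim] is of order
   4^-n, which offsets the factor 4^n lost in the subdivisions. *)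
have key e : 0 < e -> eta <= e * (3 * s * s).
  move=> e0; have [d d0 dP] := analytic_hasd ha dp e0.
  have [n nd] := pow2_small (3 * s) d0.
  set rho := 3 * s / 2 ^+ n in nd.
  have he z : normc (z - p) <= rho ->
      normc (h z - (h p + derive1 h p * (z - p))) <= e * rho.
    move=> zp; have := dP (z - p) (le_lt_trans zp nd); rewrite subrKC opprD addrA.
    by move=> /le_trans; apply; rewrite ler_wpM2l// ltW.
  have Anr : normc (A n - p) <= rho.
    apply: le_trans (Anp n) _; rewrite ler_wpM2r ?invr_ge0 ?exprn_ge0//.
    by rewrite ler_wpM2r// ler_nat.
  have S1 := segint_affine (dA n) (dB n) he Anr (Bnp n).
  have S2 := segint_affine (dB n) (dD n) he (Bnp n) (Dnp n).
  have S3 := segint_affine (dD n) (dA n) he (Dnp n) Anr.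
  apply: le_trans (tT n) _; rewrite mulrC -ler_pdivlMr ?exprn_gt0//.
  have -> : e * (3 * s * s) / 4 ^+ n = e * rho * perim (A n) (B n) (D n).
    rewrite pT /rho (_ : 4 = 2 * 2) ?exprMn; last by rewrite -natrM.
    by field; rewrite expf_neq0// pnatr_eq0.
  (* The affine part of [h] at [p] has zero integral around the triangle, so its midpoint values may
     be subtracted edge by edge. *)
  rewrite /perim !mulrDr; apply: le_trans (_ : normc (
    (segint (A n) (B n) - (h p + derive1 h p * (mid (A n) (B n) - p)) * (B n - A n)) +
    (segint (B n) (D n) - (h p + derive1 h p * (mid (B n) (D n) - p)) * (D n - B n)) +
    (segint (D n) (A n) - (h p + derive1 h p * (mid (D n) (A n) - p)) * (A n - D n)))
    <= _).
    rewrite le_eqVlt; apply/orP; left; apply/eqP; congr normc.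
    by rewrite /tri /mid; field.
  apply: le_trans (normc_leD _ _) _; apply: lerD S3.
  by apply: le_trans (normc_leD _ _) _; exact: lerD.
apply: eq0_normc; apply/eqP; rewrite eq_le normc_ge0 andbT -/eta.
have k0 : 0 < 3 * s * s + 1 by rewrite ltr_wpDl// !mulr_ge0.
apply/ler_addgt0Pr => e e0; rewrite add0r (le_trans (key _ (divr_gt0 e0 k0)))//.
by rewrite mulrAC ler_pdivrMr// ler_wpM2l ?lerDl// ltW.
Qed.

(** By Goursat's lemma on the triangle 0, [z], [z + t], the increment of [segint 0] is the integral
    over the short edge, where [h] is nearly constant. *)
Lemma primitive z : disk z -> hasd (segint 0) z (h z).
Proof.
move=> dz e e0; have [r r0 rP] := disk_open dz.
have [d d0 dP] := hasd_continuous (analytic_hasd ha dz) e0.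
exists (Num.min r (d / 2)) => [|t]; first by rewrite lt_min r0 divr_gt0.
rewrite lt_min => /andP[tr td].
have dt : disk (z + t) by apply: rP; rewrite addrC addKr.
have d0' : disk (0 : C) by exact: disk0.
have := goursat d0' dz dt; rewrite /tri (segint_rev d0' dt) => /eqP.
rewrite subr_eq0 => /eqP <-; rewrite [segint 0 z + _]addrC addrK.
have := @segint_affine z (z + t) z (h z) 0 (normc t) e dz dt.
rewrite mul0r addr0 [z + t - z]addrC addKr; apply => //; last by rewrite subrr normc0 normc_ge0.
move=> w wz; rewrite mul0r addr0 ltW// dP// (le_lt_trans wz)// (lt_trans td)//.
by rewrite ltr_pdivrMr// ltr_pMr// ltr1n.
Qed.

End Goursat.

(** * The Lebesgue integral along a segment as a primitive *)

Section SegmentIntegral.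
Context {R : realType}.
Local Notation C := R[i].

Lemma ReB : {morph @complex.Re R : x y / (x - y : C) >-> x - y}.
Proof. by case=> ? ? []. Qed.

Lemma ImB : {morph @complex.Im R : x y / (x - y : C) >-> x - y}.
Proof. by case=> ? ? []. Qed.

Lemma ReZ (r : R) (x : C) : complex.Re (r%:C * x) = r * complex.Re x.
Proof. by case: x => u v /=; rewrite mul0r subr0. Qed.

Lemma ImZ (r : R) (x : C) : complex.Im (r%:C * x) = r * complex.Im x.
Proof. by case: x => u v /=; rewrite mul0r addr0. Qed.

(** The fundamental theorem of calculus for [p (F (t * z))]; with [p] the real or the imaginary
    part, one proof serves both components. *)
Lemma segment_Rintegral (p : C -> R) (h F : C -> C) (z : C) :
  {morph p : x y / x - y} -> (forall x, `|p x| <= normc x) ->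
  (forall (r : R) x, p (r%:C * x) = r * p x) ->
  analytic h -> (forall w, disk w -> hasd F w (h w)) -> disk z ->
  \int[lebesgue_measure]_(t in `[0, 1]) p (h (t%:C * z) * z) = p (F z - F 0).
Proof.
move=> pB p1 pZ ha Fh dz.
have dt (t : R) : 0 <= t <= 1 -> disk (t%:C * z).
  move=> /andP[t0 t1]; rewrite /disk/= normcM normcr//.
  by apply: le_lt_trans dz; rewrite ler_piMl ?normc_ge0.
have Fd (t : R) : 0 <= t <= 1 ->
    is_derive t 1 (fun s : R => p (F (s%:C * z))) (p (h (t%:C * z) * z)).
  move=> t01; have := @seg_is_derive _ F 0 z (h (t%:C * z)) t p pB p1 pZ.
  rewrite add0r subr0 => /(_ (Fh _ (dt _ t01))).
  by under [X in is_derive _ _ X _]eq_fun do rewrite add0r.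
have hd (t : R) : 0 <= t <= 1 -> derivable (fun s : R => p (h (s%:C * z) * z)) t 1.
  move=> t01.
  have hz := hasdM (analytic_hasd ha (dt _ t01)) (hasd_cst z (t%:C * z)).
  have := @seg_is_derive _ (fun w => h w * z) 0 z _ t p pB p1 pZ.
  rewrite add0r subr0 => /(_ _ hz)[+ _].
  by under [X in derivable X _ _]eq_fun do rewrite add0r.
have Fc (t : R) : 0 <= t <= 1 -> {for t, continuous (fun s : R => p (F (s%:C * z)))}.
  move=> /Fd[dF _]; apply: differentiable_continuous.
  exact/derivable1_diffP.
have := @continuous_FTC2 R (fun t : R => p (h (t%:C * z) * z))
   (fun t : R => p (F (t%:C * z))) 0 1 ltr01.
rewrite /Rintegral => ->/=.
- by rewrite rmorph1 rmorph0 mul1r mul0r pB.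
- by apply: derivable_within_continuous => t; rewrite in_itv; exact: hd.
- split.
  + move=> t; rewrite in_itv/= => /andP[/ltW t0 /ltW t1].
    by have [|] := Fd t; rewrite ?t0.
  + by apply: cvg_at_right_filter; apply: Fc; rewrite lexx ler01.
  + by apply: cvg_at_left_filter; apply: Fc; rewrite lexx ler01.
- move=> t; rewrite in_itv/= => /andP[/ltW t0 /ltW t1].
  by rewrite derive1E; have [|_ ->] := Fd t; rewrite ?t0.
Qed.

Lemma segment_integral_primitive (h F : C -> C) z : analytic h ->
  (forall w, disk w -> hasd F w (h w)) -> disk z ->
  segment_integral h z = F z - F 0.
Proof.
move=> ha Fh dz; rewrite /segment_integral.
rewrite (segment_Rintegral ReB (@normc_Re R) ReZ ha Fh dz).
rewrite (segment_Rintegral ImB (@normc_Im R) ImZ ha Fh dz).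
by case: (F z - F 0).
Qed.

Lemma segment_integral_hasd (h : C -> C) z : analytic h -> disk z ->
  hasd (segment_integral h) z (h z).
Proof.
move=> ha dz; have [r r0 rP] := disk_open dz.
apply: (@hasd_eq _ (fun w => segint h 0 w - segint h 0 0) _ _ _ r) => //.
  move=> w /rP dw; rewrite (@segment_integral_primitive h (segint h 0))// => x dx.
  exact: primitive.
rewrite -[h z]subr0; apply: hasdB; last exact: hasd_cst.
exact: primitive.
Qed.

Lemma segment_integral0 (h : C -> C) : analytic h -> segment_integral h 0 = 0.
Proof.
move=> ha; rewrite (@segment_integral_primitive h (segint h 0)) ?subrr//.
  by move=> w dw; exact: primitive.
exact: disk0.
Qed.

End SegmentIntegral.

(** * Roots of unity and discrete averages *)

Section RootsOfUnity.
Context {R : realType}.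
Local Notation C := R[i].

Definition cis (t : R) : C := cos t +i* sin t.

Lemma normc_cis t : normc (cis t) = 1.
Proof. by rewrite /cis /= cos2Dsin2 sqrtr1. Qed.

Lemma cis0 : cis 0 = 1.
Proof. by rewrite /cis cos0 sin0. Qed.

Lemma cisD s t : cis (s + t) = cis s * cis t.
Proof.
rewrite /cis cosD sinD; apply/eqP; rewrite eq_complex /= eqxx /=.
by apply/eqP; ring.
Qed.

Lemma cos_lip (s t : R) : `|cos s - cos t| <= `|s - t|.
Proof.
wlog st : s t / s <= t => [H|].
  by have [/H//|/ltW/H] := leP s t; rewrite distrC [leRHS]distrC.
have [c _ E] := @MVT_segment R cos (fun x => - sin x) s t st
  (fun x _ => is_derive_cos x) (continuous_subspaceT (@continuous_cos R)).
rewrite distrC E normrM normrN [leRHS]distrC ler_piMl//; exact: sin_max.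
Qed.

Lemma sin_lip (s t : R) : `|sin s - sin t| <= `|s - t|.
Proof.
wlog st : s t / s <= t => [H|].
  by have [/H//|/ltW/H] := leP s t; rewrite distrC [leRHS]distrC.
have [c _ E] := @MVT_segment R sin (fun x => cos x) s t st
  (fun x _ => is_derive_sin x) (continuous_subspaceT (@continuous_sin R)).
rewrite distrC E normrM [leRHS]distrC ler_piMl//; exact: cos_max.
Qed.

Lemma cis_lip (s t : R) : normc (cis s - cis t) <= 2 * `|s - t|.
Proof.
rewrite (le_trans (normc_le_ReIm _))// mulr_natl mulr2n lerD//=.
  exact: cos_lip.
exact: sin_lip.
Qed.

Lemma cis_surj (u : C) : normc u = 1 -> exists2 t, 0 <= t <= pi *+ 2 & u = cis t.
Proof.
case: u => a b /= u1.
have ab : a ^+ 2 + b ^+ 2 = 1.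
  by rewrite -[LHS]sqr_sqrtr ?u1 ?expr1n// addr_ge0 ?sqr_ge0.
have a1 : -1 <= a <= 1.
  rewrite -ler_norml -[leRHS]normr1 -ler_sqr ?nnegrE// !real_normK ?num_real//.
  by rewrite expr1n -ab lerDl sqr_ge0.
have cb : Num.sqrt (1 - a ^+ 2) = `|b| by rewrite -ab addrC addKr sqrtr_sqr.
have [b0|b0] := leP 0 b.
  exists (acos a).
    by rewrite acos_ge0// (le_trans (acos_lepi a1))// mulr2n lerDl pi_ge0.
  by rewrite /cis acosK ?in_itv//= sin_acos// cb ger0_norm.
exists (pi *+ 2 - acos a).
  rewrite subr_ge0 gerBl acos_ge0// andbT (le_trans (acos_lepi a1))//.
  by rewrite mulr2n lerDl pi_ge0.
rewrite /cis addrC cosD2pi sinD2pi cosN sinN acosK ?in_itv//= sin_acos// cb.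
by rewrite ltr0_norm// opprK.
Qed.

Definition rou m : C := cis (pi *+ 2 / 2 ^+ m).

Lemma rou0 : rou 0 = 1.
Proof. by rewrite /rou expr0 divr1 /cis cos2pi sin2pi. Qed.

Lemma rouS m : rou m.+1 ^+ 2 = rou m.
Proof.
rewrite expr2 -cisD /rou; congr cis.
by rewrite exprS; field; rewrite expf_neq0// pnatr_eq0.
Qed.

Lemma rou1 : rou 1 = -1.
Proof.
rewrite /rou expr1 -[pi *+ 2]mulr_natr mulfK ?pnatr_eq0// /cis cospi sinpi.
by apply/eqP; rewrite eq_complex /= oppr0 !eqxx.
Qed.

Lemma normc_rou m k : normc (rou m ^+ k) = 1.
Proof. by rewrite normcX normc_cis expr1n. Qed.

Lemma rou_expD m n : rou (m + n) ^+ (2 ^ n) = rou m.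
Proof.
elim: n m => [|n IHn] m; first by rewrite addn0 expn0 expr1.
by rewrite addnS expnSr exprM -addSn IHn rouS.
Qed.

Lemma rou_exp m : rou m ^+ (2 ^ m) = 1.
Proof. by rewrite -[in rou m](add0n m) rou_expD rou0. Qed.

Lemma cisX t k : cis t ^+ k = cis (t *+ k).
Proof. by elim: k => [|k IHk]; rewrite ?cis0// exprS IHk mulrS cisD. Qed.

(** 16 is 2 * (2 * 4): the Lipschitz constant in [cis_lip], and the angle 2 pi / 2^m with pi <=
    4. *)
Lemma rou_sub1 m : normc (rou m - 1) <= 16 / 2 ^+ m.
Proof.
rewrite -cis0 (le_trans (cis_lip _ _))// subr0.
have p4 : pi <= 4 :> R.
  have := @pihalf_lt2 R; rewrite ltr_pdivrMr// => /ltW/le_trans; apply.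
  by rewrite -natrM.
have p0 : 0 <= pi *+ 2 / 2 ^+ m :> R.
  by rewrite divr_ge0 ?exprn_ge0// mulrn_wge0// pi_ge0.
rewrite ger0_norm//.
rewrite mulrA ler_wpM2r ?invr_ge0 ?exprn_ge0// -[pi *+ 2]mulr_natr.
by rewrite (_ : 16 = 2 * (4 * 2)) ?ler_pM2l ?ler_pM2r// -!natrM.
Qed.

(** For odd [j], repeated squaring reaches -1; for even [j], the power is one of the root of the
    previous level. *)
Lemma rou_neq1 m j : (0 < j < 2 ^ m)%N -> rou m ^+ j != 1.
Proof.
elim: m j => [|m IHm] j; first by case: j.
move=> /andP[j0 jm]; have [oj|/negbTE oj] := boolP (odd j).
  apply/eqP => /(congr1 (fun x => x ^+ (2 ^ m))).
  rewrite exprAC -[in rou _]add1n rou_expD rou1 expr1n -signr_odd oj expr1.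
  by move/eqP; rewrite eq_sym -subr_eq0 opprK -mulr2n pnatr_eq0.
have E : j = (2 * j./2)%N by rewrite -[LHS]odd_double_half oj mul2n.
rewrite E exprM rouS IHm//.
by move: (j./2) E j0 jm => i ->; rewrite expnS ltn_pmul2l// muln_gt0 => /andP[_ ->] ->.
Qed.

(* Squaring at most doubles the distance to 1, and ends at -1. *)
Lemma rou_sep m j : rou m ^+ j != 1 -> 4 / 2 ^+ m <= normc (rou m ^+ j - 1).
Proof.
elim: m j => [|m IHm] j; first by rewrite rou0 expr1n eqxx.
move=> j1; rewrite ler_pdivrMr ?exprn_gt0//.
have [j2|j2] := eqVneq (rou m ^+ j) 1.
  have /eqP : (rou m.+1 ^+ j - 1) * (rou m.+1 ^+ j + 1) = 0.
    by rewrite -subr_sqr expr1n exprAC rouS j2 subrr.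
  rewrite mulf_eq0 subr_eq0 (negbTE j1) addr_eq0 => /eqP ->.
  rewrite -opprD normcN -[1 + 1]/(2%:R) normc_nat exprS mulrA -natrM.
  by rewrite ler_peMr// exprn_ege1// ler1n.
have := IHm j j2; rewrite ler_pdivrMr ?exprn_gt0// => /le_trans; apply.
rewrite exprS mulrA ler_pM2r ?exprn_gt0//.
rewrite -rouS exprAC -[X in _ - X](expr1n _ 2) subr_sqr normcM.
rewrite ler_wpM2l ?normc_ge0// (le_trans (normc_leD _ _))//.
by rewrite normc_rou normc1 -[1 + 1]/(2%:R).
Qed.

(** The index is the integer part of the angle divided by the step, reduced modulo [2 ^ m] because
    the angle 2 pi itself may occur. *)
Lemma rou_cover m (u : C) : normc u = 1 ->
  exists k : 'I_(2 ^ m), normc (u - rou m ^+ k) <= 16 / 2 ^+ m.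
Proof.
move=> /cis_surj[t /andP[t0 _] ->].
have p0 : 0 < pi *+ 2 / 2 ^+ m :> R 
  by rewrite divr_gt0 ?exprn_gt0// pmulrn_lgt0// pi_gt0.
pose k := Num.truncn (t / (pi *+ 2 / 2 ^+ m)).
have kn : (k %% 2 ^ m < 2 ^ m)%N by rewrite ltn_mod expn_gt0.
exists (Ordinal kn) => /=.
have -> : rou m ^+ (k %% 2 ^ m) = rou m ^+ k.
  by rewrite [in RHS](divn_eq k (2 ^ m)) exprD mulnC exprM rou_exp expr1n mul1r.
rewrite cisX (le_trans (cis_lip _ _))//.
have p4 : pi <= 4 :> R.
  have := @pihalf_lt2 R; rewrite ltr_pdivrMr// => /ltW/le_trans; apply.
  by rewrite -natrM.
apply: (@le_trans _ _ (2 * (pi *+ 2 / 2 ^+ m))); last first.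
  rewrite mulrA ler_wpM2r ?invr_ge0 ?exprn_ge0// -[pi *+ 2]mulr_natr.
  by rewrite (_ : 16 = 2 * (4 * 2)) ?ler_pM2l ?ler_pM2r// -!natrM.
rewrite ler_pM2l//.
have := @truncn_itv R (t / (pi *+ 2 / 2 ^+ m)).
rewrite divr_ge0 ?(ltW p0)// => /(_ isT) /andP[].
rewrite -/k ler_pdivlMr// ltr_pdivrMr// => h1 h2; rewrite -[_ *+ k]mulr_natl.
rewrite ger0_norm ?subr_ge0// lerBlDl -[leRHS]addrC.
by apply: le_trans (ltW h2) _; rewrite -addn1 natrD mulrDl mul1r addrC.
Qed.

Lemma sum_rou m j : rou m ^+ j != 1 -> \sum_(k < 2 ^ m) (rou m ^+ k) ^+ j = 0.
Proof.
move=> j1; under eq_bigr do rewrite exprAC.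
have := subrX1 (rou m ^+ j) (2 ^ m).
rewrite exprAC rou_exp expr1n subrr => /esym/eqP.
by rewrite mulf_eq0 subr_eq0 (negbTE j1) /= => /eqP.
Qed.

Lemma sum_rouV m j : rou m ^+ j != 1 ->
  \sum_(k < 2 ^ m) ((rou m ^+ k)^-1) ^+ j = 0.
Proof.
move=> j1; have j2 : (rou m ^+ j)^-1 != 1 by rewrite invr_eq1.
under eq_bigr do rewrite exprVn exprAC -exprVn.
have := subrX1 ((rou m ^+ j)^-1) (2 ^ m).
rewrite exprVn exprAC rou_exp expr1n invr1 subrr => /esym/eqP.
by rewrite mulf_eq0 subr_eq0 (negbTE j2) /= => /eqP.
Qed.

Definition davg m (Phi : C -> C) : C :=
  (\sum_(k < 2 ^ m) Phi (rou m ^+ k)) / 2%:R ^+ m.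

Let two_neq0 m : (2%:R : C) ^+ m != 0.
Proof. by rewrite expf_neq0// pnatr_eq0. Qed.

Lemma davgZ m c f : davg m (fun v => c * f v) = c * davg m f.
Proof. by rewrite /davg -mulr_sumr mulrA. Qed.

Lemma davgB m f g : davg m (fun v => f v - g v) = davg m f - davg m g.
Proof. by rewrite /davg sumrB mulrBl. Qed.

Lemma davg_cst m c : davg m (fun=> c) = c.
Proof. by rewrite /davg sumr_const card_ord -[c *+ _]mulr_natr natrX mulfK. Qed.

Lemma eq_davg m f g : (forall k, f (rou m ^+ k) = g (rou m ^+ k)) ->
  davg m f = davg m g.
Proof. by move=> fg; rewrite /davg; congr (_ / _); apply: eq_bigr. Qed.

Lemma davg_le m f (M : R) : (forall v, normc v = 1 -> normc (f v) <= M) ->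
  normc (davg m f) <= M.
Proof.
move=> fM; rewrite normcM normcV normcX normc_nat ler_pdivrMr ?exprn_gt0//.
rewrite (le_trans (normc_sum _ _ _))//.
apply: (@le_trans _ _ (\sum_(k < 2 ^ m) M)).
  by apply: ler_sum => k _; rewrite fM// normc_rou.
by rewrite sumr_const card_ord -natrX mulr_natr.
Qed.

Lemma sum_ord_double (V : nmodType) n (F : nat -> V) :
  \sum_(k < 2 * n) F k = \sum_(k < n) (F (2 * k)%N + F (2 * k).+1).
Proof.
elim: n => [|n IHn]; first by rewrite muln0 !big_ord0.
by rewrite mulnS !big_ord_recr /= IHn addrA.
Qed.

(** Only differences at adjacent nodes remain: refinement changes the average of a Lipschitz
    function little. These differences become the terms of the nuclear expansion. *)
Lemma davgS m f : davg m.+1 f - davg m f = (\sum_(k < 2 ^ m)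
  (f (rou m.+1 ^+ (2 * k).+1) - f (rou m.+1 ^+ (2 * k)))) / 2%:R ^+ m.+1.
Proof.
rewrite /davg expnS (sum_ord_double _ (fun k => f (rou m.+1 ^+ k))).
have -> : \sum_(k < 2 ^ m) f (rou m ^+ k) =
    \sum_(k < 2 ^ m) f (rou m.+1 ^+ (2 * k)).
  by apply: eq_bigr => k _; rewrite exprM rouS.
rewrite big_split sumrB /= exprS; field; exact: two_neq0.
Qed.

Lemma davg_rouV m j : (0 < j < 2 ^ m)%N -> davg m (fun v => v^-1 ^+ j) = 0.
Proof. by move=> jm; rewrite /davg sum_rouV ?mul0r// rou_neq1. Qed.

Lemma davg_sum m n (f : nat -> C -> C) :
  davg m (fun v => \sum_(j < n) f j v) = \sum_(j < n) davg m (f j).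
Proof. by rewrite /davg exchange_big -mulr_suml. Qed.

Lemma one_subX_neq0 (x : C) n : normc x < 1 -> (0 < n)%N -> 1 - x ^+ n != 0.
Proof.
move=> x1 n0; rewrite subr_eq0; apply/eqP => /(congr1 (@normc R)).
rewrite normc1 normcX => /eqP; rewrite eq_sym; apply/negP.
by rewrite lt_eqF// exprn_ilt1 ?normc_ge0// -lt0n.
Qed.

(** At a [2 ^ m]-th root of unity the geometric series closes up, as [(x * v) ^+ (2 ^ m)] no longer
    depends on [v]. *)
Lemma geometric_kernel m (x v : C) : normc x < 1 -> v ^+ (2 ^ m) = 1 ->
  (1 - x * v)^-1 = (\sum_(j < 2 ^ m) x ^+ j * v ^+ j) / (1 - x ^+ (2 ^ m)).
Proof.
move=> x1 vm; have d0 := one_subX_neq0 x1 (expn_gt0 2 m).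
have y1 : x * v != 1.
  apply: contraNneq d0 => xv; rewrite -[1](expr1n _ (2 ^ m)) -xv exprMn vm mulr1.
  by rewrite subrr.
have y0 : 1 - x * v != 0 by rewrite subr_eq0 eq_sym.
apply: (mulfI y0); rewrite divff// mulrA; apply: (mulIf d0).
rewrite divfK// mul1r; under eq_bigr do rewrite -exprMn.
have := subrX1 (x * v) (2 ^ m); rewrite exprMn vm mulr1 => E.
by apply: oppr_inj; rewrite opprB E -mulNr opprB.
Qed.

Lemma rouV_exp m k : (rou m ^+ k)^-1 ^+ (2 ^ m) = 1.
Proof. by rewrite exprVn exprAC rou_exp expr1n invr1. Qed.

(** Among the powers [v^-1 ^+ j] with [j < 2 ^ m], only the constant one has a nonzero average. *)
Lemma davg_kernel m (x : C) : normc x < 1 ->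
  davg m (fun v => (1 - x * v^-1)^-1) = (1 - x ^+ (2 ^ m))^-1.
Proof.
move=> x1; rewrite -[RHS]mul1r [RHS]mulrC.
transitivity (davg m (fun v => (1 - x ^+ (2 ^ m))^-1 *
   \sum_(j < 2 ^ m) x ^+ j * v^-1 ^+ j)).
  by apply: eq_davg => k; rewrite (geometric_kernel x1 (rouV_exp _ _)) mulrC.
rewrite davgZ; congr (_ * _).
rewrite (davg_sum m _ (fun j v => x ^+ j * v^-1 ^+ j)).
have [n nE] : exists n, (2 ^ m)%N = n.+1 by exists (2 ^ m).-1; rewrite prednK// expn_gt0.
rewrite nE big_ord_recl big1 ?addr0 => [|j _].
  under eq_fun do rewrite !expr0 mulr1; exact: davg_cst.
by rewrite davgZ davg_rouV ?mulr0// nE /= ltnS.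
Qed.

End RootsOfUnity.

(** * A discrete Cauchy formula *)

Section DiscreteCauchy.
Context {R : realType}.
Local Notation C := R[i].
Implicit Types (f F : C -> C).

Lemma expr_small (q e : R) : 0 <= q -> q < 1 -> 0 < e ->
  exists N, forall n, (N <= n)%N -> q ^+ n <= e.
Proof.
move=> q0 q1 e0.
have /cvgrPdist_le/(_ _ e0)[N _ NP] : (fun n => q ^+ n) @ \oo --> (0 : R^o).
  by apply: cvg_expr; rewrite ger0_norm.
exists N => n Nn; have := NP n Nn.
by rewrite sub0r normrN ger0_norm ?exprn_ge0.
Qed.

Lemma kernel_norm (x v : C) : normc x < 1 -> normc v <= 1 ->
  1 - normc x <= normc (1 - x * v).
Proof.
move=> x1 v1; rewrite -(normc1 R); apply: le_trans (normc_lerB _ _).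
by rewrite lerD2l lerN2 normcM ler_piMr ?normc_ge0.
Qed.

Lemma kernel_neq0 (x v : C) : normc x < 1 -> normc v <= 1 -> 1 - x * v != 0.
Proof.
by move=> x1 v1; rewrite -normc_gt0 (lt_le_trans _ (kernel_norm x1 v1))// subr_gt0.
Qed.

Lemma normcV1 (v : C) : normc v = 1 -> normc v^-1 = 1.
Proof. by move=> v1; rewrite normcV v1 invr1. Qed.

Lemma cvs_kernel_avg (x : C) : normc x < 1 ->
  cvs (fun m => davg m (fun v => (1 - x * v^-1)^-1)) 1.
Proof.
move=> x1 e e0; have x1' : 0 < 1 - normc x by rewrite subr_gt0.
have [N NP] := expr_small (normc_ge0 x) x1 (mulr_gt0 e0 x1').
exists N => m Nm; rewrite davg_kernel//.
have d0 := one_subX_neq0 x1 (expn_gt0 2 m).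
have -> : (1 - x ^+ (2 ^ m))^-1 - 1 = x ^+ (2 ^ m) / (1 - x ^+ (2 ^ m)) by field.
rewrite normcM normcV normcX ler_pdivrMr ?normc_gt0//.
apply: le_trans (NP _ _) _; first exact: leq_trans Nm (ltnW (ltn_expl _ _)).
rewrite ler_wpM2l ?(ltW e0)//; have := @kernel_norm (x ^+ (2 ^ m)) 1.
rewrite mulr1 normc1 normcX => K; apply: le_trans (K _ _) => //; last first.
  by rewrite exprn_ilt1 ?normc_ge0// -lt0n expn_gt0.
rewrite lerD2l lerN2 -[leRHS]expr1 ler_wiXn2l ?normc_ge0// ?ltW//.
by rewrite expn_gt0.
Qed.

Section Homotopy.
Variables (F f : C -> C) (r : R) (a : C).
Hypotheses (fa : analytic f) (Ff : forall z, disk z -> hasd F z (f z)).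
Hypotheses (ar : normc a < r) (r1 : r < 1).

Let r0 : 0 < r.
Proof. exact: le_lt_trans (normc_ge0 _) ar. Qed.

Let r_neq0 : r%:C != 0 :> C.
Proof. by rewrite -normc_gt0 normcr// (ltW r0). Qed.

Let x := a / r%:C.

Let x1 : normc x < 1.
Proof. by rewrite normcM normcV normcr ?(ltW r0)// ltr_pdivrMr// mul1r. Qed.

(** Straight homotopy from the point [a] ([s = 0]) to the circle of radius [r] ([s = 1]). *)
Let pt (v : C) (s : C) := a + (r%:C * v - a) * s.

Let normc_rv v : normc v = 1 -> normc (r%:C * v) = r.
Proof. by move=> v1; rewrite normcM v1 mulr1 normcr// ltW. Qed.

Let ptE v (t : R) : pt v t%:C = a + t%:C * (r%:C * v - a).
Proof. by rewrite /pt mulrC. Qed.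

Let pt_le v (t : R) : normc v = 1 -> 0 <= t <= 1 -> normc (pt v t%:C) <= r.
Proof. by move=> v1 t01; rewrite ptE normc_seg ?normc_rv// ltW. Qed.

(* The increments of [F] between consecutive points telescope to zero around
   the circle, while each one is close to its linearization. *)
Let loop_sum (e : R) : 0 < e -> exists M, forall m (t : R), (M <= m)%N ->
  0 <= t <= 1 ->
  normc (\sum_(k < 2 ^ m) f (pt (rou m ^+ k) t%:C) * (r%:C * rou m ^+ k))
    <= e * 2 ^+ m.
Proof.
move=> e0; have [d d0 dP] := analytic_unif_cont fa r1 e0.
have [M MP] := pow2_small 16 d0; exists (maxn M 1) => m t.
rewrite geq_max => /andP[Mm m0] /andP[t0 t1].
have w1 : normc (rou m - 1) < d.
  apply: le_lt_trans (rou_sub1 m) _; apply: le_lt_trans MP.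
  by rewrite ler_wpM2l// lef_pV2 ?posrE ?exprn_gt0// ler_eXn2l// ltr1n.
have w_neq1 : rou m != 1 :> C.
  by rewrite -[rou m]expr1 rou_neq1//= -{1}(expn0 2) ltn_exp2l.
have t01 : 0 <= t <= 1 by rewrite t0.
(* The argument below cancels a factor [t]; at [t = 0] the sum is a multiple of the sum of the roots
   of unity, which vanishes. *)
have [->|tn0] := eqVneq t 0.
  under eq_bigr do rewrite /pt mulr0 addr0.
  rewrite -mulr_sumr -mulr_sumr.
  have -> : \sum_(k < 2 ^ m) rou m ^+ k = 0 :> C.
    transitivity (\sum_(k < 2 ^ m) (rou m ^+ k : C) ^+ 1).
      by apply: eq_bigr => k _; rewrite expr1.
    by rewrite sum_rou ?expr1.
  by rewrite !mulr0 normc0 mulr_ge0 ?exprn_ge0 ?ltW.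
have tgt0 : 0 < t by rewrite lt_neqAle eq_sym tn0.
pose p k := pt (rou m ^+ k) t%:C.
have pS k : p k.+1 - p k = t%:C * (r%:C * rou m ^+ k) * (rou m - 1).
  by rewrite /p /pt exprS; ring.
have nS k : normc (p k.+1 - p k) = t * r * normc (rou m - 1).
  by rewrite pS !normcM !normcr ?normc_rou ?(ltW r0)// mulr1.
have step k : normc (F (p k.+1) - F (p k) - f (p k) * (p k.+1 - p k)) <=
    e * (t * r * normc (rou m - 1)).
  rewrite -(nS k); have pr j : normc (p j) <= r by apply: pt_le => //; exact: normc_rou.
  have -> : F (p k.+1) - F (p k) - f (p k) * (p k.+1 - p k) =
    (F (p k.+1) - f (p k) * p k.+1) - (F (p k) - f (p k) * p k) by ring.
  apply: (@mean_value_le _ (fun z => F z - f (p k) * z) (fun z => f z - f (p k))) => s s01.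
    have ds : disk (p k + s%:C * (p k.+1 - p k)).
      by apply: le_lt_trans r1; exact: normc_seg.
    by have := hasdB (Ff ds) (hasdZ (f (p k)) (hasd_id _)); rewrite mulr1; exact.
  apply: dP => //; rewrite addrC addKr normcM normcr; last by case/andP: s01.
  apply: le_lt_trans w1; rewrite nS mulrA ler_piMl ?normc_ge0//.
  by case/andP: s01 => s0 s1; rewrite !mulr_ile1 ?mulr_ge0 ?(ltW r0) ?(ltW r1).
have tele : \sum_(k < 2 ^ m) (F (p k.+1) - F (p k)) = 0.
  rewrite -(big_mkord xpredT (fun k => F (p k.+1) - F (p k))).
  rewrite telescope_sumr// /p rou_exp expr0 subrr//.
have : normc (\sum_(k < 2 ^ m) (F (p k.+1) - F (p k) - f (p k) * (p k.+1 - p k)))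
    <= e * (t * r * normc (rou m - 1)) * 2 ^+ m.
  rewrite (le_trans (normc_sum _ _ _))//.
  apply: (@le_trans _ _ (\sum_(k < 2 ^ m) e * (t * r * normc (rou m - 1)))).
    by apply: ler_sum => k _; exact: step.
  by rewrite sumr_const card_ord -natrX mulr_natr.
rewrite sumrB tele sub0r normcN.
have -> : \sum_(k < 2 ^ m) f (p k) * (p k.+1 - p k) =
    t%:C * (rou m - 1) * \sum_(k < 2 ^ m) f (p k) * (r%:C * rou m ^+ k).
  by rewrite mulr_sumr; apply: eq_bigr => k _; rewrite pS; ring.
have w0 : 0 < normc (rou m - 1 : C) by rewrite normc_gt0 subr_eq0.
rewrite !normcM normcr// -[in X in _ -> X](ler_pM2l (mulr_gt0 tgt0 w0)).
move=> /le_trans; apply.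
rewrite [leRHS](_ : _ = e * (t * 1 * normc (rou m - 1)) * 2 ^+ m); last by ring.
rewrite ler_wpM2r ?exprn_ge0// ler_wpM2l ?(ltW e0)//.
by rewrite ler_wpM2r ?normc_ge0// ler_wpM2l// ltW.
Qed.

(** Deformation of the circle to [a]: by [cE] the derivative of [J m] in [s] is a loop sum,
    negligible against 2^m, so the kernel average of [F] over the circle has the same limit as [F a]
    times the average of the kernel. *)
Lemma discrete_cauchy :
  cvs (fun m => davg m (fun v => F (r%:C * v) * (1 - a / r%:C * v^-1)^-1)) (F a).
Proof.
rewrite -/x; pose c (v : C) := (1 - x * v^-1)^-1.
have cE v : normc v = 1 -> (r%:C * v - a) * c v = r%:C * v.
  move=> v1; have n0 : 1 - x * v^-1 != 0 by rewrite kernel_neq0// normcV1.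
  have v0 : v != 0 by rewrite -normc_gt0 v1.
  apply: (mulIf n0); rewrite /c divfK// mulrBr mulr1; congr (_ - _).
  by rewrite /x; field; rewrite ?r_neq0 ?v0.
pose J m s := \sum_(k < 2 ^ m) F (pt (rou m ^+ k) s) * c (rou m ^+ k).
have Jd m (t : R) : 0 <= t <= 1 -> hasd (J m) t%:C
    (\sum_(k < 2 ^ m) f (pt (rou m ^+ k) t%:C) * (r%:C * rou m ^+ k)).
  move=> t01; apply: (@hasd_sum _ _ (fun k s => F (pt (rou m ^+ k) s) * c (rou m ^+ k))
    (fun k => f (pt (rou m ^+ k) t%:C) * (r%:C * rou m ^+ k))) => k _.
  have v1 := @normc_rou R m k.
  have Fp := hasd_affine (Ff (le_lt_trans (pt_le v1 t01) r1)).
  have := hasdM Fp (hasd_cst (c (rou m ^+ k)) t%:C).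
  rewrite mulr0 add0r [X in hasd _ _ X](_ : _ = f (pt (rou m ^+ k) t%:C) *
    ((r%:C * rou m ^+ k - a) * c (rou m ^+ k))); last by rewrite /pt; ring.
  by rewrite cE.
have J1 m : J m 1 / 2%:R ^+ m = davg m (fun v => F (r%:C * v) * c v).
  congr (_ / _); apply: eq_bigr => k _; congr (F _ * _).
  by rewrite /pt mulr1 subrKC.
have J0 m : J m 0 / 2%:R ^+ m = F a * davg m c.
  rewrite -davgZ; congr (_ / _); apply: eq_bigr => k _; congr (F _ * _).
  by rewrite /pt mulr0 addr0.
apply: (cvs_ext J1).
suff : cvs (fun m => (J m 1 / 2%:R ^+ m - J m 0 / 2%:R ^+ m) + F a * davg m c) (0 + F a * 1).
  by rewrite add0r mulr1; apply: cvs_ext => m; rewrite J0 subrK.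
apply: cvsD; last exact/cvsZ/cvs_kernel_avg.
move=> e e0; have [M MP] := loop_sum e0; exists M => m Mm.
rewrite subr0 -mulrBl normcM normcV normcX normc_nat ler_pdivrMr ?exprn_gt0//.
have := @mean_value_le _ (J m) (fun s => \sum_(k < 2 ^ m)
   f (pt (rou m ^+ k) s) * (r%:C * rou m ^+ k)) 0 1 (e * 2 ^+ m).
rewrite subr0 normc1 mulr1; apply=> t t01; rewrite add0r mulr1; first exact: Jd.
exact: MP.
Qed.

End Homotopy.

End DiscreteCauchy.

(** * Differentiability of limits of kernel averages *)

Section LimitsOfKernels.
Context {R : realType}.
Local Notation C := R[i].

(** A quadratic remainder uniform in [m] lets derivatives pass to the limit: difference quotients of
    [S] with a fixed small step show that [S' m a] is Cauchy, and the remainder estimate survives in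
    the limit. *)
Lemma limit_hasd (S S' : nat -> C -> C) (phi : C -> C) (rho : R) :
  (forall a, normc a < rho -> cvs (S ^~ a) (phi a)) ->
  (forall a, normc a < rho -> exists D : R, exists2 d : R, 0 < d & forall m h,
    normc h < d -> normc (S m (a + h) - S m a - h * S' m a) <= D * normc h ^+ 2) ->
  exists phi', forall a, normc a < rho ->
    cvs (S' ^~ a) (phi' a) /\ hasd phi a (phi' a).
Proof.
move=> Sphi S2.
suff key a : exists l, normc a < rho -> cvs (S' ^~ a) l /\ hasd phi a l.
  have [phi' phiP] := choice key; exists phi' => a; exact: phiP.
have [ar|] := pselect (normc a < rho); last by exists 0.
have [D [d d0 dP]] := S2 a ar.
have D1 : 0 < `|D| + 1 by rewrite ltr_wpDl.
have dP' m h : normc h < d ->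
    normc (S m (a + h) - S m a - h * S' m a) <= (`|D| + 1) * normc h ^+ 2.
  move=> /dP-/(_ m)/le_trans; apply; rewrite ler_wpM2r ?exprn_ge0 ?normc_ge0//.
  by rewrite (le_trans (ler_norm _))// lerDl.
have near (h : C) : normc h < rho - normc a -> normc (a + h) < rho.
  by move=> hr; rewrite (le_lt_trans (normc_leD _ _))// -ltrBrDl.
have [l Sl] : exists l, cvs (S' ^~ a) l.
  apply: cvs_cauchy => e e0.
  (* The step [t] keeps each of the two remainders below [e * t / 4]; the four values of [S] are
     then taken to within [e * t / 8] of their limits. *)
  pose t := Num.min (Num.min (d / 2) ((rho - normc a) / 2)) (e / 4 / (`|D| + 1)).
  have t0 : 0 < t by rewrite /t !lt_min !divr_gt0// subr_gt0.
  have ttE : normc t%:C = t by rewrite normcr// ltW.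
  have half (y : R) : 0 < y -> y / 2 < y by move=> y0; rewrite ltr_pdivrMr// ltr_pMr// ltr1n.
  have td : normc t%:C < d.
    by rewrite ttE (le_lt_trans _ (half _ d0))// /t !ge_min lexx.
  have tr : normc t%:C < rho - normc a.
    rewrite ttE (le_lt_trans _ (half _ _)) ?subr_gt0//.
    by rewrite /t !ge_min lexx orbT.
  have te : (`|D| + 1) * t <= e / 4 by rewrite mulrC -ler_pdivlMr// /t ge_min lexx orbT.
  have et : 0 < e * t / 8 by rewrite divr_gt0// mulr_gt0.
  have [N1 NP1] := Sphi _ ar _ et.
  have [N2 NP2] := Sphi _ (near _ tr) _ et.
  exists (maxn N1 N2) => n m; rewrite !geq_max => /andP[n1 n2] /andP[m1 m2].
  rewrite -(ler_pM2l t0) -[in X in X * _ <= _]ttE -normcM.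
  have -> : t%:C * (S' n a - S' m a) =
    ((S m (a + t%:C) - S m a - t%:C * S' m a) -
     (S n (a + t%:C) - S n a - t%:C * S' n a)) +
    (((S n (a + t%:C) - phi (a + t%:C)) - (S m (a + t%:C) - phi (a + t%:C))) -
     ((S n a - phi a) - (S m a - phi a))) by ring.
  have q : (`|D| + 1) * normc t%:C ^+ 2 <= e * t / 4.
    rewrite ttE expr2 mulrA (mulrAC e) ler_wpM2r// ltW//.
  apply: le_trans (normc_leD _ _) _.
  have -> : t * e = (e * t / 4 + e * t / 4) +
     ((e * t / 8 + e * t / 8) + (e * t / 8 + e * t / 8)) by field.
  apply: lerD.
    by apply: le_trans (normcB_le _ _) _; apply: lerD; apply: le_trans q; apply: dP'.
  apply: le_trans (normcB_le _ _) _; apply: lerD; apply: le_trans (normcB_le _ _) _.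
    by apply: lerD; apply: NP2.
  by apply: lerD; apply: NP1.
exists l => _; split=> // e e0.
exists (Num.min (Num.min d (rho - normc a)) (e / (`|D| + 1))).
  by rewrite !lt_min d0 subr_gt0 ar divr_gt0.
move=> h; rewrite !lt_min => /andP[/andP[hd hr] he].
apply: (@le_trans _ _ ((`|D| + 1) * normc h ^+ 2)); last first.
  rewrite expr2 mulrA ler_wpM2r ?normc_ge0// mulrC -ler_pdivlMr//; exact: ltW.
have lim := cvsB (cvsB (Sphi _ (near _ hr)) (Sphi _ ar)) (cvsZ h Sl).
rewrite [l * h]mulrC; apply: (cvs_norm_le lim) => m; exact: dP'.
Qed.

(** [k] and [k'] stand for [(1 - a * w)^-1] at [a] and at [a + h], whose difference is
    [h * w * k * k']; the constant is uniform in the nodes [w]. *)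
Lemma kernel_expansion j (A W : R) : 0 <= A -> 0 <= W ->
  exists2 D : R, 0 <= D & forall h w k k' : C,
    normc k <= A -> normc k' <= A -> normc w <= W -> k' - k = h * w * k * k' ->
    normc (k' ^+ j - k ^+ j - h * (j%:R * w * k ^+ j.+1)) <= D * normc h ^+ 2.
Proof.
move=> A0 W0; elim: j => [|j [D D0 IHj]].
  by exists 0 => // h w k k' _ _ _ _; rewrite !expr0 subrr !mul0r mulr0 subr0 normc0.
exists (A * D + j%:R * W ^+ 2 * A ^+ j.+3 + W ^+ 2 * A ^+ j.+3).
  have An n : 0 <= A ^+ n by exact: exprn_ge0.
  have Wn n : 0 <= W ^+ n by exact: exprn_ge0.
  apply: addr_ge0; last exact: mulr_ge0.
  apply: addr_ge0; first exact: mulr_ge0.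
  by apply: mulr_ge0 => //; exact: mulr_ge0.
move=> h w k k' kA kA' wW E.
have -> : k' ^+ j.+1 - k ^+ j.+1 - h * (j.+1%:R * w * k ^+ j.+2) =
    k' * (k' ^+ j - k ^+ j - h * (j%:R * w * k ^+ j.+1)) +
    h * j%:R * w * k ^+ j.+1 * (k' - k) + k ^+ j * (k' - k - h * w * k ^+ 2).
  by rewrite !exprS -[j.+1]addn1 natrD; ring.
have E2 : k' - k - h * w * k ^+ 2 = h * w * k * (k' - k) by rewrite {1}E; ring.
rewrite E2 E; apply: le_trans (normc_leD _ _) _; rewrite !mulrDl.
have kX n : normc k ^+ n <= A ^+ n by rewrite lerXn2r ?nnegrE ?normc_ge0.
have kn n : 0 <= normc k ^+ n by rewrite exprn_ge0 ?normc_ge0.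
have kk : normc k ^+ j.+2 * normc k' <= A ^+ j.+3.
  by rewrite [A ^+ _]exprSr ler_pM ?normc_ge0.
have kk0 : 0 <= normc k ^+ j.+2 * normc k' by rewrite mulr_ge0 ?normc_ge0.
have wX : normc w ^+ 2 <= W ^+ 2 by rewrite lerXn2r ?nnegrE ?normc_ge0.
have w0 : 0 <= normc w ^+ 2 by rewrite exprn_ge0 ?normc_ge0.
apply: lerD; first apply: le_trans (normc_leD _ _) _; first apply: lerD.
- rewrite normcM -[A * D * _]mulrA ler_pM ?normc_ge0//; exact: IHj.
- rewrite !normcM normcX normc_nat.
  rewrite [leLHS](_ : _ = j%:R * (normc w ^+ 2) * (normc k ^+ j.+2 * normc k') * normc h ^+ 2);
    last by rewrite !exprS expr0; ring.
  rewrite ler_wpM2r ?exprn_ge0 ?normc_ge0//.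
  by apply: ler_pM => //; [exact: mulr_ge0|exact: ler_wpM2l].
- rewrite !normcM normcX.
  rewrite [leLHS](_ : _ = (normc w ^+ 2) * (normc k ^+ j.+2 * normc k') * normc h ^+ 2);
    last by rewrite !exprS expr0; ring.
  by rewrite ler_wpM2r ?exprn_ge0 ?normc_ge0// ler_pM.
Qed.

(* Differentiation maps this class for [j] to the class for [j.+1], and by the
   discrete Cauchy formula a function with analytic derivative belongs to the
   class for [j = 1]: this makes it infinitely differentiable. *)
Definition kernel_limit j (rho : R) (phi : C -> C) :=
  exists (B : R) (b v : nat -> nat -> C),
  [/\ forall m k, normc (b m k) <= B, forall m k, normc (v m k) <= rho^-1 &
    forall a, normc a < rho -> cvs (fun m => (\sum_(k < 2 ^ m)
      b m k * (1 - a * v m k)^-1 ^+ j) / 2%:R ^+ m) (phi a)].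

Lemma kernel_limit_hasd j rho phi : 0 < rho -> kernel_limit j rho phi ->
  exists2 phi', kernel_limit j.+1 rho phi' &
    forall a, normc a < rho -> hasd phi a (phi' a).
Proof.
move=> rho0 [B [b [v [bB vr bvphi]]]].
pose S m a := (\sum_(k < 2 ^ m) b m k * (1 - a * v m k)^-1 ^+ j) / 2%:R ^+ m.
pose S' m a := (\sum_(k < 2 ^ m) (j%:R * b m k * v m k) *
  (1 - a * v m k)^-1 ^+ j.+1) / 2%:R ^+ m.
have B0 : 0 <= B by exact: le_trans (normc_ge0 _) (bB 0%N 0%N).
have den m k a (d : R) : normc a <= rho - d -> d / rho <= normc (1 - a * v m k).
  move=> ad; have := normc_lerB 1 (a * v m k); rewrite normc1; apply: le_trans.
  rewrite lerBrDl -lerBrDr normcM.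
  apply: (@le_trans _ _ ((rho - d) * rho^-1)).
    by rewrite ler_pM ?normc_ge0.
  by rewrite mulrBl divff// gt_eqF.
have [phi' phiP] : exists phi', forall a, normc a < rho ->
    cvs (S' ^~ a) (phi' a) /\ hasd phi a (phi' a).
  apply: (@limit_hasd S) => // a ar.
  (* Half the distance to the circle of radius [rho] keeps [a] and [a + h] where all denominators
     are at least [d / rho]. *)
  pose d := (rho - normc a) / 2.
  have d0 : 0 < d by rewrite divr_gt0// subr_gt0.
  have ri0 : 0 <= rho^-1 by rewrite invr_ge0 ltW.
  have [D D0 DP] := kernel_expansion j (divr_ge0 (ltW rho0) (ltW d0)) ri0.
  exists (B * D), d => // m h hd.
  have nd x : normc x <= rho - d -> forall k,
      1 - x * v m k != 0 /\ normc (1 - x * v m k)^-1 <= rho / d.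
    move=> xd k; have H := den m k x d xd.
    have p0 : 0 < normc (1 - x * v m k) by apply: lt_le_trans H; rewrite divr_gt0.
    split; first by rewrite -normc_gt0.
    by rewrite normcV -[rho / d]invf_div lef_pV2 ?posrE// divr_gt0.
  have a1 : normc a <= rho - d by rewrite /d; move: (ar); lra.
  have a2 : normc (a + h) <= rho - d.
    by rewrite (le_trans (normc_leD _ _))//; move: hd; rewrite /d; lra.
  have -> : S m (a + h) - S m a - h * S' m a = (\sum_(k < 2 ^ m) b m k *
      ((1 - (a + h) * v m k)^-1 ^+ j - (1 - a * v m k)^-1 ^+ j -
       h * (j%:R * v m k * (1 - a * v m k)^-1 ^+ j.+1))) / 2%:R ^+ m.
    rewrite /S /S' [h * _]mulrA mulr_sumr -!mulrBl -!sumrB; congr (_ / _).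
    by apply: eq_bigr => k _; ring.
  rewrite normcM normcV normcX normc_nat ler_pdivrMr ?exprn_gt0//.
  apply: le_trans (normc_sum _ _ _) _.
  apply: (@le_trans _ _ (\sum_(k < 2 ^ m) B * D * normc h ^+ 2)).
    apply: ler_sum => k _; rewrite normcM -[B * D * _]mulrA ler_pM ?normc_ge0//.
    have [n1 k1] := nd _ a1 k; have [n2 k2] := nd _ a2 k.
    by apply: DP => //; field; rewrite n1 n2.
  by rewrite sumr_const card_ord -natrX mulr_natr.
exists phi'; last by move=> a /phiP[].
exists (j%:R * B * rho^-1), (fun m k => j%:R * b m k * v m k), v; split=> //.
  by move=> m k; rewrite !normcM normc_nat !ler_pM ?mulr_ge0 ?normc_ge0.
by move=> a /phiP[].
Qed.

End LimitsOfKernels.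

Section AnalyticDerivative.
Context {R : realType}.
Local Notation C := R[i].
Implicit Types (f h : C -> C).

Lemma analytic_bounded f (r : R) : analytic f -> r < 1 ->
  exists2 M : R, 0 <= M & forall z, normc z <= r -> normc (f z) <= M.
Proof.
move=> fa r1.
have : compact ((fun z => normc (f z)) @` [set z : C | normc z <= r]).
  apply: continuous_compact; last exact: disk_compact.
  apply: continuous_in_subspaceT => z; rewrite inE /= => zr.
  apply: (@continuous_comp _ _ _ f (@normc R)); last exact: normc_continuous.
  by apply: analytic_continuous => //; exact: le_lt_trans zr r1.
move=> /compact_bounded[M [_ /(_ (M + 1))]]; rewrite ltrDl ltr01 => /(_ isT) fM.
exists `|M + 1| => // z zr; rewrite (le_trans _ (ler_norm (M + 1)))//.
by rewrite (le_trans (ler_norm _))//; apply: fM; exists z.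
Qed.

Lemma hasd_uniq f z a b : hasd f z a -> hasd f z b -> a = b.
Proof. by move=> /hasd_derive1 <- /hasd_derive1. Qed.

Lemma disk_between (z : C) : disk z -> exists2 r : R, normc z < r & r < 1.
Proof.
move=> z1; exists ((normc z + 1) / 2).
  by rewrite ltr_pdivlMr// mulr_natr mulr2n ltrD2l.
by rewrite ltr_pdivrMr// mul1r -[2]/(1 + 1) ltrD2r.
Qed.

Lemma hasd_eq_ball f g z d (r : R) : normc z < r ->
  (forall w, normc w < r -> f w = g w) -> hasd f z d -> hasd g z d.
Proof.
move=> zr fg; apply: (@hasd_eq _ _ _ _ _ (r - normc z)).
  by rewrite subr_gt0.
move=> w wz; apply: fg; rewrite -[w](subrK z) (le_lt_trans (normc_leD _ _))//.
by rewrite -ltrBrDr.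
Qed.

(** The primitive of [h] is a kernel limit with [j = 1]; differentiating three times gives [h], its
    derivative, and the derivative of the latter. *)
Lemma analytic_derive h : analytic h -> analytic (derive1 h).
Proof.
move=> ha z /disk_between[r zr r1].
have r0 : 0 < r by exact: le_lt_trans (normc_ge0 _) zr.
have Pd w : disk w -> hasd (segint h 0) w (h w) by exact: primitive.
have Pa : analytic (segint h 0) by exact: hasd_analytic Pd.
have [B B0 PB] := analytic_bounded Pa r1.
have dr (w : C) : normc w < r -> disk w by move=> wr; exact: lt_trans wr r1.
have [phi1 k1 d1] : exists2 phi1, kernel_limit 2 r phi1 &
    forall a, normc a < r -> hasd (segint h 0) a (phi1 a).
  apply: kernel_limit_hasd => //.
  exists B, (fun m k => segint h 0 (r%:C * rou m ^+ k)),
    (fun m k => r%:C^-1 * (rou m ^+ k)^-1); split.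
  - by move=> m k; apply: PB; rewrite normcM normc_rou mulr1 normcr// ltW.
  - by move=> m k; rewrite normcM !normcV normc_rou invr1 mulr1 normcr// ltW.
  - move=> a ar; have := discrete_cauchy ha Pd ar r1.
    by apply: cvs_ext => m; congr (_ / _); apply: eq_bigr => k _; rewrite expr1 mulrA.
have [phi2 k2 d2] := kernel_limit_hasd r0 k1.
have [phi3 _ d3] := kernel_limit_hasd r0 k2.
have E1 a : normc a < r -> phi1 a = h a.
  by move=> ar; exact: hasd_uniq (d1 _ ar) (Pd _ (dr _ ar)).
have E2 a : normc a < r -> phi2 a = derive1 h a.
  move=> ar; have := hasd_eq_ball ar E1 (d2 _ ar).
  by move=> /hasd_uniq; apply; exact: analytic_hasd (dr _ ar).
by apply: (@hasd_derivable _ _ _ (phi3 z)); exact: hasd_eq_ball zr E2 (d3 _ zr).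
Qed.

(** After rescaling to the unit disk, the discrete Cauchy formula on the circle of radius 1/2 bounds
    [G a - G 0] by [4 * M * normc a]. The 4 comes from |x / (1 - x)| <= 2 |x| with |x| = 2 |a| <=
    1/2. *)
Lemma cauchy_estimate f (z : C) (d M : R) : analytic f -> 0 < d ->
  (forall w, normc (w - z) < d -> disk w /\ normc (f w) <= M) ->
  normc (derive1 f z) <= 4 * M / d.
Proof.
move=> fa d0 fM.
pose G w := f (z + d%:C * w).
pose g w := d%:C * derive1 f (z + d%:C * w).
have zd w : disk w -> normc (z + d%:C * w - z) < d.
  by move=> w1; rewrite addrC addKr normcM normcr ?(ltW d0)// gtr_pMr.
have Gd w : disk w -> hasd G w (g w).
  by move=> /zd/fM[dw _]; apply: hasd_affine; exact: analytic_hasd.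
have M0 : 0 <= M.
  by apply: le_trans (normc_ge0 _) (fM z _).2; rewrite subrr normc0.
have ga : analytic g.
  move=> w /zd/fM[dw _]; apply: hasd_derivable; apply: hasdZ.
  by apply: hasd_affine; apply: analytic_hasd dw; exact: analytic_derive.
have h1 : 2^-1 < 1 :> R by rewrite invf_lt1// ltr1n.
have GM w : disk w -> normc (G w) <= M by move=> /zd/fM[].
have Glip a : normc a < 4^-1 -> normc (G a - G 0) <= 4 * M * normc a.
  move=> a4; have a2 : normc a < 2^-1.
    by rewrite (lt_le_trans a4)// lef_pV2 ?posrE// ler_nat.
  have z2 : normc (0 : C) < 2^-1 by rewrite normc0 invr_gt0.
  have lim := cvsB (discrete_cauchy ga Gd a2 h1) (discrete_cauchy ga Gd z2 h1).
  apply: (cvs_norm_le lim) => m; rewrite -davgB; apply: davg_le => v v1.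
  have v1' : normc v^-1 = 1 by rewrite normcV1.
  have v1le : normc v^-1 <= 1 by rewrite v1'.
  set x := a / _; have xE : normc x = 2 * normc a.
    by rewrite normcM normcV normcr ?invr_ge0// invrK mulrC.
  have x2 : normc x <= 2^-1.
    rewrite xE -ler_pdivlMl// (le_trans (ltW a4))//.
    by rewrite -invfM -natrM.
  have x1 : normc x < 1 by exact: le_lt_trans x2 _.
  rewrite !mul0r subr0 invr1 -mulrBr normcM (_ : 4 * M * _ = M * (4 * normc a)); last by ring.
  have n0 := kernel_neq0 x1 v1le.
  have -> : (1 - x * v^-1)^-1 - 1 = x * v^-1 / (1 - x * v^-1).
    by move: n0; move: (x * v^-1) => y n0; field; exact: n0.
  apply: ler_pM; rewrite ?normc_ge0//.
    by apply: GM; rewrite /disk/= normcM v1 mulr1 normcr ?invr_ge0.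
  clearbody x; rewrite !normcM v1' mulr1 normcV ler_pdivrMr ?normc_gt0//.
  have := kernel_norm x1 v1le; rewrite xE.
  have : 2 * normc a <= 2^-1 by rewrite -xE.
  set K := normc (1 - _); have := normc_ge0 a; set y := normc a => y0 h2 h3.
  have : 2^-1 <= K by lra.
  nra.
have g0E : g 0 = d%:C * derive1 f z by rewrite /g mulr0 addr0.
have : normc (g 0) <= 4 * M.
  apply/ler_addgt0Pr => e e0.
  have [r r0 rP] := Gd 0 (@disk0 R) e e0.
  pose t := Num.min r 4^-1 / 2.
  have t0 : 0 < t by rewrite /t divr_gt0// lt_min r0 invr_gt0 ltr0n.
  have tlt : t < Num.min r 4^-1 
    by rewrite /t ltr_pdivrMr// ltr_pMr ?ltr1n// lt_min r0 invr_gt0 ltr0n.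
  move: tlt; rewrite lt_min => /andP[tr t4].
  have tE : normc (t%:C : C) = t by rewrite normcr// ltW.
  have := rP t%:C; rewrite tE => /(_ tr); rewrite add0r => H1.
  have := Glip t%:C; rewrite tE => /(_ t4) H2.
  rewrite -(ler_pM2r t0) -[X in _ * X <= _]tE -normcM.
  have -> : g 0 * t%:C = (G t%:C - G 0) - (G t%:C - G 0 - g 0 * t%:C) by ring.
  by apply: le_trans (normcB_le _ _) _; rewrite mulrDl lerD.
by rewrite g0E normcM normcr ?(ltW d0)// ler_pdivlMr// mulrC.
Qed.

End AnalyticDerivative.

(** * Normal weights on dyadic radii *)

Section Dyadic.
Context {R : realType}.
Local Notation C := R[i].

Definition eps m : R := 2^-1 ^+ m.
Definition rad m : R := 1 - eps m.

Lemma eps_gt0 m : 0 < eps m.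
Proof. by rewrite exprn_gt0// invr_gt0. Qed.

Lemma eps_le1 m : eps m <= 1.
Proof. by rewrite exprn_ile1 ?invr_ge0// invf_le1// ler1n. Qed.

Lemma epsS m : eps m = 2 * eps m.+1.
Proof. by rewrite /eps exprS mulrA divff ?mul1r// pnatr_eq0. Qed.

Lemma epsE m : eps m = (2 ^+ m)^-1.
Proof. by rewrite /eps exprVn. Qed.

Lemma eps_le m n : (m <= n)%N -> eps n <= eps m.
Proof. by move=> mn; rewrite ler_wiXn2l ?invr_ge0// invf_le1// ler1n. Qed.

Lemma eps_small (d : R) : 0 < d -> exists N, eps N < d.
Proof. by move=> /(pow2_small 1)[N]; rewrite mul1r -epsE; exists N. Qed.

Lemma rad_lt1 m : rad m < 1.
Proof. by rewrite gtrBl eps_gt0. Qed.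

Lemma rad_ge0 m : 0 <= rad m.
Proof. by rewrite subr_ge0 eps_le1. Qed.

Lemma rad_le m n : (m <= n)%N -> rad m <= rad n.
Proof. by move=> /eps_le; rewrite lerD2l lerN2. Qed.

Lemma radS_sub m : rad m.+1 - rad m = eps m.+1.
Proof. by rewrite /rad [in eps m](epsS m); ring. Qed.

Lemma rad0 : rad 0 = 0.
Proof. by rewrite /rad /eps expr0 subrr. Qed.

Lemma rad_itv (r : R) : 0 <= r -> r < 1 -> exists m, rad m <= r <= rad m.+1.
Proof.
move=> r0 r1; have s0 : 0 < 1 - r by rewrite subr_gt0.
have [N NP] := eps_small s0.
have : r <= rad N by rewrite /rad; move: NP; lra.
elim: N {NP} => [|N IHN rN]; first by rewrite rad0 => r0'; exists 0%N; rewrite rad0 r0 (le_trans r0')// rad_ge0.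
by have [/IHN//|/ltW Nr] := leP r (rad N); exists N; rewrite Nr.
Qed.

Lemma powRX (a s : R) m : 0 <= a -> (a ^+ m) `^ s = (a `^ s) ^+ m.
Proof.
move=> a0; elim: m => [|m IHm]; first by rewrite !expr0 powR1.
by rewrite !exprS powRM ?exprn_ge0// IHm.
Qed.

Lemma geo_sum (q : R) n : 0 <= q -> q < 1 -> \sum_(i < n) q ^+ i <= (1 - q)^-1.
Proof.
move=> q0 q1; have q1' : 0 < 1 - q by rewrite subr_gt0.
rewrite -(ler_pM2l q1') divff ?gt_eqF// -[X in X <= _]opprK -mulNr opprB.
by rewrite -subrX1 opprB gerBl exprn_ge0.
Qed.

Lemma geo_sum_rev (q : R) n : 0 <= q -> q < 1 ->
  \sum_(i < n.+1) q ^+ (n - i) <= (1 - q)^-1.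
Proof.
move=> q0 q1; apply: le_trans (geo_sum n.+1 q0 q1).
rewrite (reindex_inj rev_ord_inj) /=; apply: ler_sum => i _.
by rewrite subSS subKn// -ltnS.
Qed.

Definition num (nu : weight R) m : R := nu (rad m)%:C.

Lemma disk_real (r : R) : 0 <= r -> r < 1 -> disk (r%:C : C).
Proof. by move=> r0 r1; change (normc (r%:C : C) < 1); rewrite normcr. Qed.

Lemma num_gt0 nu m : 0 < num nu m.
Proof. by apply: weight_gt0; apply: disk_real; rewrite ?rad_ge0 ?rad_lt1. Qed.

Lemma weight_le_num (nu : weight R) z m : disk z -> rad m <= normc z -> nu z <= num nu m.
Proof. by move=> dz mz; apply: weight_noninc; rewrite ?normcr ?rad_ge0. Qed.

Lemma num_le_weight (nu : weight R) z m : normc z <= rad m -> num nu m <= nu z.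
Proof.
move=> zm; apply: weight_noninc; last by rewrite normcr ?rad_ge0.
by apply: disk_real; rewrite ?rad_ge0 ?rad_lt1.
Qed.

Lemma onem_sqr_ge (r : R) : 0 <= r -> r <= 1 -> 1 - r <= 1 - r ^+ 2.
Proof. by move=> r0 r1; rewrite lerD2l lerN2 expr2 ler_piMl. Qed.

Lemma onem_sqr_le (r : R) : 0 <= r -> r <= 1 -> 1 - r ^+ 2 <= 2 * (1 - r).
Proof. by move=> r0 r1; nra. Qed.

(** Condition (I) without quotients and with [1 - r] for [1 - r ^+ 2]; the two differ by a factor
    between 1 and 2, whence the power of 2 in the constant. *)
Lemma weight_I (nu : weight R) beta : normal_exp_I nu beta -> exists2 c : R, 0 < c &
  forall r s : R, 0 <= r -> r <= s -> s < 1 ->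
  nu r%:C * (1 - s) `^ beta <= c * nu s%:C * (1 - r) `^ beta.
Proof.
move=> [b0 [c c0 cP]]; exists (c * 2 `^ beta); first by rewrite mulr_gt0 ?powR_gt0.
move=> r s r0 rs s1; have r1 := le_lt_trans rs s1; have s0 := le_trans r0 rs.
have dr := disk_real r0 r1; have ds := disk_real s0 s1.
have ns := weight_gt0 nu ds; have nr := weight_gt0 nu dr.
have pr : 0 < 1 - r ^+ 2 by rewrite subr_gt0 expr_lt1.
have ps : 0 < 1 - s ^+ 2 by rewrite subr_gt0 expr_lt1.
have := cP r s r0 rs s1; rewrite ler_pdivrMr ?powR_gt0// mulrA mulrAC.
rewrite ler_pdivlMr ?powR_gt0// => H.
apply: (@le_trans _ _ (nu r%:C * (1 - s ^+ 2) `^ beta)).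
  rewrite ler_pM2l// ge0_ler_powR ?nnegrE ?subr_ge0 ?(ltW b0) ?(ltW s1)//.
    by rewrite ltW// -subr_gt0.
  by rewrite onem_sqr_ge// ltW.
apply: le_trans H _; rewrite -!mulrA ler_pM2l// [leRHS]mulrCA ler_pM2l//.
rewrite -powRM ?subr_ge0 ?(ltW r1)// ge0_ler_powR ?nnegrE ?(ltW b0) ?(ltW pr)//.
  by rewrite mulr_ge0// subr_ge0 ltW.
by rewrite onem_sqr_le// ltW.
Qed.

Lemma weight_II (nu : weight R) gamma : normal_exp_II nu gamma -> exists2 c : R, 0 < c &
  forall r s : R, 0 <= r -> r <= s -> s < 1 ->
  nu s%:C * (1 - r) `^ gamma <= c * nu r%:C * (1 - s) `^ gamma.
Proof.
move=> [b0 [c c0 cP]]; exists (c * 2 `^ gamma); first by rewrite mulr_gt0 ?powR_gt0.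
move=> r s r0 rs s1; have r1 := le_lt_trans rs s1; have s0 := le_trans r0 rs.
have dr := disk_real r0 r1; have ds := disk_real s0 s1.
have ns := weight_gt0 nu ds; have nr := weight_gt0 nu dr.
have pr : 0 < 1 - r ^+ 2 by rewrite subr_gt0 expr_lt1.
have ps : 0 < 1 - s ^+ 2 by rewrite subr_gt0 expr_lt1.
have := cP r s r0 rs s1; rewrite ler_pdivrMr ?powR_gt0// mulrA mulrAC.
rewrite ler_pdivlMr ?powR_gt0// => H.
apply: (@le_trans _ _ (nu s%:C * (1 - r ^+ 2) `^ gamma)).
  rewrite ler_pM2l// ge0_ler_powR ?nnegrE ?subr_ge0 ?(ltW b0) ?(ltW r1)//.
    by rewrite ltW// -subr_gt0.
  by rewrite onem_sqr_ge// ltW.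
apply: le_trans H _; rewrite -!mulrA ler_pM2l// [leRHS]mulrCA ler_pM2l//.
rewrite -powRM ?subr_ge0 ?(ltW s1)// ge0_ler_powR ?nnegrE ?(ltW b0) ?(ltW ps)//.
  by rewrite mulr_ge0// subr_ge0 ltW.
by rewrite onem_sqr_le// ltW.
Qed.

Lemma onem_rad m : 1 - rad m = eps m.
Proof. by rewrite /rad; ring. Qed.

Lemma num_I (nu : weight R) beta : normal_exp_I nu beta -> exists2 c : R, 0 < c &
  forall m n, (m <= n)%N -> num nu m * eps n `^ beta <= c * num nu n * eps m `^ beta.
Proof.
move=> /weight_I[c c0 cP]; exists c => // m n mn; rewrite -!onem_rad.
by apply: cP; rewrite ?rad_ge0 ?rad_le ?rad_lt1.
Qed.

Lemma num_II (nu : weight R) gamma : normal_exp_II nu gamma -> exists2 c : R, 0 < c &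
  forall m n, (m <= n)%N -> num nu n * eps m `^ gamma <= c * num nu m * eps n `^ gamma.
Proof.
move=> /weight_II[c c0 cP]; exists c => // m n mn; rewrite -!onem_rad.
by apply: cP; rewrite ?rad_ge0 ?rad_le ?rad_lt1.
Qed.

Lemma eps_powR m s : eps m `^ s = (2^-1 `^ s) ^+ m.
Proof. by rewrite /eps powRX ?invr_ge0. Qed.

Lemma half_powR_lt1 (s : R) : 0 < s -> 2^-1 `^ s < 1 :> R.
Proof.
move=> s0; have E : 1 = 1 `^ s :> R by rewrite powR1.
rewrite [ltRHS]E gt0_ltr_powR ?nnegrE ?invr_ge0//.
by rewrite invf_lt1// ltr1n.
Qed.

Lemma numS (nu : weight R) : (exists beta, normal_exp_I nu beta) ->
  exists2 c : R, 0 < c & forall m, num nu m <= c * num nu m.+1.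
Proof.
move=> [beta /num_I[c c0 cP]]; exists (c * 2 `^ beta) => [|m].
  by rewrite mulr_gt0 ?powR_gt0.
have := cP m m.+1 (leqnSn m); rewrite [eps m]epsS powRM ?(ltW (eps_gt0 _))//.
by rewrite mulrA ler_pM2r ?powR_gt0 ?eps_gt0// mulrAC.
Qed.

(** By (II), [(num nu m)^-1] grows at least geometrically up to a constant, so the sum is dominated
    by its last term. *)
Lemma sum_num_II (nu : weight R) : (exists gamma, normal_exp_II nu gamma) ->
  exists2 c : R, 0 < c & forall n, \sum_(m < n.+1) (num nu m)^-1 <= c / num nu n.
Proof.
move=> [gamma gP]; have [g0 _] := gP; have [c c0 cP] := num_II gP.
have q1 := half_powR_lt1 g0; set q := 2^-1 `^ gamma in q1.
have q0 : 0 < q by rewrite powR_gt0// invr_gt0.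
exists (c / (1 - q)); first by rewrite divr_gt0// subr_gt0.
move=> n; apply: (@le_trans _ _ (\sum_(m < n.+1) c / num nu n * q ^+ (n - m))); last first.
  rewrite -mulr_sumr [leRHS]mulrAC ler_wpM2l ?divr_ge0 ?(ltW c0) ?(ltW (num_gt0 _ _))//.
  exact: geo_sum_rev (ltW q0) q1.
apply: ler_sum => m _; have mn : (m <= n)%N by rewrite -ltnS.
have E : q ^+ n = q ^+ m * q ^+ (n - m) by rewrite -exprD subnKC.
have := cP m n mn; rewrite !eps_powR -/q E => H.
have qm : 0 < q ^+ m by rewrite exprn_gt0.
have P0 : 0 < num nu m * num nu n * q ^+ m by rewrite !mulr_gt0 ?num_gt0.
rewrite -(ler_pM2r P0) -[num nu m * _ * _]mulrA mulKf ?gt_eqF ?num_gt0//.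
apply: le_trans H _; rewrite le_eqVlt; apply/orP; left; apply/eqP.
by field; rewrite gt_eqF ?num_gt0.
Qed.

(** By (I), the terms decay like 2^-(s - beta) per level up to a constant, so the sum is dominated
    by its first term. *)
Lemma sum_num_I (nu : weight R) beta s : normal_exp_I nu beta -> beta < s ->
  exists2 c : R, 0 < c & forall m n,
    \sum_(i < n) eps (m + i) `^ s / num nu (m + i) <= c * (eps m `^ s / num nu m).
Proof.
move=> bP bs; have [c c0 cP] := num_I bP.
have q1 : 2^-1 `^ (s - beta) < 1 :> R by rewrite half_powR_lt1// subr_gt0.
set q := 2^-1 `^ (s - beta) in q1.
have q0 : 0 < q by rewrite powR_gt0// invr_gt0.
exists (c / (1 - q)); first by rewrite divr_gt0// subr_gt0.
move=> m n; apply: (@le_trans _ _ (\sum_(i < n) c * (eps m `^ s / num nu m) * q ^+ i)); last first.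
  rewrite -mulr_sumr [leRHS]mulrAC ler_wpM2l ?mulr_ge0 ?divr_ge0 ?powR_ge0 ?invr_ge0 ?(ltW c0) ?(ltW (num_gt0 _ _))//.
  exact: geo_sum (ltW q0) q1.
apply: ler_sum => i _; have := cP m (m + i)%N (leq_addr _ _).
have e0 k := @powR_gt0 R _ beta (eps_gt0 k).
have sE k : eps k `^ s = eps k `^ beta * q ^+ k.
  rewrite /q -powRX ?invr_ge0// -/(eps k) -powRD ?subrKC//.
  by rewrite (gt_eqF (eps_gt0 _)) implybT.
rewrite !sE ler_pdivrMr ?num_gt0// [q ^+ (m + i)]exprD => H.
rewrite -(ler_pM2r (num_gt0 nu m)).
have -> : c * (eps m `^ beta * q ^+ m / num nu m) * q ^+ i * num nu (m + i) * num nu m =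
  c * num nu (m + i) * eps m `^ beta * (q ^+ m * q ^+ i).
  by field; rewrite gt_eqF ?num_gt0.
rewrite [leLHS](_ : _ = num nu m * eps (m + i) `^ beta * (q ^+ m * q ^+ i)); last by ring.
by rewrite ler_wpM2r// mulr_ge0 ?exprn_ge0 ?ltW.
Qed.

(** Condition (II) forces the weight to vanish at the boundary; this is what puts bounded analytic
    functions into the little space. *)
Lemma weight_to0 (nu : weight R) : (exists gamma, normal_exp_II nu gamma) ->
  forall e : R, 0 < e -> exists2 r : R, r < 1 &
    forall z, r < normc z -> disk z -> nu z < e.
Proof.
move=> [gamma gP] e e0; have [g0 _] := gP; have [c c0 cP] := num_II gP.
have q1 := half_powR_lt1 g0; set q := 2^-1 `^ gamma in q1.
have K0 : 0 < c * num nu 0 by rewrite mulr_gt0// num_gt0.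
have [N NP] := expr_small (powR_ge0 _ _) q1 (divr_gt0 (divr_gt0 e0 (ltr0n R 2)) K0).
exists (rad N); first exact: rad_lt1.
move=> z /ltW Nz dz; apply: le_lt_trans (weight_le_num nu dz Nz) _.
have := cP 0%N N (leq0n _); rewrite !eps_powR expr0 mulr1 -/q => /le_lt_trans; apply.
have := NP N (leqnn N); rewrite ler_pdivlMr// mulrC => /le_lt_trans; apply.
by rewrite ltr_pdivrMr// ltr_pMr// ltr1n.
Qed.

End Dyadic.

(** * Weighted growth of a function and of its derivative *)

Section WeightedDerivatives.
Context {R : realType}.
Local Notation C := R[i].
Implicit Types (mu : weight R) (y : C -> C).

Lemma onem_sqr_gt0 (z : C) : disk z -> 0 < 1 - normc z ^+ 2.
Proof. by move=> dz; rewrite subr_gt0 expr_lt1 ?normc_ge0. Qed.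

Lemma rad_near (z w : C) m : normc z <= rad m -> normc (w - z) < eps m.+1 ->
  normc w <= rad m.+1.
Proof.
move=> zm wz; rewrite -[w](subrK z) (le_trans (normc_leD _ _))//.
rewrite -(subrK (rad m) (rad m.+1)) radS_sub lerD//; exact: ltW.
Qed.

Lemma derive1_le_num mu y (K : R) m z : analytic y ->
  (forall w, disk w -> mu w * normc (y w) <= K) -> normc z <= rad m ->
  normc (derive1 y z) <= 4 * K / (num mu m.+1 * eps m.+1).
Proof.
move=> ya yK zm.
have -> : 4 * K / (num mu m.+1 * eps m.+1) = 4 * (K / num mu m.+1) / eps m.+1.
  by field; rewrite !gt_eqF ?num_gt0 ?eps_gt0.
apply: cauchy_estimate; rewrite ?eps_gt0// => w wz.
have wm := rad_near zm wz; have dw : disk w by exact: le_lt_trans wm (rad_lt1 _).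
split=> //; rewrite ler_pdivlMr ?num_gt0// mulrC; apply: le_trans (yK w dw).
by rewrite ler_wpM2r ?normc_ge0// num_le_weight.
Qed.

(** For [z] between the radii [rad m] and [rad m.+1] the Cauchy estimate takes place at level
    [m.+2]: [c * c] pays for two levels in the weight, and 32 is 4 * 8, with 1 - |z|^2 at most
    [8 * eps m.+2]. *)
Lemma derive1_weighted_le mu : (exists beta, normal_exp_I mu beta) ->
  exists2 c : R, 0 < c & forall y (K : R), analytic y ->
  (forall w, disk w -> mu w * normc (y w) <= K) ->
  forall z, disk z -> (1 - normc z ^+ 2) * mu z * normc (derive1 y z) <= c * K.
Proof.
move=> /numS[c c0 cP]; exists (32 * c * c); first by rewrite !mulr_gt0.
move=> y K ya yK z dz.
have [m /andP[mz zm]] := rad_itv (normc_ge0 z) dz.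
have D := derive1_le_num ya yK zm.
have K0 : 0 <= K.
  apply: le_trans (yK 0 (@disk0 R)); rewrite mulr_ge0 ?normc_ge0//.
  exact/ltW/weight_gt0/disk0.
have h1 : 1 - normc z ^+ 2 <= 8 * eps m.+2.
  apply: le_trans (onem_sqr_le (normc_ge0 z) (ltW dz)) _.
  have -> : 8 * eps m.+2 = 2 * eps m :> R.
    by rewrite (epsS m) (epsS m.+1) !mulrA -!natrM.
  by rewrite ler_pM2l// lerBlDl -lerBlDr.
have h2 : mu z <= c * c * num mu m.+2.
  apply: le_trans (weight_le_num mu dz mz) _; apply: le_trans (cP m) _.
  by rewrite -mulrA ler_pM2l.
have mz0 := weight_gt0 mu dz.
apply: (@le_trans _ _ (8 * eps m.+2 * (c * c * num mu m.+2) *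
    (4 * K / (num mu m.+2 * eps m.+2)))).
  rewrite ler_pM ?normc_ge0 ?mulr_ge0 ?(ltW (onem_sqr_gt0 dz)) ?(ltW mz0)//.
  by rewrite ler_pM ?(ltW (onem_sqr_gt0 dz)) ?(ltW mz0).
rewrite le_eqVlt; apply/orP; left; apply/eqP.
by field; rewrite !gt_eqF ?num_gt0 ?eps_gt0.
Qed.

(* Radial integration of a derivative bound, one dyadic annulus at a time. *)
Lemma weighted_le_derive1 mu y (K B : R) m0 : analytic y -> 0 <= K ->
  (forall z, normc z <= rad m0 -> normc (y z) <= B) ->
  (forall z, rad m0 <= normc z -> disk z ->
     (1 - normc z ^+ 2) * mu z * normc (derive1 y z) <= K) ->
  forall n z, normc z <= rad (m0 + n) ->
  normc (y z) <= B + K * \sum_(i < n) (num mu (m0 + i.+1))^-1.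
Proof.
move=> ya K0 yB yK; elim=> [|n IHn] z.
  by rewrite addn0 big_ord0 mulr0 addr0; exact: yB.
rewrite addnS => zn; rewrite big_ord_recr /= mulrDr addrA.
have [zn'|nz] := leP (normc z) (rad (m0 + n)).
  apply: le_trans (IHn z zn') _; rewrite lerDl mulr_ge0 ?invr_ge0 ?(ltW (num_gt0 _ _))//.
have z0 : 0 < normc z by exact: le_lt_trans (rad_ge0 _) nz.
(* Radial projection of [z] to the boundary of the disk handled by induction. *)
pose z' := (rad (m0 + n) / normc z)%:C * z.
have z'E : normc z' = rad (m0 + n).
  by rewrite normcM normcr ?divr_ge0 ?rad_ge0 ?normc_ge0// divfK ?gt_eqF.
have dzz : z - z' = (1 - rad (m0 + n) / normc z)%:C * z.
  by rewrite rmorphB /= /z'; ring.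
have r1 : rad (m0 + n) / normc z <= 1 by rewrite ler_pdivrMr// mul1r ltW.
have nzz : normc (z - z') <= eps (m0 + n).+1.
  rewrite dzz normcM normcr ?subr_ge0// mulrBl mul1r divfK ?gt_eqF//.
  by rewrite -radS_sub lerD2r.
have dz : disk z by exact: le_lt_trans zn (rad_lt1 _).
have seg (t : R) : 0 <= t <= 1 ->
    rad (m0 + n) <= normc (z' + t%:C * (z - z')) <= rad (m0 + n).+1.
  move=> /andP[t0 t1]; apply/andP; split; last first.
    by apply: normc_seg; rewrite ?t0// z'E rad_le.
  rewrite dzz /z' mulrA -mulrDl -rmorphM -rmorphD normcM normcr; last first.
    apply: addr_ge0; first by rewrite divr_ge0 ?rad_ge0 ?normc_ge0.
    by rewrite mulr_ge0 ?subr_ge0.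
  rewrite mulrDl divfK ?gt_eqF// lerDl !mulr_ge0 ?subr_ge0 ?normc_ge0//.
have : normc (y z - y z') <= K / (num mu (m0 + n).+1 * eps (m0 + n).+1) * normc (z - z').
  apply: (@mean_value_le _ y (derive1 y)) => t /seg/andP[t1 t2].
    by apply: analytic_hasd => //; exact: le_lt_trans t2 (rad_lt1 _).
  have dw : disk (z' + t%:C * (z - z')) by exact: le_lt_trans t2 (rad_lt1 _).
  rewrite ler_pdivlMr ?mulr_gt0 ?num_gt0 ?eps_gt0//.
  apply: le_trans (yK _ _ dw); last exact: le_trans (rad_le (leq_addr _ _)) t1.
  rewrite mulrC ler_wpM2r ?normc_ge0// mulrC.
  rewrite ler_pM ?(ltW (num_gt0 _ _)) ?(ltW (eps_gt0 _))//; last exact: num_le_weight.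
  apply: le_trans (onem_sqr_ge (normc_ge0 _) (ltW dw)).
  by rewrite -onem_rad lerD2l lerN2.
move=> H; rewrite -[y z](subrK (y z')) addrC.
apply: le_trans (normc_leD _ _) _; apply: lerD; last by apply: IHn; rewrite z'E.
apply: le_trans H _; rewrite addnS.
apply: (@le_trans _ _ (K / (num mu (m0 + n).+1 * eps (m0 + n).+1) * eps (m0 + n).+1)).
  by rewrite ler_wpM2l// divr_ge0 ?mulr_ge0 ?(ltW (num_gt0 _ _)) ?(ltW (eps_gt0 _)).
rewrite le_eqVlt; apply/orP; left; apply/eqP.
by field; rewrite !gt_eqF ?num_gt0 ?eps_gt0.
Qed.

(** The derivative bound is asked only outside [rad m0], and the inner bound [B] enters multiplied
    by [mu z]: it disappears at the boundary, as little-space membership requires. *)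
Lemma normal_derive1 mu : normal mu -> exists2 c : R, 0 < c &
  forall y (K B : R) m0, analytic y -> 0 <= K -> 0 <= B ->
  (forall z, normc z <= rad m0 -> normc (y z) <= B) ->
  (forall z, rad m0 <= normc z -> disk z ->
     (1 - normc z ^+ 2) * mu z * normc (derive1 y z) <= K) ->
  forall z, disk z -> mu z * normc (y z) <= mu z * B + c * K.
Proof.
move=> [/numS[c c0 cP] /sum_num_II[d d0 dP]].
exists (c * d); first exact: mulr_gt0.
move=> y K B m0 ya K0 B0 yB yK z dz.
have mz0 := weight_gt0 mu dz.
have [zm|mz] := leP (normc z) (rad m0).
  apply: (@le_trans _ _ (mu z * B)); first by rewrite ler_pM2l// yB.
  by rewrite lerDl !mulr_ge0 ?(ltW c0) ?(ltW d0).
have [m /andP[mz' zm]] := rad_itv (normc_ge0 z) dz.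
have m0m : (m0 <= m.+1)%N.
  rewrite leqNgt; apply/negP => /ltnW/(@rad_le R) h.
  by have := le_lt_trans zm (le_lt_trans h mz); rewrite ltxx.
have := weighted_le_derive1 ya K0 yB yK; move=> /(_ (m.+1 - m0)%N z).
rewrite subnKC// => /(_ zm) H.
have S : \sum_(i < m.+1 - m0) (num mu (m0 + i.+1))^-1 <= d / num mu m.+1.
  apply: le_trans (dP m.+1).
  rewrite -(big_mkord xpredT (fun i => (num mu i)^-1)).
  rewrite (@big_cat_nat _ _ _ m0.+1)//=.
  rewrite [leLHS](_ : _ = \sum_(m0.+1 <= i < m.+2) (num mu i)^-1).
    rewrite lerDr sumr_ge0// => i _; rewrite invr_ge0 ltW ?num_gt0//.
  rewrite -[m0.+1]add0n big_addn subSS big_mkord.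
  by apply: eq_bigr => i _; rewrite !addnS addnC.
apply: (@le_trans _ _ (mu z * (B + K * (d / num mu m.+1)))).
  rewrite ler_pM2l//; apply: le_trans H _.
  by rewrite lerD2l ler_wpM2l.
rewrite mulrDr lerD2l.
have muz : mu z <= c * num mu m.+1.
  by apply: le_trans (weight_le_num mu dz mz') _; exact: cP.
apply: (@le_trans _ _ (c * num mu m.+1 * (K * (d / num mu m.+1)))).
  by rewrite ler_wpM2r// !mulr_ge0 ?invr_ge0 ?(ltW d0) ?(ltW (num_gt0 _ _)).
rewrite le_eqVlt; apply/orP; left; apply/eqP.
by field; rewrite !gt_eqF ?num_gt0.
Qed.

Lemma weighted_le_of_derive1 mu : normal mu -> exists2 c : R, 0 < c &
  forall y (K : R), analytic y -> y 0 = 0 -> 0 <= K ->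
  (forall z, disk z -> (1 - normc z ^+ 2) * mu z * normc (derive1 y z) <= K) ->
  forall z, disk z -> mu z * normc (y z) <= c * K.
Proof.
move=> /normal_derive1[c c0 cP]; exists c => // y K ya y0 K0 yK z dz.
have := cP y K 0 0%N ya K0 (lexx 0); rewrite rad0 => H.
have := H _ _ z dz; rewrite mulr0 add0r; apply.
  move=> w w0; have -> : w = 0.
    by apply: eq0_normc; apply/eqP; rewrite eq_le w0 normc_ge0.
  by rewrite y0 normc0.
by move=> w _; exact: yK.
Qed.

(** Beyond a radius [rad m] the derivative contributes at most [e / 2]; the maximum of [y] inside
    that radius is damped by [mu], which tends to 0. *)
Lemma in_H0_of_derive1 mu y : normal mu -> analytic y ->
  in_H0 (fun z => (1 - normc z ^+ 2) * mu z) (derive1 y) -> in_H0 mu y.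
Proof.
move=> nmu ya [_ y0]; split=> // e e0.
have [c c0 cP] := normal_derive1 nmu; have [_ nII] := nmu.
have [r r1 rP] := y0 (e / 2 / c) (divr_gt0 (divr_gt0 e0 (ltr0n R 2)) c0).
have [m rm] : exists m, r < rad m.
  have : 0 < 1 - r by rewrite subr_gt0.
  by move=> /eps_small[m mP]; exists m; rewrite /rad ltrBrDl -ltrBrDr.
have [B B0 BP] := analytic_bounded ya (rad_lt1 m).
have B1 : 0 < B + 1 by rewrite ltr_wpDl.
have [s s1 sP] := weight_to0 nII (divr_gt0 (divr_gt0 e0 (ltr0n R 2)) B1).
exists s => // z sz dz.
apply: le_lt_trans (cP y (e / 2 / c) B m ya _ B0 BP _ z dz) _.
- by rewrite !divr_ge0 ?(ltW e0) ?(ltW c0).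
- by move=> w mw dw; rewrite ltW// rP// (lt_le_trans rm).
rewrite [c * _]mulrC divfK ?gt_eqF// [ltRHS]splitr ltrD2r.
have := sP z sz dz; rewrite ltr_pdivlMr//; apply: le_lt_trans.
by rewrite ler_wpM2l ?lerDl// ltW// weight_gt0.
Qed.

End WeightedDerivatives.

(** * Suprema of kernels at dyadic points *)

Lemma sum_div (V : nmodType) a b (F : nat -> V) :
  \sum_(k < 2 ^ (a + b)) F (k %/ 2 ^ b)%N = (\sum_(k < 2 ^ a) F k) *+ 2 ^ b.
Proof.
elim: b => [|b IHb].
  by rewrite addn0 mulr1n; apply: eq_bigr => k _; rewrite divn1.
rewrite addnS expnS (sum_ord_double _ (fun k => F (k %/ 2 ^ b.+1)%N)).
rewrite expnS mulnC mulrnA -IHb mulr2n -big_split; apply: eq_bigr => k _ /=.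
rewrite [(2 ^ b * 2)%N]mulnC !divnMA mulKn//; congr (_ + F (_ %/ _)%N).
by rewrite -addn1 mulnC divnMDl// divn_small// addn0.
Qed.

Section DyadicPoints.
Context {R : realType}.
Local Notation C := R[i].

Definition dpt m k : C := (rad m)%:C * rou m ^+ k.

Lemma normc_dpt m k : normc (dpt m k) = rad m.
Proof. by rewrite normcM normc_rou mulr1 normcr// rad_ge0. Qed.

Lemma disk_dpt m k : disk (dpt m k).
Proof. by rewrite /disk/= normc_dpt rad_lt1. Qed.

Lemma rou_near1 m j : normc (rou m ^+ j - 1 : C) <= j%:R * (16 * eps m).
Proof.
elim: j => [|j IHj]; first by rewrite expr0 subrr normc0 mul0r.
have -> : rou m ^+ j.+1 - 1 = rou m ^+ j * (rou m - 1) + (rou m ^+ j - 1) :> C.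
  by rewrite exprSr; ring.
rewrite (le_trans (normc_leD _ _))// -addn1 natrD mulrDl addrC lerD//.
by rewrite normcM normc_rou !mul1r epsE rou_sub1.
Qed.

Lemma eps_mul2 n j : 2 ^+ j * eps (n + j) = eps n :> R.
Proof. by rewrite /eps exprD mulrCA -exprMn divff ?pnatr_eq0// expr1n mulr1. Qed.

(* [k %/ 2 ^ (m - n)] is the ancestor at level [n] of the point [k] at level
   [m]. *)
Lemma dpt_ancestor n j k :
  normc (dpt (n + j) k - dpt n (k %/ 2 ^ j)) <= 17 * eps n.
Proof.
have -> : dpt (n + j) k - dpt n (k %/ 2 ^ j) =
   (rad (n + j) - rad n)%:C * rou (n + j) ^+ k +
   (rad n)%:C * (rou (n + j) ^+ k - rou n ^+ (k %/ 2 ^ j)).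
  by rewrite /dpt [((rad (n + j) - rad n)%:C)]rmorphB/=; ring.
(* 1 for the radii, 16 for the arguments. *)
have -> : 17 * eps n = eps n + 16 * eps n :> R by ring.
rewrite (le_trans (normc_leD _ _))// lerD//.
  rewrite normcM normc_rou mulr1 normcr ?subr_ge0 ?rad_le ?leq_addr//.
  have := @rad_lt1 R (n + j); rewrite /rad; lra.
rewrite normcM normcr ?rad_ge0// -(rou_expD n j) -exprM.
rewrite {1}(divn_eq k (2 ^ j)) exprD [(_ %/ _ * _)%N]mulnC.
have -> (x y : C) : x * y - x = x * (y - 1) by ring.
rewrite normcM normc_rou mul1r.
apply: le_trans (ler_piMl (normc_ge0 _) (ltW (rad_lt1 _))) _.
apply: le_trans (rou_near1 _ _) _.
apply: (@le_trans _ _ ((2 ^ j)%:R * (16 * eps (n + j)))).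
  rewrite ler_wpM2r ?mulr_ge0 ?(ltW (eps_gt0 _))// ler_nat ltnW//.
  by rewrite ltn_mod expn_gt0.
by rewrite natrX mulrCA eps_mul2.
Qed.

End DyadicPoints.

Section KernelSup.
Context {R : realType}.
Local Notation C := R[i].
Variables (c : C -> R) (phi : C -> C) (A : R).
Hypotheses (c_ge0 : forall z, disk z -> 0 <= c z) (c_le : forall z, disk z -> c z <= A).
Hypothesis phi_disk : forall z, disk z -> disk (phi z).

Definition kd (zeta z : C) : R := normc (1 - zeta^* * phi z).

(** The function G_s of the overview, for an abstract bounded [c] in place of the weighted modulus
    of [g]. *)
Definition ksup (s : R) (zeta : C) : R :=
  sup [set c z / kd zeta z `^ s | z in disk].

Lemma kd_ge zeta z : disk zeta -> disk z -> 1 - normc zeta <= kd zeta z.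
Proof.
move=> dzeta /phi_disk dz; rewrite -[normc zeta]normcJ; apply: kernel_norm.
  by rewrite normcJ.
exact: ltW.
Qed.

Lemma kd_gt0 zeta z : disk zeta -> disk z -> 0 < kd zeta z.
Proof. by move=> d1 d2; apply: lt_le_trans (kd_ge d1 d2); rewrite subr_gt0. Qed.

Lemma kd_le2 zeta z : disk zeta -> disk z -> kd zeta z <= 2.
Proof.
move=> d1 /phi_disk d2; rewrite /kd (le_trans (normcB_le _ _))//.
rewrite normc1 -[2]/(1 + 1) lerD2l normcM normcJ -[leRHS]mulr1.
by rewrite ler_pM ?normc_ge0// ltW.
Qed.

Lemma kd_lip zeta zeta' z : disk z -> kd zeta z <= kd zeta' z + normc (zeta - zeta').
Proof.
move=> /phi_disk dz; rewrite /kd.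
have -> : 1 - zeta^* * phi z = (1 - zeta'^* * phi z) - (zeta - zeta')^* * phi z.
  by rewrite rmorphB/=; ring.
rewrite (le_trans (normcB_le _ _))// lerD2l normcM normcJ.
by rewrite ler_piMr ?normc_ge0// ltW.
Qed.

Lemma ksup_has_sup s zeta : 0 <= s -> disk zeta ->
  has_sup [set c z / kd zeta z `^ s | z in disk].
Proof.
move=> s0 dzeta; have z1 : 0 < 1 - normc zeta by rewrite subr_gt0.
split; first by exists (c 0 / kd zeta 0 `^ s), 0 => //; exact: disk0.
exists (A / (1 - normc zeta) `^ s) => _ [z dz <-].
rewrite ler_pM ?c_ge0 ?invr_ge0 ?powR_ge0 ?c_le//.
rewrite lef_pV2 ?posrE ?powR_gt0 ?kd_gt0// ge0_ler_powR ?nnegrE ?(ltW z1)//.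
  exact/ltW/kd_gt0.
exact: kd_ge.
Qed.

Lemma ksup_ge s zeta z : 0 <= s -> disk zeta -> disk z ->
  c z / kd zeta z `^ s <= ksup s zeta.
Proof.
move=> s0 d1 dz; apply: sup_upper_bound; first exact: ksup_has_sup.
by exists z.
Qed.

Lemma ksup_le s zeta K : (forall z, disk z -> c z / kd zeta z `^ s <= K) ->
  ksup s zeta <= K.
Proof.
move=> H; apply: sup_le_ub; last by move=> _ [z dz <-]; exact: H.
by exists (c 0 / kd zeta 0 `^ s), 0 => //; exact: disk0.
Qed.

Lemma ksup_ge0 s zeta : 0 <= s -> disk zeta -> 0 <= ksup s zeta.
Proof.
move=> s0 d1; apply: le_trans (ksup_ge s0 d1 (@disk0 R)).
by rewrite divr_ge0 ?powR_ge0// c_ge0//; exact: disk0.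
Qed.

(** [kd zeta' z] is at least the distance of [zeta'] to the unit circle, so a displacement by [k]
    times that distance changes the denominator by a factor at most [1 + k]. *)
Lemma ksup_compare s zeta zeta' (k : R) : 0 <= s -> 0 <= k -> disk zeta -> disk zeta' ->
  normc (zeta - zeta') <= k * (1 - normc zeta') ->
  ksup s zeta' <= (1 + k) `^ s * ksup s zeta.
Proof.
move=> s0 k0 d1 d2 dk; apply: ksup_le => z dz.
have kz := kd_gt0 d1 dz; have kz' := kd_gt0 d2 dz.
have k1 : 0 <= 1 + k by rewrite addr_ge0.
apply: (@le_trans _ _ ((1 + k) `^ s * (c z / kd zeta z `^ s))); last first.
  by rewrite ler_wpM2l ?powR_ge0// ksup_ge.
rewrite mulrCA ler_wpM2l ?c_ge0// ler_pdivlMr ?powR_gt0// mulrC ler_pdivrMr ?powR_gt0//.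
rewrite -powRM ?(ltW kz')// ge0_ler_powR ?nnegrE ?mulr_ge0 ?(ltW kz) ?(ltW kz')//.
apply: le_trans (kd_lip zeta zeta' dz) _; rewrite mulrDl mul1r lerD2l.
by apply: le_trans dk _; rewrite ler_wpM2l// kd_ge.
Qed.

Section Discrete.
Variable nu : weight R.

(* For [s = alpha + 3] this is comparable to the mass of a square of side
   [eps m] at level [m] for the weight in the integral condition. *)
Definition kw (s : R) m := eps m `^ (s - 1) / num nu m.

Definition ksum (s : R) M :=
  \sum_(m < M) kw s m * \sum_(k < 2 ^ m) ksup s (dpt m k).

Definition ksummable s := exists B : R, forall M, ksum s M <= B.

Lemma kw_ge0 s m : 0 <= kw s m.
Proof. by rewrite divr_ge0 ?powR_ge0// ltW// num_gt0. Qed.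

(** At a point of level [m] every denominator is at least [eps m], so the additional quotient of
    [t]-th powers is at most 1. *)
Lemma ksummable_incr s t : 0 <= s -> 0 <= t -> ksummable s -> ksummable (s + t).
Proof.
move=> s0 t0 [B BP]; exists B => M; apply: le_trans (BP M).
apply: ler_sum => m _; rewrite !mulr_sumr; apply: ler_sum => k _.
have en0 := @eps_gt0 R m.
have -> : kw (s + t) m = kw s m * eps m `^ t.
  rewrite /kw mulrAC -powRD ?(gt_eqF en0) ?implybT//.
  by congr (_ `^ _ / _); ring.
rewrite -mulrA ler_wpM2l ?kw_ge0//.
rewrite mulrC -ler_pdivlMr ?powR_gt0//; apply: ksup_le => z dz.
have kz := kd_gt0 (disk_dpt m k) dz.
rewrite ler_pdivlMr ?powR_gt0//; apply: le_trans (ksup_ge s0 (disk_dpt m k) dz).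
rewrite powRD ?(gt_eqF kz) ?implybT// invfM -!mulrA ler_wpM2l ?c_ge0//.
rewrite ler_piMr ?invr_ge0 ?powR_ge0// mulrC ler_pdivrMr ?powR_gt0// mul1r.
rewrite ge0_ler_powR ?nnegrE ?(ltW en0) ?(ltW kz)//.
by have := kd_ge (disk_dpt m k) dz; rewrite normc_dpt onem_rad.
Qed.

Lemma scale_choice m (d : R) : eps m <= d -> d <= 2 ->
  exists2 n, (n <= m)%N & eps n <= d <= 2 * eps n.
Proof.
elim: m => [|m IHm]; first by rewrite /eps expr0 => h1 h2; exists 0%N; rewrite // expr0 h1 mulr1.
move=> h1 h2; have [/IHm[//|n nm nP]|/ltW h3] := leP (eps m) d.
  by exists n => //; exact: leqW.
by exists m.+1 => //; rewrite h1 -epsS.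
Qed.

(** For each [z], the denominator [d] at the point of level [m] singles out a scale [n]; the
    ancestor at level [n] is within [17 * eps n], hence its denominator is at most [18 * d]. Summing
    over all [n] removes the dependence of the scale on [z]. *)
Lemma ksup_ancestors s t m k : 0 <= s -> 0 <= t ->
  ksup s (dpt m k) <= 18 `^ (s + t) * 2 `^ t *
    \sum_(n < m.+1) eps n `^ t * ksup (s + t) (dpt n (k %/ 2 ^ (m - n))).
Proof.
move=> s0 t0; have st0 : 0 <= s + t by rewrite addr_ge0.
apply: ksup_le => z dz; set d := kd (dpt m k) z.
have d0 : 0 < d := kd_gt0 (disk_dpt m k) dz.
have [n nm /andP[nd dn]] : exists2 n, (n <= m)%N & eps n <= d <= 2 * eps n.
  apply: scale_choice; last by apply: kd_le2 => //; exact: disk_dpt.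
  by have := kd_ge (disk_dpt m k) dz; rewrite normc_dpt onem_rad.
set K := 18 `^ _ * _.
have K0 : 0 <= K by rewrite mulr_ge0 ?powR_ge0.
pose F i := eps i `^ t * ksup (s + t) (dpt i (k %/ 2 ^ (m - i))).
have F0 i : 0 <= F i by rewrite mulr_ge0 ?powR_ge0// ksup_ge0//; exact: disk_dpt.
apply: (@le_trans _ _ (K * F n)); last first.
  rewrite ler_wpM2l// (bigD1 (inord n : 'I_m.+1))//= inordK ?ltnS// lerDl.
  by apply: sumr_ge0 => i _; exact: F0.
pose z' : C := dpt n (k %/ 2 ^ (m - n)); have dz' : disk z' by exact: disk_dpt.
apply: (@le_trans _ _ (K * (eps n `^ t * (c z / kd z' z `^ (s + t))))); last first.
  by rewrite ler_wpM2l// ler_wpM2l ?powR_ge0// ksup_ge.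
have d'0 : 0 < kd z' z by exact: kd_gt0.
have dd' : kd z' z <= 18 * d.
  apply: le_trans (kd_lip z' (dpt m k) dz) _.
  have -> : 18 * d = d + 17 * d by ring.
  rewrite lerD2l normc_distC; apply: le_trans (_ : 17 * eps n <= _).
    by have := @dpt_ancestor R n (m - n) k; rewrite subnKC.
  by rewrite ler_pM2l.
rewrite [leRHS](_ : _ = c z * (K * eps n `^ t / kd z' z `^ (s + t))); last by ring.
rewrite ler_wpM2l ?c_ge0// ler_pdivlMr ?powR_gt0// mulrC ler_pdivrMr ?powR_gt0//.
apply: (@le_trans _ _ ((18 * d) `^ (s + t))).
  by rewrite ge0_ler_powR ?nnegrE ?mulr_ge0 ?(ltW d'0) ?(ltW d0).
rewrite powRM ?(ltW d0)// [d `^ (s + t)]powRD ?(gt_eqF d0) ?implybT//.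
rewrite [leRHS](_ : _ = 18 `^ (s + t) * (d `^ s * (2 `^ t * eps n `^ t))); last by rewrite /K; ring.
rewrite ler_wpM2l ?powR_ge0// ler_wpM2l ?powR_ge0//.
by rewrite -powRM ?(ltW (eps_gt0 _))// ge0_ler_powR ?nnegrE ?mulr_ge0 ?(ltW d0) ?(ltW (eps_gt0 _)).
Qed.

(** Each level is charged to its ancestors and the order of summation exchanged. A point of level
    [n] has [2 ^ i] descendants at level [n + i], which costs one power of [eps]: the exponent
    [s - 1] drops to [s - 2], and (I) sums over [i] because [beta < s - 2]. *)
Lemma ksummable_decr s t beta : normal_exp_I nu beta -> beta < s - 2 -> 0 <= t ->
  ksummable (s + t) -> ksummable s.
Proof.
move=> bP bs t0 [B BP]; have [b0 _] := bP.
have s0 : 0 <= s by move: b0 bs; lra.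
have st0 : 0 <= s + t by rewrite addr_ge0.
have [D D0 DP] := sum_num_I bP bs.
pose K : R := 18 `^ (s + t) * 2 `^ t.
have K0 : 0 <= K by rewrite mulr_ge0 ?powR_ge0.
exists (K * D * B) => M.
pose S n := \sum_(k < 2 ^ n) ksup (s + t) (dpt n k).
have S0 n : 0 <= S n by apply: sumr_ge0 => k _; rewrite ksup_ge0//; exact: disk_dpt.
(* Share of the ancestors of level [n] in level [m]; the value 0 for [n > m] lets both indices run
   over all levels below [M]. *)
pose T m n : R := if (n <= m)%N then kw s m * eps n `^ t * (2 ^+ (m - n) * S n) else 0.
have T0 m n : 0 <= T m n.
  rewrite /T; case: ifP => // _; apply: mulr_ge0.
    by rewrite mulr_ge0 ?kw_ge0 ?powR_ge0.
  by rewrite mulr_ge0 ?exprn_ge0.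
apply: (@le_trans _ _ (K * \sum_(m < M) \sum_(n < M) T m n)).
  rewrite mulr_sumr; apply: ler_sum => m _.
  apply: (@le_trans _ _ (kw s m * \sum_(k < 2 ^ m) K * \sum_(n < m.+1)
      eps n `^ t * ksup (s + t) (dpt n (k %/ 2 ^ (m - n))))).
    rewrite ler_wpM2l ?kw_ge0//; apply: ler_sum => k _; exact: ksup_ancestors.
  rewrite -mulr_sumr exchange_big /= mulrCA ler_wpM2l// mulr_sumr.
  rewrite (eq_bigr (fun n : 'I_m.+1 => T m n)); last first.
    move=> n _; have nm : (n <= m)%N by rewrite -ltnS.
    rewrite /T nm -mulr_sumr [LHS]mulrA; congr (_ * _).
    have := sum_div n (m - n) (fun k => ksup (s + t) (dpt n k)).
    by rewrite subnKC// => ->; rewrite -[LHS]mulr_natl natrX.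
  rewrite -!(big_mkord xpredT (T m)) (@big_cat_nat _ _ _ m.+1 0 M)//=.
  by rewrite lerDl sumr_ge0.
rewrite exchange_big -[K * D * B]mulrA ler_wpM2l//=.
apply: (@le_trans _ _ (D * ksum (s + t) M)); last by rewrite ler_pM2l.
rewrite mulr_sumr; apply: ler_sum => n _; rewrite -/(S n).
rewrite -(big_mkord xpredT (fun m => T m n)) (@big_cat_nat _ _ _ n 0 M)//=; last exact: ltnW.
rewrite big_nat_cond big1 ?add0r; last first.
  by move=> m /andP[/andP[_ mn] _]; rewrite /T leqNgt mn.
rewrite -{1}[n : nat]add0n big_addn big_mkord.
have -> : \sum_(i < M - n) T (i + n)%N n =
    eps n `^ t * S n * (eps n * \sum_(i < M - n) eps (n + i) `^ (s - 2) / num nu (n + i)).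
  rewrite mulrA mulr_sumr; apply: eq_bigr => i _.
  rewrite /T leq_addl addnK [(i + n)%N]addnC /kw.
  have E : eps (n + i) `^ (s - 1) = eps (n + i) `^ (s - 2) * eps (n + i) :> R.
    rewrite -{3}[eps (n + i)]powRr1 ?(ltW (eps_gt0 _))//.
    rewrite -powRD ?(gt_eqF (eps_gt0 _)) ?implybT//; congr (_ `^ _); ring.
  have E2 : eps (n + i) * 2 ^+ i = eps n :> R.
    by rewrite mulrC eps_mul2.
  by rewrite E -E2; ring.
apply: (@le_trans _ _ (eps n `^ t * S n * (eps n * (D * (eps n `^ (s - 2) / num nu n))))).
  by rewrite ler_wpM2l ?mulr_ge0 ?powR_ge0// ler_wpM2l ?DP// ltW// eps_gt0.
rewrite le_eqVlt; apply/orP; left; apply/eqP; rewrite /kw.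
have -> : eps n `^ (s + t - 1) = eps n `^ t * eps n `^ (s - 2) * eps n :> R.
  rewrite -{4}[eps n]powRr1 ?(ltW (eps_gt0 _))//.
  rewrite -!powRD ?(gt_eqF (eps_gt0 _)) ?implybT//; congr (_ `^ _); ring.
by ring.
Qed.

End Discrete.

End KernelSup.

(** * Discretization of the integral *)

Section IntegralComparison.
Local Open Scope ereal_scope.
Context d (T : measurableType d) (R : realType) (m : {measure set T -> \bar R}).

(* No measurability is required: the integral of a nonnegative function is a
   supremum over the simple functions below it. *)
Lemma ge0_le_integral_any (D : set T) (f g : T -> \bar R) :
  (forall x, D x -> 0 <= f x) -> (forall x, D x -> f x <= g x) ->
  \int[m]_(x in D) f x <= \int[m]_(x in D) g x.
Proof.
move=> f0 fg; have g0 x : D x -> 0 <= g x.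
  by move=> Dx; apply: le_trans (f0 x Dx) (fg x Dx).
rewrite !ge0_integralE//; apply: ereal_sup_le => _ [h /= hf <-].
exists h => // x; apply: le_trans (hf x) _; rewrite /patch.
by case: ifPn => // /set_mem; exact: fg.
Qed.

Lemma integral_scaled_indic (A : set T) (b : R) : measurable A -> (0 <= b)%R ->
  \int[m]_x (b * \1_A x)%:E = b%:E * m A.
Proof.
move=> mA b0; under eq_integral do rewrite EFinM.
rewrite ge0_integralZl_EFin ?integral_indic ?setIT//.
by apply/measurable_EFinP; exact: measurable_indic.
Qed.

Lemma measurable_scaled_indic (A : set T) (b : R) : measurable A ->
  measurable_fun [set: T] (fun x : T => (b * \1_A x)%:E : \bar R).
Proof.
move=> mA; apply/measurable_EFinP; exact: measurable_funM.
Qed.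

End IntegralComparison.

Section Squares.
Context {R : realType}.
Local Notation C := R[i].

Definition square (z : C) (r : R) : set (R * R) :=
  `[complex.Re z - r, complex.Re z + r] `*` `[complex.Im z - r, complex.Im z + r].

Lemma measurable_square z r : measurable (square z r).
Proof. by apply: measurableX. Qed.

Lemma measure_square z r : 0 < r ->
  (lebesgue_measure \x lebesgue_measure)%E (square z r) = (4 * r ^+ 2)%:E.
Proof.
move=> r0; rewrite /square product_measure1E//= !lebesgue_measure_itv /= !lte_fin.
have lt (x : R) : x - r < x + r by lra.
rewrite !lt -!EFinB -EFinM; congr (_%:E); ring.
Qed.

Lemma squareP z r p : square z r p <->
  `|p.1 - complex.Re z| <= r /\ `|p.2 - complex.Im z| <= r.
Proof.
rewrite /square /= !in_itv /= !ler_distl.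
by split=> -[/andP[h1 h2] /andP[h3 h4]]; rewrite h1 h2 h3 h4.
Qed.

Lemma square_close z r p : square z r p -> normc ((p.1 +i* p.2) - z) <= 2 * r.
Proof.
move=> /squareP[h1 h2]; apply: le_trans (normc_le_ReIm _) _.
by rewrite ReB ImB mulr_natl mulr2n lerD.
Qed.

Lemma close_square z r p : normc ((p.1 +i* p.2) - z) <= r -> square z r p.
Proof.
move=> h; apply/squareP; case: z h => x y /= h.
have := normc_Re ((p.1 +i* p.2) - (x +i* y)); have := normc_Im ((p.1 +i* p.2) - (x +i* y)).
by move=> /= h1 h2; split; [exact: le_trans h2 h|exact: le_trans h1 h].
Qed.

End Squares.

Section IntegralDiscretization.
Context {R : realType}.
Local Notation C := R[i].
Variables (c : C -> R) (phi : C -> C) (A : R).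
Hypotheses (c_ge0 : forall z, disk z -> 0 <= c z) (c_le : forall z, disk z -> c z <= A).
Hypothesis phi_disk : forall z, disk z -> disk (phi z).
Variables (nu : weight R) (alpha : R).
Hypothesis nu_I : exists beta, normal_exp_I nu beta.
Hypothesis alpha_gtN3 : 0 <= alpha + 3.

Let s := alpha + 3.
Let W (zeta : C) : R := (1 - normc zeta ^+ 2) `^ alpha / nu zeta.
Let w m : R := eps m `^ alpha / num nu m.

Let w_ge0 m : 0 <= w m.
Proof. by rewrite divr_ge0 ?powR_ge0// ltW// num_gt0. Qed.

Let W_ge0 zeta : disk zeta -> 0 <= W zeta.
Proof. by move=> dz; rewrite divr_ge0 ?powR_ge0// ltW// weight_gt0. Qed.

Let kw_w m : kw nu s m = w m * eps m ^+ 2.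
Proof.
rewrite /kw /w mulrAC; congr (_ / _).
rewrite -powR_mulrn ?(ltW (eps_gt0 _))// -powRD ?(gt_eqF (eps_gt0 _)) ?implybT//.
by congr (_ `^ _); rewrite /s; ring.
Qed.

(** The logarithms of [x] and [e] differ by at most [ln 4], which handles both signs of [a] at
    once. *)
Lemma powR_between (x e a : R) : 0 < e -> e / 4 <= x -> x <= 4 * e ->
  (4 `^ `|a|)^-1 * e `^ a <= x `^ a /\ x `^ a <= 4 `^ `|a| * e `^ a.
Proof.
move=> e0 ex xe; have x0 : 0 < x by apply: lt_le_trans ex; rewrite divr_gt0.
have lnx : `|ln x - ln e| <= ln 4.
  rewrite ler_norml; apply/andP; split.
    rewrite lerNl opprB lerBlDl -lnM ?posrE// ler_ln ?posrE ?mulr_gt0//.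
    by move: ex; rewrite ler_pdivrMr.
  rewrite lerBlDr -lnM ?posrE// ler_ln ?posrE ?mulr_gt0//.
have h : `|a * ln x - a * ln e| <= `|a| * ln 4 by rewrite -mulrBr normrM ler_wpM2l.
rewrite /powR !gt_eqF// -expRN -!expRD !ler_expR.
move: h; rewrite ler_norml => /andP[h1 h2]; split.
  by move: h1; lra.
by rewrite -lerBlDr.
Qed.

(** Points this close to level [m] may lie below [rad m], though above the preceding radius; there
    [numS] compares the weights, and the 1 in [1 + C1] covers [m = 0]. *)
Lemma W_lower : exists2 k : R, 0 < k & forall m j zeta,
  normc (zeta - dpt m j) <= eps m / 4 ->
  disk zeta /\ k * w m <= W zeta.
Proof.
have [C1 C0 CP] := numS nu_I.
exists ((4 `^ `|alpha|)^-1 / (1 + C1)); first by rewrite divr_gt0 ?invr_gt0 ?powR_gt0 ?addr_gt0.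
move=> m j zeta zm; have e0 := @eps_gt0 R m.
have h1 : normc zeta <= rad m + eps m / 4.
  by rewrite -[zeta](subrK (dpt m j)) addrC (le_trans (normc_leD _ _))// normc_dpt lerD2l.
have h2 : rad m - eps m / 4 <= normc zeta.
  rewrite lerBlDr -(normc_dpt m j) -[dpt m j](subrK zeta) addrC.
  by rewrite (le_trans (normc_leD _ _))// lerD2l normc_distC.
have dz : disk zeta by apply: le_lt_trans h1 _; rewrite /rad; move: e0; lra.
split=> //.
have nz := weight_gt0 nu dz.
have n0 : nu zeta <= (1 + C1) * num nu m.
  case: m e0 zm h1 h2 => [|m] e0 zm h1 h2.
    have : nu zeta <= num nu 0 by apply: weight_le_num => //; rewrite rad0 normc_ge0.
    by move/le_trans; apply; rewrite mulrDl mul1r lerDl mulr_ge0 ?ltW ?num_gt0.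
  have : nu zeta <= num nu m.
    apply: weight_le_num => //; apply: le_trans h2.
    by rewrite /rad (epsS m); move: e0; lra.
  move/le_trans; apply; apply: le_trans (CP m) _.
  by rewrite mulrDl mul1r lerDr ltW ?num_gt0.
have [lo _] : (4 `^ `|alpha|)^-1 * eps m `^ alpha <= (1 - normc zeta ^+ 2) `^ alpha /\
   (1 - normc zeta ^+ 2) `^ alpha <= 4 `^ `|alpha| * eps m `^ alpha.
  apply: powR_between => //.
    by apply: le_trans (onem_sqr_ge (normc_ge0 _) (ltW dz)); move: h1; rewrite /rad; lra.
  by apply: le_trans (onem_sqr_le (normc_ge0 _) (ltW dz)) _; move: h2; rewrite /rad; lra.
rewrite /W ler_pdivlMr// /w.
apply: le_trans lo.
rewrite [leLHS](_ : _ = (4 `^ `|alpha|)^-1 * eps m `^ alpha * (nu zeta / ((1 + C1) * num nu m))).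
  rewrite ler_piMr ?mulr_ge0 ?invr_ge0 ?powR_ge0//.
  by rewrite ler_pdivrMr ?mul1r// mulr_gt0 ?num_gt0// addr_gt0.
by field; rewrite !gt_eqF ?powR_gt0 ?num_gt0 ?addr_gt0.
Qed.

Lemma W_upper : exists2 k : R, 0 < k & forall m zeta,
  rad m <= normc zeta <= rad m.+1 -> W zeta <= k * w m.
Proof.
have [C1 C0 CP] := numS nu_I.
exists (4 `^ `|alpha| * C1); first by rewrite mulr_gt0 ?powR_gt0.
move=> m zeta /andP[h1 h2]; have e0 := @eps_gt0 R m.
have dz : disk zeta by exact: le_lt_trans h2 (rad_lt1 _).
have nz := weight_gt0 nu dz.
have n0 : num nu m <= C1 * nu zeta.
  by apply: le_trans (CP m) _; rewrite ler_pM2l// num_le_weight.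
have [_ up] : (4 `^ `|alpha|)^-1 * eps m `^ alpha <= (1 - normc zeta ^+ 2) `^ alpha /\
   (1 - normc zeta ^+ 2) `^ alpha <= 4 `^ `|alpha| * eps m `^ alpha.
  apply: powR_between => //.
    apply: le_trans (onem_sqr_ge (normc_ge0 _) (ltW dz)).
    by move: h2; rewrite /rad (epsS m); move: (@eps_gt0 R m.+1); lra.
  by apply: le_trans (onem_sqr_le (normc_ge0 _) (ltW dz)) _; move: h1; rewrite /rad; lra.
rewrite /W ler_pdivrMr//; apply: le_trans up _; rewrite /w.
rewrite [leRHS](_ : _ = 4 `^ `|alpha| * eps m `^ alpha * (C1 * nu zeta / num nu m)).
  rewrite ler_peMr ?mulr_ge0 ?powR_ge0//.
  by rewrite ler_pdivlMr ?num_gt0// mul1r.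
by field; rewrite gt_eqF ?num_gt0.
Qed.

(** Distinct levels are separated by their radii; points of one level [m > 0] are separated by
    [4 * eps m] on the unit circle, times a radius at least 1/2. Hence the small squares around the
    points are disjoint. *)
Lemma dpt_sep m k m' k' : (k < 2 ^ m)%N -> (k' < 2 ^ m')%N ->
  normc (dpt m k - dpt m' k' : C) <= eps m / 4 + eps m' / 4 -> m = m' /\ k = k'.
Proof.
wlog mm' : m k m' k' / (m <= m')%N.
  move=> H km km' mk; have [mm'|/ltnW mm'] := leqP m m'; first exact: H.
  move: mk; rewrite [_ / 4 + _]addrC normc_distC => mk; by have [-> ->] := H _ _ _ _ mm' km' km mk.
move=> km km' mk; move: mm'; rewrite leq_eqVlt => /orP[/eqP mm'|mm']; last first.
  have h : eps m' <= eps m / 2 :> R by rewrite (epsS m) mulrAC divff ?mul1r ?eps_le// pnatr_eq0.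
  have := normc_lerB (dpt m' k' : C) (dpt m k); rewrite !normc_dpt normc_distC.
  move/le_trans => /(_ _ mk); rewrite /rad => h2.
  by exfalso; have := @eps_gt0 R m; move: h h2; lra.
subst m'; split=> //; apply/eqP; rewrite -[_ == _]negbK; apply/negP => kk'.
have m0 : (0 < m)%N by case: m km km' kk' {mk} => // ; case: k; case: k'.
have r2 : 2^-1 <= rad m :> R.
  have := @rad_le R 1 m m0; rewrite /rad /eps expr1; lra.
have sep : 4 * eps m <= normc (rou m ^+ k - rou m ^+ k' : C).
  wlog kk : k k' km km' kk' {mk} / (k <= k')%N.
    by move=> H; have [/H->//|/ltnW/H{}H] := leqP k k'; rewrite normc_distC H// eq_sym.
  have -> : rou m ^+ k - rou m ^+ k' = - (rou m ^+ k * (rou m ^+ (k' - k) - 1)) :> C.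
    by rewrite mulrBr -exprD subnKC// mulr1 opprB.
  rewrite normcN normcM normc_rou mul1r epsE rou_sep// rou_neq1//.
  by rewrite subn_gt0 ltn_neqAle kk' kk (leq_ltn_trans (leq_subr _ _)).
move: mk; rewrite /dpt -mulrBr normcM normcr ?rad_ge0//.
apply/negP; rewrite -ltNge; apply: (@lt_le_trans _ _ (2^-1 * (4 * eps m))).
  by have := @eps_gt0 R m; lra.
by rewrite ler_pM ?mulr_ge0 ?invr_ge0 ?(ltW (eps_gt0 _)).
Qed.

Let D := [set p : R * R | disk (p.1 +i* p.2 : C)].
Let Psi (zeta : C) : \bar R :=
  (ereal_sup [set (c z / normc (1 - zeta^* * phi z) `^ s)%:E | z in disk] *
    (W zeta)%:E)%E.

Let PsiE zeta : disk zeta -> Psi zeta = (ksup c phi s zeta * W zeta)%:E.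
Proof.
move=> dz; rewrite /Psi [RHS]EFinM; congr (_ * _)%E.
have [h1 h2] := ksup_has_sup c_ge0 c_le phi_disk alpha_gtN3 dz.
rewrite /ksup -ereal_sup_EFin//; congr ereal_sup.
by apply/seteqP; split=> [_ [z dz' <-]|_ [_ [z dz' <-] <-]];
  [exists (c z / kd phi zeta z `^ s) => //; exists z|exists z].
Qed.

Let Psi_ge0 zeta : disk zeta -> (0 <= Psi zeta)%E.
Proof.
by move=> dz; rewrite PsiE// lee_fin mulr_ge0 ?W_ge0// (ksup_ge0 c_ge0 c_le).
Qed.

Local Notation leb2 := (lebesgue_measure \x lebesgue_measure)%E.

(** On each of the disjoint small squares the integrand is at least a constant multiple of its size
    at the centre, so a step function with these values lies below it. *)
Lemma ksummable_of_integral :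
  (\int[leb2]_(p in D) Psi (p.1 +i* p.2) < +oo)%E -> ksummable c phi nu s.
Proof.
move=> int_lt; have [k1 k0 kP] := W_lower.
(* 4/3 is 1 + 1/3: the points of a square are within [eps m / 4] of its centre, whose distance to
   the unit circle is [eps m]. *)
pose K := (4 / 3) `^ s; have K0 : 0 < K by rewrite powR_gt0// divr_gt0.
pose b m k := k1 * w m / K * ksup c phi s (dpt m k).
have b0 m k : 0 <= b m k.
  apply: mulr_ge0; first by apply: divr_ge0 (ltW K0); exact: mulr_ge0 (ltW k0) (w_ge0 m).
  by apply: (ksup_ge0 c_ge0 c_le) => //; exact: disk_dpt.
pose Q m k := square (dpt m k : C) (eps m / 8).
have Qe m k p : Q m k p -> normc ((p.1 +i* p.2) - dpt m k) <= eps m / 4.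
  by move=> /square_close /le_trans; apply; lra.
have lower m k p : Q m k p -> disk (p.1 +i* p.2 : C) /\ ((b m k)%:E <= Psi (p.1 +i* p.2))%E.
  move=> /Qe pm; have [dp Wp] := kP _ _ _ pm; split=> //.
  rewrite PsiE// lee_fin.
  have h := @ksup_compare _ c phi A c_ge0 c_le phi_disk s (p.1 +i* p.2) (dpt m k) (3^-1).
  have e0 := @eps_gt0 R m.
  have -> : b m k = (ksup c phi s (dpt m k) / K) * (k1 * w m) by rewrite /b; ring.
  apply: ler_pM Wp.
  - apply: divr_ge0 (ltW K0); apply: (ksup_ge0 c_ge0 c_le) => //; exact: disk_dpt.
  - exact: mulr_ge0 (ltW k0) (w_ge0 m).
  rewrite ler_pdivrMr// mulrC /K (_ : 4 / 3 = 1 + 3^-1); last by field.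
  apply: h => //; first exact: disk_dpt.
  by rewrite normc_dpt onem_rad; lra.
have key M : (\sum_(m < M) \sum_(k < 2 ^ m) (b m k)%:E * leb2 (Q m k) <=
    \int[leb2]_(p in D) Psi (p.1 +i* p.2))%E.
  pose g (p : R * R) := (\sum_(m < M) \sum_(k < 2 ^ m) b m k * \1_(Q m k) p)%R.
  have gE p : ((g p)%:E = \sum_(m < M) \sum_(k < 2 ^ m) (b m k * \1_(Q m k) p)%:E)%E.
    by rewrite /g -sumEFin; apply: eq_bigr => m _; rewrite -sumEFin.
  have mQ m k : measurable (Q m k) by exact: measurable_square.
  have -> : (\sum_(m < M) \sum_(k < 2 ^ m) (b m k)%:E * leb2 (Q m k) =
      \int[leb2]_p (g p)%:E)%E.
    under [RHS]eq_integral do rewrite gE.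
    rewrite ge0_integral_sum//; last 2 first.
    - by move=> m; apply: emeasurable_sum => k; apply: measurable_scaled_indic; exact: mQ.
    - by move=> m p _; apply: sume_ge0 => k _; rewrite lee_fin mulr_ge0.
    apply: eq_bigr => m _; rewrite ge0_integral_sum//; last 2 first.
    - by move=> k; apply: measurable_scaled_indic; exact: mQ.
    - by move=> k p _; rewrite lee_fin mulr_ge0.
    by apply: eq_bigr => k _; apply/esym/integral_scaled_indic; [exact: mQ|exact: b0].
  rewrite [leRHS]integral_mkcond; apply: ge0_le_integral_any => p _.
    by rewrite gE; apply: sume_ge0 => m _; apply: sume_ge0 => k _; rewrite lee_fin mulr_ge0.
  have [[m0 [kk [kk2 Qp]]]|noQ] := pselect (exists m0 : 'I_M, exists kk, (kk < 2 ^ m0)%N /\ Q m0 kk p).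
    have [dp bp] := lower _ _ _ Qp.
    have uniq m k : (k < 2 ^ m)%N -> Q m k p -> m = m0 /\ k = kk.
      move=> k2 /Qe h; have h' := Qe _ _ _ Qp.
      apply: (dpt_sep k2 kk2); rewrite (_ : dpt m k - dpt m0 kk =
        ((p.1 +i* p.2) - dpt m0 kk) - ((p.1 +i* p.2) - dpt m k)); last by ring.
      by rewrite (le_trans (normcB_le _ _))// addrC; apply: lerD.
    have -> : (g p)%:E = (b m0 kk)%:E.
      congr (_%:E); rewrite /g (bigD1 m0)//= (bigD1 (Ordinal kk2))//=.
      rewrite [X in _ + X + _]big1 ?addr0 => [|k kn]; last first.
        rewrite indicE; case: (boolP (p \in Q m0 k)) => [|_]; last by rewrite mulr0.
        move=> /set_mem/(uniq _ _ (ltn_ord k))[_ E].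
        by case/negP: kn; apply/eqP/val_inj.
      rewrite [X in _ + X]big1 ?addr0 => [|m mn]; last first.
        apply: big1 => k _.
        rewrite indicE; case: (boolP (p \in Q m k)) => [|_]; last by rewrite mulr0.
        move=> /set_mem/(uniq _ _ (ltn_ord k))[E _].
        by case/negP: mn; apply/eqP/val_inj.
      by rewrite indicE mem_set// mulr1.
    by rewrite patchE mem_set.
  have -> : (g p)%:E = 0%E.
    congr (_%:E); rewrite /g big1// => m _; rewrite big1// => k _.
    rewrite indicE; case: (boolP (p \in Q m k)) => [|_]; last by rewrite mulr0.
    by move=> /set_mem Qp; case: noQ; exists m, (k : nat); split.
  by rewrite patchE; case: ifPn => // /set_mem; exact: Psi_ge0.
have : (\int[leb2]_(p in D) Psi (p.1 +i* p.2))%E \is a fin_num.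
  rewrite ge0_fin_numE//; by apply: integral_ge0 => p Dp; apply: Psi_ge0.
move=> /fineK; set I := fine _ => IE.
(* 16 comes from the area [4 * (eps m / 8) ^+ 2] of a square. *)
exists (I * 16 * K / k1) => M.
have := key M; rewrite -IE.
have -> : (\sum_(m < M) \sum_(k < 2 ^ m) (b m k)%:E * leb2 (Q m k) =
    (k1 / K / 16 * ksum c phi nu s M)%:E)%E.
  rewrite /ksum mulr_sumr -sumEFin; apply: eq_bigr => m _.
  rewrite mulr_sumr mulr_sumr -sumEFin; apply: eq_bigr => k _.
  rewrite measure_square ?divr_gt0 ?eps_gt0// -EFinM; congr (_%:E).
  by rewrite /b kw_w; field; rewrite gt_eqF.
rewrite lee_fin => H; rewrite -(ler_pM2l (_ : 0 < k1 / K / 16)); last by rewrite !divr_gt0.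
apply: le_trans H _; rewrite le_eqVlt; apply/orP; left; apply/eqP.
by field; rewrite !gt_eqF.
Qed.

Lemma dpt_cover (zeta : C) : disk zeta -> exists m, exists2 k, (k < 2 ^ m)%N &
  rad m <= normc zeta <= rad m.+1 /\ normc (zeta - dpt m k) <= 17 * eps m.
Proof.
move=> dz; have [m mP] := rad_itv (normc_ge0 zeta) dz.
have [u u1 zu] : exists2 u : C, normc u = 1 & zeta = (normc zeta)%:C * u.
  have [->|z0] := eqVneq zeta 0; first by exists 1; rewrite ?normc1// normc0 mul0r.
  have n0 : 0 < normc zeta by rewrite normc_gt0.
  exists (zeta / (normc zeta)%:C); last first.
    by rewrite mulrC divfK// -normc_gt0 normcr ?normc_ge0.
  by rewrite normcM normcV normcr ?normc_ge0// divff// gt_eqF.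
have [k kP] := rou_cover m u1.
exists m, k => //; split=> //; have /andP[m1 m2] := mP.
have -> : zeta - dpt m k = (normc zeta - rad m)%:C * u + (rad m)%:C * (u - rou m ^+ k).
  rewrite {1}zu /dpt [(normc zeta - _)%:C]rmorphB [X in _ = X * u + _]/=; ring.
rewrite (le_trans (normc_leD _ _))// (_ : 17 * _ = eps m + 16 * eps m); last by ring.
rewrite !normcM u1 mulr1 !normcr ?rad_ge0 ?subr_ge0//; apply: lerD.
  by move: m2; rewrite /rad; have := @eps_gt0 R m.+1; lra.
rewrite -[leRHS]mul1r; apply: ler_pM => //; rewrite ?rad_ge0 ?normc_ge0 ?(ltW (rad_lt1 _))//.
by rewrite epsE.
Qed.

(** The squares of half side [17 * eps m] cover the disk by [dpt_cover]; they overlap, but only the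
    sum of their areas enters. Term-by-term integration is applied to their indicators. *)
Lemma integral_of_ksummable : ksummable c phi nu s ->
  (\int[leb2]_(p in D) Psi (p.1 +i* p.2) < +oo)%E.
Proof.
move=> [B BP]; have [k2 k0 kP] := W_upper.
(* 35 is 1 + 34, as [17 * eps m = 34 * eps m.+1] and the point is at distance at least [eps m.+1]
   from the unit circle. *)
pose K := 35 `^ s; have K0 : 0 < K by rewrite powR_gt0.
pose b m k := K * k2 * w m * ksup c phi s (dpt m k).
have b0 m k : 0 <= b m k.
  apply: mulr_ge0; last by apply: (ksup_ge0 c_ge0 c_le) => //; exact: disk_dpt.
  by apply: mulr_ge0 (w_ge0 m); apply: mulr_ge0; exact: ltW.
pose Q m k := square (dpt m k : C) (17 * eps m).
have mQ m k : measurable (Q m k) by exact: measurable_square.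
pose h m p : \bar R := (\sum_(k < 2 ^ m) (b m k * \1_(Q m k) p)%:E)%E.
have h0 m p : (0 <= h m p)%E.
  by apply: sume_ge0 => k _; rewrite lee_fin mulr_ge0.
have mh m : measurable_fun [set: R * R] (h m).
  by apply: emeasurable_sum => k; apply: measurable_scaled_indic; exact: mQ.
have bound p : D p -> (Psi (p.1 +i* p.2) <= \sum_(m <oo) h m p)%E.
  move=> Dp; have [m [k k2' [mP pk]]] := dpt_cover Dp.
  apply: (@le_trans _ _ (h m p)); last first.
    apply: le_trans (nneseries_lim_ge m.+1 _) => [|n _ _]; last exact: h0.
    by rewrite big_mkord big_ord_recr /= leeDr// sume_ge0.
  apply: (@le_trans _ _ (b m k * \1_(Q m k) p)%:E); last first.
    rewrite /h (bigD1 (Ordinal k2'))//= leeDl// sume_ge0// => j _.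
    by rewrite lee_fin mulr_ge0.
  rewrite indicE mem_set ?mulr1; last exact: close_square.
  rewrite PsiE// lee_fin (_ : b m k = (K * ksup c phi s (dpt m k)) * (k2 * w m)); last first.
    by rewrite /b; ring.
  apply: ler_pM; [|exact: W_ge0| |exact: kP].
    exact: (ksup_ge0 c_ge0 c_le).
  rewrite /K (_ : 35 = 1 + 34); last by ring.
  apply: (@ksup_compare _ c phi A) => //; first exact: disk_dpt.
  rewrite normc_distC; apply: le_trans pk _; move/andP: mP => [_].
  by rewrite /rad (epsS m); lra.
apply: le_lt_trans (_ : (\int[leb2]_p (\sum_(m <oo) h m p) < +oo)%E).
  rewrite integral_mkcond; apply: ge0_le_integral_any => p _; rewrite patchE; case: ifPn => //.
    by move=> /set_mem; exact: Psi_ge0.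
    by move=> /set_mem; exact: bound.
  by move=> _; apply: nneseries_ge0 => m _ _; exact: h0.
rewrite integral_nneseries//.
(* 1156 is 4 * 17^2, from the area of a square. *)
apply: (@le_lt_trans _ _ (K * k2 * 1156 * B)%:E); last exact: ltry.
apply: lime_le.
  by apply: is_cvg_nneseries => m _ _; apply: integral_ge0 => p _; exact: h0.
apply: nearW => M.
apply: (@le_trans _ _ (K * k2 * 1156 * ksum c phi nu s M)%:E); last first.
  rewrite lee_fin; apply: ler_wpM2l (BP M).
  exact: mulr_ge0 (mulr_ge0 (ltW K0) (ltW k0)) (ler0n R 1156).
rewrite big_mkord /ksum mulr_sumr -sumEFin; apply: lee_sum => m _.
rewrite /h ge0_integral_sum//; last 2 first.
- by move=> k; apply: measurable_scaled_indic; exact: mQ.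
- by move=> k p _; rewrite lee_fin mulr_ge0.
rewrite mulr_sumr mulr_sumr -sumEFin; apply: lee_sum => k _.
have -> : (\int[leb2]_p (b m k * \1_(Q m k) p)%:E = (b m k)%:E * leb2 (Q m k))%E.
  by apply: integral_scaled_indic; [exact: mQ|exact: b0].
rewrite measure_square ?mulr_gt0 ?eps_gt0// -EFinM lee_fin.
by rewrite /b kw_w le_eqVlt; apply/orP; left; apply/eqP; ring.
Qed.

End IntegralDiscretization.

(** * Necessity *)

Section SumOfKernels.
Context {R : realType}.
Local Notation C := R[i].

Lemma bernoulli (e : R) n : 0 <= e -> 1 + n%:R * e <= (1 + e) ^+ n.
Proof.
move=> e0; elim: n => [|n IHn]; first by rewrite expr0 mul0r addr0.
rewrite exprS; apply: (@le_trans _ _ ((1 + e) * (1 + n%:R * e))).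
  rewrite -[n.+1]addn1 natrD; have : 0 <= e * (n%:R * e) by rewrite !mulr_ge0.
  by lra.
by rewrite ler_wpM2l// addr_ge0.
Qed.

(** With e = [eps m]: (1 - e) (1 + e) <= 1, and Bernoulli's inequality gives at least 2 for the
    power 1 / e of 1 + e. *)
Lemma rad_exp m : rad m ^+ (2 ^ m) <= 2^-1 :> R.
Proof.
have e0 := ltW (@eps_gt0 R m).
have h : rad m ^+ (2 ^ m) * (1 + eps m) ^+ (2 ^ m) <= 1 :> R.
  rewrite -exprMn exprn_ile1 ?mulr_ge0 ?rad_ge0 ?addr_ge0//.
  rewrite /rad; have : 0 <= eps m * eps m :> R by rewrite mulr_ge0.
  by lra.
have b := bernoulli (2 ^ m) e0.
move: b; rewrite epsE natrX mulfV ?expf_neq0// -epsE => b.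
rewrite -[2^-1]mul1r ler_pdivlMr//; apply: le_trans h.
by rewrite ler_wpM2l ?exprn_ge0 ?rad_ge0.
Qed.

(** The Poisson kernel as a real part: sums of squared kernels reduce to the average of Cauchy
    kernels, known from [davg_kernel]. *)
Lemma poisson_kernel (y : C) : 1 - y != 0 ->
  (1 - normc y ^+ 2) * (normc (1 - y) ^+ 2)^-1 = 2 * complex.Re (1 - y)^-1 - 1.
Proof.
case: y => a b h; have := h; rewrite -normc_gt0 => /= h'.
have n0 : (1 - a) ^+ 2 + (0 - b) ^+ 2 != 0.
  by apply: contraTneq h' => ->; rewrite sqrtr0 ltxx.
rewrite /= !sqr_sqrtr ?addr_ge0 ?sqr_ge0//; field.
by move: n0; congr (_ != 0); ring.
Qed.

(** 3 is 2 * 2 - 1: the condition on [x] makes [x ^+ (2 ^ m)] at most 1/2 in modulus, so the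
    averaged Cauchy kernel is at most 2. *)
Lemma sum_kernel_sqr m (x : C) : normc x <= rad m ->
  \sum_(k < 2 ^ m) (normc (1 - x * (rou m ^+ k)^-1) ^+ 2)^-1 <=
  3 * 2 ^+ m / (1 - normc x).
Proof.
move=> xm; have x1 : normc x < 1 by exact: le_lt_trans xm (rad_lt1 _).
have x0 := normc_ge0 x.
have v1 k : normc (rou m ^+ k)^-1 = 1 :> R by rewrite normcV normc_rou invr1.
rewrite ler_pdivlMr ?subr_gt0//.
apply: (@le_trans _ _ ((1 - normc x ^+ 2) *
    \sum_(k < 2 ^ m) (normc (1 - x * (rou m ^+ k)^-1) ^+ 2)^-1)).
  rewrite mulrC ler_wpM2r//.
    by apply: sumr_ge0 => k _; rewrite invr_ge0 exprn_ge0 ?normc_ge0.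
  by rewrite lerD2l lerN2 expr2 ler_piMl// ltW.
rewrite mulr_sumr.
rewrite [leLHS](_ : _ = \sum_(k < 2 ^ m) (2 * complex.Re (1 - x * (rou m ^+ k)^-1)^-1 - 1)); last first.
  apply: eq_bigr => k _; rewrite -poisson_kernel ?kernel_neq0 ?v1//.
  by rewrite normcM v1 mulr1.
rewrite sumrB sumr_const card_ord -mulr_sumr.
have := davg_kernel m x1; rewrite /davg => /(congr1 (fun z => z * 2%:R ^+ m)).
rewrite mulfVK ?expf_neq0 ?pnatr_eq0// => E.
rewrite -(raddf_sum (@complex.Re R)) E.
have two : complex.Re ((1 - x ^+ (2 ^ m))^-1 * 2%:R ^+ m) <= 2 * 2 ^+ m.
  apply: le_trans (ler_norm _) _; apply: le_trans (normc_Re _) _.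
  rewrite normcM normcX normc_nat ler_wpM2r ?exprn_ge0//.
  rewrite normcV -[leRHS]invrK lef_pV2 ?posrE ?invr_gt0//; last first.
    by rewrite normc_gt0 one_subX_neq0// expn_gt0.
  apply: le_trans (normc_lerB _ _); rewrite normc1 normcX.
  have : normc x ^+ (2 ^ m) <= 2^-1.
    apply: (@le_trans _ _ (rad m ^+ (2 ^ m))); last exact: rad_exp.
    by rewrite lerXn2r ?nnegrE ?rad_ge0.
  by lra.
by rewrite natrX; move: two; lra.
Qed.

End SumOfKernels.

Section NuclearSum.
Context {R : realType}.
Local Notation C := R[i].

Definition rnorm (Y : normedModType C) (y : Y) : R := complex.Re `|y|.
Local Notation N := rnorm.

Lemma norm_ReE (Y : normedModType C) (y : Y) : `|y| = (N y)%:C.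
Proof.
have := normr_ge0 y; rewrite /rnorm; case: `|y| => a b; rewrite lecE /=.
by move=> /andP[/eqP -> _].
Qed.

Lemma rnorm0 (Y : normedModType C) : N (0 : Y) = 0.
Proof. by rewrite /rnorm normr0. Qed.

Lemma Nle (Y : normedModType C) (y : Y) (b : R) : (`|y| <= b%:C) = (N y <= b).
Proof. by rewrite norm_ReE lecR. Qed.

Lemma N_ge0 (Y : normedModType C) (y : Y) : 0 <= N y.
Proof. by have := normr_ge0 y; rewrite norm_ReE -[0]/(0%:C : C) lecR. Qed.

Lemma N_leD (Y : normedModType C) (x y : Y) : N (x + y) <= N x + N y.
Proof. by rewrite -Nle rmorphD /= -!norm_ReE ler_normD. Qed.

Lemma N_sum (Y : normedModType C) (I : Type) (r : seq I) (P : pred I) (F : I -> Y) :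
  N (\sum_(i <- r | P i) F i) <= \sum_(i <- r | P i) N (F i).
Proof.
elim/big_rec2: _ => [|i a b _ ab]; first by rewrite rnorm0.
by rewrite (le_trans (N_leD _ _))// lerD2l.
Qed.

Lemma N_scale (Y : normedModType C) (a : C) (y : Y) : N (a *: y) = normc a * N y.
Proof.
have : (N (a *: y))%:C = (normc a * N y)%:C :> C.
  by rewrite -norm_ReE normrZ rmorphM /= -norm_ReE.
by move=> [].
Qed.

Lemma dual_norm_ge0 (X : normedModType C) (x' : {scalar X}) : (0 <= dual_norm x')%E.
Proof.
by apply: ereal_sup_ubound; exists 0; [rewrite /= normr0 ler01|rewrite -[complex.Re _]/(normc _) linear0 normc0].
Qed.

Lemma dual_norm_ge (X : normedModType C) (x' : {scalar X}) (f : X) (B : R) :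
  0 < B -> N f <= B -> ((normc (x' f) / B)%:E <= dual_norm x')%E.
Proof.
move=> B0 fB; apply: ereal_sup_ubound; exists ((B^-1)%:C *: f).
  rewrite /= -[1]/(1%:C : C) Nle N_scale normcr ?invr_ge0 ?(ltW B0)//.
  by rewrite ler_pdivrMl// mulr1.
rewrite -[complex.Re _]/(normc _) linearZ /= normcM normcr 1?mulrC//.
by rewrite invr_ge0 ltW.
Qed.

(* Pairing each functional with unimodular multiples of the [f i] turns
   [\sum_i `|x' (f i)|] into a single value of [x']. *)
Lemma nuclear_sum_le (X Y : normedModType C) (T : X -> Y) : nuclear T ->
  exists2 D : R, 0 <= D & forall (I : finType) (f : I -> X) (B : R), 0 < B ->
    (forall e : I -> C, (forall i, normc (e i) <= 1) ->
       N (\sum_i e i *: f i) <= B) ->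
    \sum_i N (T (f i)) <= D * B.
Proof.
move=> [x' [y [_ Dlt Tcvg]]].
pose d k := (dual_norm (x' k) * (N (y k))%:E)%E.
have d0 k : (0 <= d k)%E by rewrite mule_ge0 ?dual_norm_ge0// lee_fin N_ge0.
have D0 : (0 <= \sum_(k <oo) d k)%E by exact: nneseries_ge0.
have /fineK DE : (\sum_(k <oo) d k)%E \is a fin_num by rewrite ge0_fin_numE.
exists (fine (\sum_(k <oo) d k)%E); first exact: fine_ge0.
set D := fine _ in DE *; move=> I f B B0 fB.
have term k : ((\sum_i normc (x' k (f i)) * N (y k) / B)%R%:E <= d k)%E.
  (* Phase that makes the value of [x' k] at [f i] nonnegative; it is 0 when that value is 0, as the
     inverse of 0 is 0. *)
  pose e i := ((normc (x' k (f i)))^-1)%:C * (x' k (f i))^*.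
  have eE i : e i * x' k (f i) = (normc (x' k (f i)))%:C.
    rewrite /e -mulrA [_^* * _]mulrC mulcJ -rmorphM /=; congr (_%:C).
    by have [->|n0] := eqVneq (normc (x' k (f i))) 0; [rewrite expr0n mulr0|field].
  have e1 i : normc (e i) <= 1.
    rewrite normcM normcJ normcr ?invr_ge0 ?normc_ge0//.
    by have [->|n0] := eqVneq (normc (x' k (f i))) 0; [rewrite mulr0|rewrite mulVf].
  have := dual_norm_ge (x' k) B0 (fB e e1).
  rewrite linear_sum (eq_bigr (fun i => (normc (x' k (f i)))%:C)); last first.
    by move=> i _; rewrite linearZ /= -eE.
  rewrite (_ : \sum_i _ = (\sum_i normc (x' k (f i)))%:C); last by rewrite rmorph_sum.
  rewrite normc_real ger0_norm ?sumr_ge0// => [|i _]; last exact: normc_ge0.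
  move=> H; apply: le_trans (_ : _ <= (_ * (N (y k))%:E))%E _; last first.
    by apply: (lee_wpmul2r _ H); rewrite lee_fin N_ge0.
  by rewrite -EFinM lee_fin !mulr_suml ler_sum// => i _; rewrite mulrAC.
have partial n : \sum_i N (\sum_(0 <= k < n) x' k (f i) *: y k) <= D * B.
  apply: (@le_trans _ _ (\sum_(0 <= k < n) \sum_i normc (x' k (f i)) * N (y k))).
    rewrite exchange_big /=; apply: ler_sum => i _.
    by apply: le_trans (N_sum _ _ _) _; apply: ler_sum => k _; rewrite N_scale.
  rewrite -ler_pdivrMr// mulr_suml -lee_fin -sumEFin DE.
  apply: le_trans (nneseries_lim_ge n _) => [|k _ _]; last exact: d0.
  by apply: lee_sum => k _; rewrite mulr_suml; exact: term.
apply/ler_addgt0Pr => e e0.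
(* The series converges for each [f i] separately; the error is shared among the finitely many
   [i]. *)
pose e' := e / (#|I|%:R + 1).
have I0 : 0 < #|I|%:R + 1 :> R by rewrite ltr_wpDl.
have e'0 : 0 < e' by rewrite divr_gt0.
have close i : \forall n \near \oo,
    N (T (f i)) <= N (\sum_(0 <= k < n) x' k (f i) *: y k) + e'.
  have /cvgrPdist_le/(_ e'%:C) := Tcvg (f i); rewrite ltcR => /(_ e'0).
  apply: filterS => n; rewrite Nle => h.
  rewrite -[T (f i)](subrK (\sum_(0 <= k < n) x' k (f i) *: y k)) addrC.
  by rewrite (le_trans (N_leD _ _))// lerD2l.
have [n nP] : exists n, forall i, N (T (f i)) <= N (\sum_(0 <= k < n) x' k (f i) *: y k) + e'.
  have : \forall n \near \oo, forall i, true -> 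
      N (T (f i)) <= N (\sum_(0 <= k < n) x' k (f i) *: y k) + e'.
    by apply: filter_forall => i; apply: filterS (close i).
  by move=> [n _ /(_ n (leqnn _))] h; exists n => i; exact: h.
apply: (@le_trans _ _ (\sum_i (N (\sum_(0 <= k < n) x' k (f i) *: y k) + e'))).
  by apply: ler_sum => i _; exact: nP.
rewrite big_split /= lerD// sumr_const -mulr_natr /e' mulrAC ler_pdivrMr//.
by rewrite ler_wpM2l ?(ltW e0)// lerDl.
Qed.

End NuclearSum.

(** * Functions as elements of weighted spaces, and the derivative of the image *)

Section Elements.
Context {R : realType}.
Local Notation C := R[i].

Implicit Types (f h : C -> C) (z : C).

(** Elements of a weighted space vanish off the disk, so a function is cut off before it becomes
    one. *)
Definition ext0 f (z : C) : C := if `[< disk z >] then f z else 0.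

Lemma ext0E f z : disk z -> ext0 f z = f z.
Proof. by rewrite /ext0; case: asboolP. Qed.

Lemma disk_hasd f h z d : disk z -> (forall w, disk w -> f w = h w) ->
  hasd f z d -> hasd h z d.
Proof. by move=> dz; apply: (@hasd_eq_ball _ _ _ _ _ 1). Qed.

Lemma eq_analytic f h : (forall w, disk w -> f w = h w) -> analytic f -> analytic h.
Proof.
move=> fh fa; apply: (@hasd_analytic _ _ (derive1 f)) => z dz.
exact: disk_hasd dz fh (analytic_hasd fa dz).
Qed.

Lemma eq_derive1 f h z : disk z -> (forall w, disk w -> f w = h w) -> analytic f ->
  derive1 h z = derive1 f z.
Proof.
by move=> dz fh fa; exact: hasd_derive1 (disk_hasd dz fh (analytic_hasd fa dz)).
Qed.

Lemma eq_in_H0 (w : C -> R) f h : (forall z, disk z -> f z = h z) -> in_H0 w f -> in_H0 w h.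
Proof.
move=> fh [fa f0]; split; first exact: eq_analytic fh fa.
move=> e /f0[r r1 rP]; exists r => // z rz dz; rewrite -fh//; exact: rP.
Qed.

Lemma eq_in_Hinf (w : C -> R) f h : (forall z, disk z -> f z = h z) -> in_Hinf w f -> in_Hinf w h.
Proof.
move=> fh [fa [M f0]]; split; first exact: eq_analytic fh fa.
exists M => _ [z dz <-]; rewrite -fh//; apply: f0; by exists z.
Qed.

Lemma elements_ext (E : weighted_space R) (f : C -> C) : space_mem E (ext0 f) ->
  exists e : elements E, forall z, disk z -> e z = f z.
Proof.
move=> Ef; have H : ext0 f \in space_pred E.
  by rewrite inE; split=> // z dz; rewrite /ext0; case: asboolP.
by exists (Elements H) => z dz /=; rewrite ext0E.
Qed.

Lemma rnorm_elements (E : weighted_space R) (f : elements E) :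
  rnorm f = weighted_norm (space_weight E) f.
Proof. by []. Qed.

Lemma elements_le (E : weighted_space R) (f : elements E) z : disk z ->
  space_weight E z * normc (f z) <= rnorm f.
Proof.
move=> dz; rewrite rnorm_elements; apply: ub_le_sup.
  exact: (space_bounded (elements_mem f)).
by exists z.
Qed.

Lemma elements_norm_le (E : weighted_space R) (f : elements E) (B : R) :
  (forall z, disk z -> space_weight E z * normc (f z) <= B) -> rnorm f <= B.
Proof. by move=> fB; rewrite rnorm_elements; exact: weighted_norm_le. Qed.

Lemma elements_sum (E : weighted_space R) (I : Type) (r : seq I) (P : pred I)
    (F : I -> elements E) z :
  (\sum_(i <- r | P i) F i) z = \sum_(i <- r | P i) F i z.
Proof. by elim/big_rec2: _ => [|i a b _ <-]. Qed.

End Elements.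

Section DerivativeOfImage.
Context {R : realType}.
Local Notation C := R[i].
Variables (g phi : C -> C).
Hypotheses (g_analytic : analytic g) (phi_self : self_map phi).

Lemma comp_analytic f : analytic f -> analytic (fun z => f (phi z) * g z).
Proof.
move=> fa; have [pa pd] := phi_self.
apply: (@hasd_analytic _ _ (fun z => f (phi z) * derive1 g z +
    g z * (derive1 f (phi z) * derive1 phi z))) => z dz.
apply: (@hasdM _ (fun z => f (phi z)) g) (analytic_hasd g_analytic dz).
exact: hasd_comp (analytic_hasd pa dz) (analytic_hasd fa (pd _ dz)).
Qed.

Lemma S_op_hasd f z : analytic f -> disk z ->
  hasd (S_op g phi f) z (derive1 f (phi z) * g z).
Proof.
move=> fa dz; have ha := comp_analytic (analytic_derive fa).
exact: (@segment_integral_hasd R _ z ha dz).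
Qed.

Lemma S_op_analytic f : analytic f -> analytic (S_op g phi f).
Proof. by move=> fa; apply: hasd_analytic => z dz; exact: S_op_hasd. Qed.

Lemma S_op_derive1 f z : analytic f -> disk z ->
  derive1 (S_op g phi f) z = derive1 f (phi z) * g z.
Proof. by move=> fa dz; exact: hasd_derive1 (S_op_hasd fa dz). Qed.

Lemma S_op0 f : analytic f -> S_op g phi f 0 = 0.
Proof.
move=> fa; apply: (@segment_integral0 _ (fun z => derive1 f (phi z) * g z)).
exact/comp_analytic/analytic_derive.
Qed.

End DerivativeOfImage.

(** * Test functions at the dyadic points and their weighted sums *)

Section TestFunctions.
Context {R : realType}.
Local Notation C := R[i].
Variables (nu : weight R) (beta : R) (N : nat).
Hypotheses (nu_I : normal_exp_I nu beta) (nu_II : exists gamma, normal_exp_II nu gamma).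
Hypothesis beta_lt : beta < N.+1%:R.

Implicit Types a z : C.

(** Exponent [N + 2], so that the derivative carries the exponent [N + 3] of [ksup]. *)
Definition test_fun a z : C := (1 - a^* * z)^-1 ^+ N.+2.

Lemma test_fun_neq0 a z : disk a -> disk z -> 1 - a^* * z != 0.
Proof. by move=> da dz; rewrite kernel_neq0 ?normcJ// ltW. Qed.

Lemma test_fun_hasd a z : disk a -> disk z ->
  hasd (test_fun a) z (N.+2%:R * a^* * (1 - a^* * z)^-1 ^+ N.+3).
Proof.
move=> da dz; have n0 := test_fun_neq0 da dz.
have H : hasd (fun w => 1 - a^* * w) z (0 - a^* * 1).
  by apply: hasdB; [exact: hasd_cst|apply: hasdZ; exact: hasd_id].
have := hasdX N.+2 (hasdV H n0); congr (hasd _ _ _).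
by rewrite /= !exprS; field.
Qed.

Lemma test_fun_analytic a : disk a -> analytic (test_fun a).
Proof. by move=> da; apply: hasd_analytic => z dz; exact: test_fun_hasd. Qed.

Lemma test_fun_le a z : disk a -> disk z ->
  normc (test_fun a z) <= ((1 - normc a)^-1) ^+ N.+2.
Proof.
move=> da dz; rewrite normcX lerXn2r ?nnegrE ?normc_ge0 ?invr_ge0 ?subr_ge0 ?(ltW da)//.
rewrite normcV lef_pV2 ?posrE ?subr_gt0 ?normc_gt0 ?test_fun_neq0//.
by rewrite -[normc a]normcJ kernel_norm ?normcJ// ltW.
Qed.

Lemma test_fun_H0 a : disk a -> in_H0 nu (test_fun a).
Proof.
move=> da; split; first exact: test_fun_analytic.
move=> e e0; pose b := ((1 - normc a)^-1) ^+ N.+2.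
have b0 : 0 < b by rewrite exprn_gt0// invr_gt0 subr_gt0.
have [r r1 rP] := weight_to0 nu_II (divr_gt0 e0 b0); exists r => // z rz dz.
apply: (@le_lt_trans _ _ (nu z * b)).
  by rewrite ler_wpM2l ?test_fun_le// ltW ?weight_gt0.
by rewrite -ltr_pdivlMr// rP.
Qed.

Lemma rou_conj m k : (rou m ^+ k : C)^* = (rou m ^+ k)^-1.
Proof.
have n0 : rou m ^+ k != 0 :> C by rewrite -normc_gt0 normc_rou.
by apply: (mulfI n0); rewrite mulcJ normc_rou expr1n divff.
Qed.

Lemma dpt_conj m k : (dpt m k : C)^* = (rad m)%:C * (rou m ^+ k)^-1.
Proof. by rewrite -rou_conj /dpt [LHS]rmorphM; congr (_ * _); exact: conjc_real. Qed.

(** All but two of the [N + 2] factors are bounded by [d^-1]; the remaining square is summed over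
    the circle by [sum_kernel_sqr]. The free [d] permits different choices on coarse and fine
    levels. *)
Lemma sum_test_fun_le m z (d : R) : disk z -> 0 < d -> eps m <= d ->
  d <= 1 - rad m * normc z ->
  kw nu (N%:R + 3) m * \sum_(k < 2 ^ m) normc (test_fun (dpt m k) z) <=
  3 * (eps m / d) ^+ N.+1 / num nu m.
Proof.
move=> dz d0 ed dle; have e0 := @eps_gt0 R m; pose x := (rad m)%:C * z.
have nx : normc x = rad m * normc z by rewrite normcM normcr ?rad_ge0.
have xm : normc x <= rad m by rewrite nx ler_piMr ?rad_ge0// ltW.
have x1 : normc x < 1 by exact: le_lt_trans xm (rad_lt1 _).
have kwE : kw nu (N%:R + 3) m = eps m ^+ N.+2 / num nu m.
  rewrite /kw; congr (_ / _); rewrite -powR_mulrn ?(ltW e0)//; congr (_ `^ _).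
  by rewrite -[N.+2]addn2 natrD; ring.
have term k : normc (test_fun (dpt m k) z) <=
    d^-1 ^+ N * (normc (1 - x * (rou m ^+ k)^-1) ^+ 2)^-1.
  have -> : test_fun (dpt m k) z = (1 - x * (rou m ^+ k)^-1)^-1 ^+ N.+2.
    by rewrite /test_fun dpt_conj /x; congr (_^-1 ^+ _); ring.
  rewrite normcX normcV -addn2 exprD exprVn [in X in _ * X]exprVn; apply: ler_wpM2r.
    by rewrite invr_ge0 exprn_ge0 ?normc_ge0.
  rewrite -exprVn lerXn2r ?nnegrE ?invr_ge0 ?normc_ge0 ?(ltW d0)//.
  have v1 : normc (rou m ^+ k)^-1 <= 1 :> R by rewrite normcV normc_rou invr1.
  rewrite lef_pV2 ?posrE ?normc_gt0 ?kernel_neq0//.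
  by apply: le_trans (kernel_norm x1 v1); rewrite nx.
have S1 : \sum_(k < 2 ^ m) normc (test_fun (dpt m k) z) <=
    d^-1 ^+ N * (3 * 2 ^+ m / d).
  apply: (@le_trans _ _ (\sum_(k < 2 ^ m)
      d^-1 ^+ N * (normc (1 - x * (rou m ^+ k)^-1) ^+ 2)^-1)).
    by apply: ler_sum => k _; exact: term.
  rewrite -mulr_sumr; apply: ler_wpM2l; first by rewrite exprn_ge0 ?invr_ge0 ?ltW.
  apply: le_trans (sum_kernel_sqr xm) _; apply: ler_wpM2l; first by rewrite mulr_ge0 ?exprn_ge0.
  by rewrite lef_pV2 ?posrE ?subr_gt0// nx.
apply: le_trans (ler_wpM2l (kw_ge0 _ _ _) S1) _; rewrite kwE.
rewrite le_eqVlt; apply/orP; left; apply/eqP.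
have n0 : num nu m != 0 by rewrite gt_eqF// num_gt0.
have ep : eps m * 2 ^+ m = 1 :> R by rewrite epsE mulVf// expf_neq0.
rewrite expr_div_n [eps m ^+ N.+2]exprSr [d ^+ N.+1]exprSr exprVn.
apply: etrans (_ : _ = eps m * 2 ^+ m *
    (3 * (eps m ^+ N.+1 / (d ^+ N * d)) / num nu m)) _; last by rewrite ep mul1r.
have dN0 : d ^+ N != 0 by rewrite expf_neq0// gt_eqF.
move: dN0 (eps m ^+ N.+1) (2 ^+ m) => dN0 eN p; set dN := d ^+ N in dN0 *.
by field; rewrite n0 dN0 gt_eqF.
Qed.

(** Levels are split at the annulus [n] of [z]. Coarse ones take [d = eps m] and sum by (II); fine
    ones take [d = eps n.+1] and sum by (I), as [beta < N + 1]. *)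
Lemma test_sum : exists2 K : R, 0 < K & forall M z, disk z ->
  nu z * (\sum_(m < M) kw nu (N%:R + 3) m *
    \sum_(k < 2 ^ m) normc (test_fun (dpt m k) z)) <= K.
Proof.
have [c1 c10 P1] := sum_num_II nu_II.
have [c2 c20 P2] := sum_num_I nu_I beta_lt.
have [c3 c30 P3] := numS (ex_intro _ beta nu_I).
exists (3 * c1 + 3 * c2 * c3); first by rewrite addr_gt0 ?mulr_gt0.
move=> M z dz; have [n /andP[n1 n2]] := rad_itv (normc_ge0 z) dz.
pose a m := kw nu (N%:R + 3) m * \sum_(k < 2 ^ m) normc (test_fun (dpt m k) z).
have a0 m : 0 <= a m.
  by apply: mulr_ge0 (kw_ge0 _ _ _) _; apply: sumr_ge0 => k _; exact: normc_ge0.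
have rz m : 1 - rad m * normc z >= eps m.
  rewrite -[eps m]onem_rad lerD2l lerN2 ler_piMr ?rad_ge0//; exact: ltW.
have rz' m : 1 - rad m * normc z >= eps n.+1.
  rewrite -[eps n.+1]onem_rad lerD2l lerN2; apply: le_trans n2.
  by rewrite ler_piMl ?normc_ge0// ltW ?rad_lt1.
have a1 m : a m <= 3 * (num nu m)^-1.
  have := sum_test_fun_le dz (eps_gt0 m) (lexx _) (rz m).
  by rewrite divff ?gt_eqF ?eps_gt0// expr1n mulr1.
have a2 i : a (n.+1 + i)%N <=
    3 / eps n.+1 ^+ N.+1 * (eps (n.+1 + i) `^ N.+1%:R / num nu (n.+1 + i)).
  have := sum_test_fun_le dz (eps_gt0 n.+1) (eps_le (leq_addr i _)) (rz' _).
  move/le_trans; apply; rewrite powR_mulrn ?(ltW (eps_gt0 _))// expr_div_n.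
  by rewrite le_eqVlt; apply/orP; left; apply/eqP; ring.
have S1 : \sum_(m < n.+1) a m <= 3 * (c1 / num nu n).
  apply: (@le_trans _ _ (\sum_(m < n.+1) 3 * (num nu m)^-1)).
    by apply: ler_sum => m _; exact: a1.
  by rewrite -mulr_sumr ler_pM2l.
have S2 : \sum_(i < M) a (n.+1 + i)%N <= 3 * c2 / num nu n.+1.
  have p0 : 0 < eps n.+1 ^+ N.+1 :> R by rewrite exprn_gt0 ?eps_gt0.
  apply: (@le_trans _ _ (\sum_(i < M) 3 / eps n.+1 ^+ N.+1 *
      (eps (n.+1 + i) `^ N.+1%:R / num nu (n.+1 + i)))).
    by apply: ler_sum => i _; exact: a2.
  rewrite -mulr_sumr; apply: le_trans (ler_wpM2l _ (P2 n.+1 M)) _.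
    by rewrite divr_ge0// ltW.
  rewrite powR_mulrn ?(ltW (eps_gt0 _))// le_eqVlt; apply/orP; left; apply/eqP.
  by field; rewrite !gt_eqF ?num_gt0.
have nz := weight_gt0 nu dz.
apply: (@le_trans _ _ (nu z * (3 * (c1 / num nu n) + 3 * c2 / num nu n.+1))).
  rewrite ler_pM2l//; apply: le_trans (lerD S1 S2).
  have <- : \sum_(m < n.+1 + M) a m = \sum_(m < n.+1) a m + \sum_(i < M) a (n.+1 + i)%N.
    by rewrite big_split_ord.
  rewrite addnC big_split_ord /=.
  by rewrite lerDl sumr_ge0.
rewrite mulrDr; apply: lerD.
  have h : nu z <= num nu n by exact: weight_le_num.
  rewrite [leLHS](_ : _ = 3 * c1 * (nu z / num nu n)); last by ring.
  by rewrite ler_piMr ?mulr_ge0 ?(ltW c10)// ler_pdivrMr ?num_gt0// mul1r.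
have h : nu z <= c3 * num nu n.+1.
  by apply: le_trans (P3 n); exact: weight_le_num.
rewrite [leLHS](_ : _ = 3 * c2 * (nu z / num nu n.+1)); last by ring.
apply: ler_wpM2l; first by rewrite mulr_ge0 ?(ltW c20).
by rewrite ler_pdivrMr ?num_gt0.
Qed.

End TestFunctions.

Lemma sum_sigma (V : nmodType) (I : finType) (n : I -> nat) (F : I -> nat -> V) :
  \sum_i \sum_(k < n i) F i k = \sum_(p : {i : I & 'I_(n i)}) F (tag p) (tagged p).
Proof. exact: (sig_big_dep xpredT (fun=> xpredT) (fun i k => F i (k : 'I_(n i)))). Qed.

Section Necessity.
Context {R : realType}.
Local Notation C := R[i].
Variables (nu mu : weight R) (g phi : C -> C) (beta A : R) (N : nat).
Hypotheses (nu_I : normal_exp_I nu beta) (nu_II : exists gamma, normal_exp_II nu gamma).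
Hypotheses (mu_I : exists beta, normal_exp_I mu beta) (beta_lt : beta < N.+1%:R).
Hypotheses (g_analytic : analytic g) (phi_self : self_map phi).

Let c (z : C) : R := (1 - normc z ^+ 2) * mu z * normc (g z).
Hypothesis c_le : forall z, disk z -> c z <= A.

Let c_ge0 z : disk z -> 0 <= c z.
Proof.
move=> dz; rewrite /c mulr_ge0 ?normc_ge0// mulr_ge0//.
  exact/ltW/onem_sqr_gt0.
exact/ltW/weight_gt0.
Qed.

Lemma ksummable_of_nuclear : nuclear_between (S_op g phi) (H0 nu) (Hinf mu) ->
  ksummable c phi nu (N%:R + 3).
Proof.
move=> [T TS Tnuc]; have [_ phid] := phi_self.
have [c1 c10 P1] := derive1_weighted_le mu_I.
have [D D0 DP] := nuclear_sum_le Tnuc.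
have [K K0 KP] := test_sum nu_I nu_II beta_lt.
pose s : R := N%:R + 3.
have s0 : 0 <= s by rewrite /s addr_ge0.
have [f fP] : exists f : nat -> nat -> elements (H0 nu), forall m k z, disk z ->
    f m k z = (kw nu s m)%:C * test_fun N (dpt m k) z.
  have : forall mk : nat * nat, exists e : elements (H0 nu), forall z, disk z ->
      e z = (kw nu s mk.1)%:C * test_fun N (dpt mk.1 mk.2) z.
    move=> [m k] /=; apply: elements_ext.
    have := in_H0P (kw nu s m)%:C (test_fun_H0 N nu_II (disk_dpt m k)) (in_H00 nu).
    by apply: eq_in_H0 => z dz; rewrite ext0E// addr0.
  by move=> /choice[f fP]; exists (fun m k => f (m, k)) => m k z; exact: (fP (m, k)).
have B0 := ksup_ge0 c_ge0 c_le phid s0 (disk_dpt 0 0).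
set k0 := kw nu s 0 * ksup c phi s (dpt 0 0).
(* At level 0 the point is 0 and the test function constant, so this term is kept apart; from level
   1 on [rad m] is at least 1/2, which controls the factor that differentiation brings out. *)
have one m k : kw nu s m * ksup c phi s (dpt m k) <=
    (if m == 0%N then kw nu s 0 * ksup c phi s (dpt 0 k) else 0) +
    2 * c1 * rnorm (T (f m k)).
  have rn0 : 0 <= 2 * c1 * rnorm (T (f m k)).
    by rewrite mulr_ge0 ?N_ge0// mulr_ge0// ltW.
  case: m rn0 => [|m] rn0 /=; first by rewrite lerDl.
  rewrite add0r; have [->|kw0] := eqVneq (kw nu s m.+1) 0; first by rewrite mul0r.
  have kwp : 0 < kw nu s m.+1 by rewrite lt_neqAle eq_sym kw0 kw_ge0.
  rewrite mulrC -ler_pdivlMr//; apply: ksup_le => z dz.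
  have dd := disk_dpt m.+1 k : disk (dpt m.+1 k : C).
  have fa : analytic (f m.+1 k) by have := elements_mem (f m.+1 k) => -[].
  have d1 : derive1 (f m.+1 k) (phi z) = (kw nu s m.+1)%:C *
      (N.+2%:R * (dpt m.+1 k)^* * (1 - (dpt m.+1 k)^* * phi z)^-1 ^+ N.+3).
    apply: hasd_derive1; apply: (@disk_hasd _ (fun z => (kw nu s m.+1)%:C *
      test_fun N (dpt m.+1 k) z)); [exact: phid|by move=> w dw; rewrite fP|].
    by apply: hasdZ; apply: test_fun_hasd => //; exact: phid.
  have [Ta _] := elements_mem (T (f m.+1 k)).
  have := P1 _ (rnorm (T (f m.+1 k))) Ta (fun w dw => elements_le (T (f m.+1 k)) dw) z dz.
  have Sa := S_op_analytic g_analytic phi_self fa.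
  rewrite (eq_derive1 dz _ Sa) => [|w dw]; last by rewrite TS.
  have nd : normc (derive1 (f m.+1 k) (phi z)) =
      kw nu s m.+1 * (N.+2%:R * rad m.+1 / kd phi (dpt m.+1 k) z ^+ N.+3).
    rewrite d1 normcM normcr ?kw_ge0//; congr (_ * _); rewrite normcM; congr (_ * _).
      by rewrite normcM normc_nat normcJ normc_dpt.
    by rewrite normcX normcV exprVn.
  rewrite S_op_derive1// normcM nd => H.
  have kd0 : 0 < kd phi (dpt m.+1 k) z by exact: kd_gt0.
  have pE : kd phi (dpt m.+1 k) z `^ s = kd phi (dpt m.+1 k) z ^+ N.+3.
    rewrite -powR_mulrn ?(ltW kd0)//; congr (_ `^ _).
    by rewrite /s -[N.+3]addn3 natrD.
  rewrite ler_pdivrMr ?powR_gt0// pE mulrAC ler_pdivlMr//.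
  have Q0 := exprn_gt0 N.+3 kd0; set Q := _ ^+ N.+3 in H Q0 *; clearbody Q.
  rewrite -ler_pdivrMr//; set X := (X in X <= _).
  have X0 : 0 <= X by apply: divr_ge0 (ltW Q0); exact: mulr_ge0 (c_ge0 dz) (ltW kwp).
  have XE : (N.+2%:R * rad m.+1) * X <= c1 * rnorm (T (f m.+1 k)).
    by apply: le_trans H; rewrite le_eqVlt; apply/orP; left; apply/eqP; rewrite /X /c; ring.
  have h : 2^-1 <= N.+2%:R * rad m.+1 :> R.
    apply: (@le_trans _ _ (rad m.+1)); last by rewrite ler_peMl ?rad_ge0// ler1n.
    by have := @rad_le R 1 m.+1 isT; rewrite /rad /eps expr1; lra.
  by move: (ler_wpM2r X0 h) XE; lra.
have nux z : disk z -> 0 <= nu z by move=> dz; exact/ltW/weight_gt0.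
have sumT M : \sum_(m < M) \sum_(k < 2 ^ m) rnorm (T (f m k)) <= D * K.
  rewrite (sum_sigma (fun m : 'I_M => (2 ^ m)%N) (fun m k => rnorm (T (f m k)))) /=.
  apply: (DP {m : 'I_M & 'I_(2 ^ m)} (fun p => f (tag p) (tagged p))) => // e e1.
  apply: elements_norm_le => z dz; apply: le_trans (KP M z dz).
  apply: (ler_wpM2l (nux z dz)); rewrite elements_sum.
  under [X in _ <= X]eq_bigr do rewrite mulr_sumr.
  rewrite (sum_sigma (fun m : 'I_M => (2 ^ m)%N) (fun m k => kw nu s m * normc (test_fun N (dpt m k) z))) /=.
  apply: le_trans (normc_sum _ _ _) _; apply: ler_sum => p _.
  rewrite [X in normc X](_ : _ = e p * f (tag p) (tagged p) z)//.
  rewrite fP// normcM [normc (_%:C * _)]normcM [normc _%:C]normcr ?kw_ge0//.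
  rewrite ler_piMl//; apply: mulr_ge0 (normc_ge0 _); exact: kw_ge0.
exists (k0 + 2 * c1 * (D * K)) => M.
apply: le_trans (_ : _ <= \sum_(m < M) \sum_(k < 2 ^ m)
    ((if m == 0 :> nat then kw nu s 0 * ksup c phi s (dpt 0 k) else 0) +
    2 * c1 * rnorm (T (f m k)))) _.
  rewrite /ksum; apply: ler_sum => m _; rewrite mulr_sumr; apply: ler_sum => k _.
  exact: one.
under eq_bigr do rewrite big_split /=.
rewrite big_split /=; apply: lerD; last first.
  under eq_bigr do rewrite -mulr_sumr.
  by rewrite -mulr_sumr; apply: ler_wpM2l (sumT M); rewrite mulr_ge0// ltW.
have k00 : 0 <= k0 by apply: mulr_ge0 (kw_ge0 _ _ _) B0.
case: M => [|M]; first by rewrite big_ord0.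
rewrite big_ord_recl /= big_ord1 [X in _ + X]big1 ?addr0// => m _.
by rewrite big1.
Qed.

End Necessity.

(** * Richardson extrapolation of the Cauchy kernel *)

Section Richardson.
Context {R : realType}.
Local Notation C := R[i].
Implicit Types (s t : nat -> C) (x : C).

(* Richardson extrapolation of a sequence whose error has an expansion in
   powers of [2^-j]. *)
Fixpoint rich L s j : C :=
  if L is L'.+1
  then (2%:R ^+ L * rich L' s j.+1 - rich L' s j) / (2%:R ^+ L - 1)
  else s j.

Let den_neq0 L : (2%:R ^+ L.+1 - 1 : C) != 0.
Proof.
rewrite subr_eq0; apply/eqP => /(congr1 (@normc R)); rewrite normc1 normcX normc_nat.
by move/eqP; rewrite gt_eqF// exprn_egt1// ltr1n.
Qed.

Let denE L : 2%:R ^+ L.+1 - 1 = (2 ^+ L.+1 - 1)%:C :> C.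
Proof. by rewrite rmorphB rmorphXn /= rmorph_nat. Qed.

Let normc_den L : normc (2%:R ^+ L.+1 - 1 : C) = 2 ^+ L.+1 - 1.
Proof.
by rewrite denE normcr// subr_ge0 exprn_ege1// ler1n.
Qed.

Lemma richB L s t j : rich L (fun i => s i - t i) j = rich L s j - rich L t j.
Proof. by elim: L j => [//|L IHL] j /=; rewrite !IHL -mulrBl; congr (_ / _); ring. Qed.

Lemma richZ L a s j : rich L (fun i => a * s i) j = a * rich L s j.
Proof. by elim: L j => [//|L IHL] j /=; rewrite !IHL; ring. Qed.

Lemma rich_davg L m (s : nat -> C -> C) j :
  rich L (fun i => davg m (s i)) j = davg m (fun v => rich L (s ^~ v) j).
Proof.
elim: L j => [//|L IHL] j /=; rewrite !IHL -davgZ -davgB [LHS]mulrC -davgZ.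
by apply: eq_davg => k; rewrite mulrC.
Qed.

Lemma rich_cvs L (s : nat -> nat -> C) t j :
  (forall i, (j <= i <= j + L)%N -> cvs (s ^~ i) (t i)) ->
  cvs (fun l => rich L (s l) j) (rich L t j).
Proof.
elim: L j => [|L IHL] j st /=; first by apply: st; rewrite leqnn leq_addr.
rewrite mulrC; apply: (@cvs_ext _ (fun l => (2%:R ^+ L.+1 - 1)^-1 *
   (2%:R ^+ L.+1 * rich L (s l) j.+1 - rich L (s l) j))); first by move=> l; rewrite mulrC.
apply/cvsZ/cvsB; first apply: cvsZ.
  by apply: IHL => i /andP[h1 h2]; apply: st; rewrite (ltnW h1) addnS -addSn.
by apply: IHL => i /andP[h1 h2]; apply: st; rewrite h1 (leq_trans h2)// leq_add2l.
Qed.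

(** The weights of an extrapolation step add up to 1. *)
Lemma rich_lim L s l : cvs s l -> cvs (rich L s) l.
Proof.
move=> sl; elim: L => [//|L IHL] /=.
have -> : l = (2%:R ^+ L.+1 - 1)^-1 * (2%:R ^+ L.+1 * l - l).
  rewrite (_ : 2%:R ^+ L.+1 * l - l = (2%:R ^+ L.+1 - 1) * l); last by rewrite mulrBl mul1r.
  by rewrite mulKf// den_neq0.
apply: (@cvs_ext _ (fun j => (2%:R ^+ L.+1 - 1)^-1 *
   (2%:R ^+ L.+1 * rich L s j.+1 - rich L s j))); first by move=> j; rewrite mulrC.
by apply/cvsZ/cvsB => //; apply: cvsZ; apply: (@cvs_ext _ (fun n => rich L s (1 + n)%N)) => //; exact: cvs_shift.
Qed.

(** The step of index [L >= 1] has norm (2^L + 1) / (2^L - 1), at most 3. *)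
Lemma rich_le L s j (B : R) : (forall i, (j <= i <= j + L)%N -> normc (s i) <= B) ->
  normc (rich L s j) <= 3 ^+ L * B.
Proof.
elim: L j => [|L IHL] j sB /=.
  by rewrite expr0 mul1r; apply: sB; rewrite leqnn leq_addr.
have p1 : 2 <= 2 ^+ L.+1 :> R by rewrite exprS ler_peMr// exprn_ege1// ler1n.
rewrite normcM normcV normc_den ler_pdivrMr; last by move: p1; lra.
have h1 : normc (rich L s j.+1) <= 3 ^+ L * B.
  by apply: IHL => i /andP[h1 h2]; apply: sB; rewrite (ltnW h1) addnS -addSn.
have h2 : normc (rich L s j) <= 3 ^+ L * B.
  by apply: IHL => i /andP[h1' h2]; apply: sB; rewrite h1' (leq_trans h2)// leq_add2l.
have B0 := le_trans (normc_ge0 _) h2.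
apply: le_trans (normcB_le _ _) _; rewrite normcM normcX normc_nat.
move: (2 ^+ L.+1) p1 => p p1; rewrite exprS -[3 * _ * B]mulrA.
move: (3 ^+ L * B) h1 h2 B0 => Q h1 h2 Q0.
have p0 : 0 <= p := le_trans (ler0n _ 2) p1.
have := ler_wpM2l p0 h1; have := ler_wpM2r Q0 p1; move: p1 h2.
by rewrite mulrBr mulr1; lra.
Qed.

Fixpoint rich_cst L : R :=
  if L is L'.+1 then rich_cst L' * (1 - 2^-1 ^+ L.+1) / (2 ^+ L - 1) else 2^-1.

Lemma rich_cst_le L : 0 <= rich_cst L <= 1.
Proof.
elim: L => [|L /andP[c0 c1]] /=; first by lra.
have p1 : 2 <= 2 ^+ L.+1 :> R by rewrite exprS ler_peMr// exprn_ege1// ler1n.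
have h1 : 0 <= (2^-1 : R) ^+ L.+2 <= 1 by rewrite exprn_ge0 ?exprn_ile1 ?invr_ge0// invf_le1 ?ler1n.
have d0 : 0 < 2 ^+ L.+1 - 1 :> R by move: p1; lra.
rewrite divr_ge0 ?mulr_ge0 ?(ltW d0)//=; last by move: h1; lra.
rewrite ler_pdivrMr// mul1r; apply: (@le_trans _ _ 1); last by move: p1; lra.
by rewrite mulr_ile1//; move: h1; lra.
Qed.

(** In the inductive step the two products share all but their end factors, and [2 ^+ L.+1]
    equalizes the coefficients; the difference of the inverse end factors is
    [(rad (j + L.+2) - rad j) * x], which supplies one more power of [eps j] and of [x]. *)
Lemma rich_kernel L x j : (forall i, (j <= i <= j + L.+1)%N -> 1 - (rad i)%:C * x != 0) ->
  let w i := (1 - (rad i)%:C * x)^-1 in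
  rich L w j.+1 - rich L w j =
  (rich_cst L * eps j ^+ L.+1)%:C * x ^+ L.+1 * \prod_(i < L.+2) w (j + i)%N.
Proof.
move=> h w; elim: L j h => [|L IHL] j h /=.
  rewrite big_ord_recl big_ord1 /= addn0 addn1 !expr1 /w.
  have n0 := h j; have n1 := h j.+1.
  rewrite (_ : (2^-1 * eps j)%:C = (rad j.+1)%:C - (rad j)%:C); last first.
    by rewrite -rmorphB radS_sub (epsS j); congr (_%:C); field.
  by field; rewrite n0 ?n1 ?addn1 ?leqnn ?leqnSn.
have H1 := IHL j.+1; have H2 := IHL j.
rewrite -mulrBl.
have -> : 2%:R ^+ L.+1 * rich L w j.+2 - rich L w j.+1 -
   (2%:R ^+ L.+1 * rich L w j.+1 - rich L w j) =
   2%:R ^+ L.+1 * (rich L w j.+2 - rich L w j.+1) - (rich L w j.+1 - rich L w j) :> C by ring.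
rewrite H1 ?H2; last 2 first.
- by move=> i /andP[h1 h2]; apply: h; rewrite h1 (leq_trans h2)// leq_add2l.
- by move=> i /andP[h1 h2]; apply: h; rewrite (ltnW h1) addnS -addSn.
have E0 : \prod_(i < L.+3) w (j + i)%N = w j * \prod_(i < L.+2) w (j.+1 + i)%N.
  rewrite big_ord_recl addn0; congr (_ * _); apply: eq_bigr => i _.
  by rewrite lift0 addnS addSn.
have E1 : \prod_(i < L.+3) w (j + i)%N = \prod_(i < L.+2) w (j + i)%N * w (j + L.+2)%N.
  by rewrite big_ord_recr.
have wj : w j != 0 by rewrite invr_eq0 h// leqnn leq_addr.
have wl : w (j + L.+2)%N != 0 by rewrite invr_eq0 h// leqnn leq_addr.
have -> : \prod_(i < L.+2) w (j.+1 + i)%N = (w j)^-1 * \prod_(i < L.+3) w (j + i)%N.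
  by rewrite E0 mulKf.
have -> : \prod_(i < L.+2) w (j + i)%N = (w (j + L.+2)%N)^-1 * \prod_(i < L.+3) w (j + i)%N.
  by rewrite E1 mulrC mulfK.
rewrite /w !invrK; move: (\prod_(i < L.+3) _) => P.
have e1 : eps j = 2 * eps j.+1 :> R by rewrite epsS.
have r1 : rad (j + L.+2) - rad j = eps j * (1 - 2^-1 ^+ L.+2) :> R.
  by rewrite /rad /eps exprD; ring.
have A1 : 2%:R ^+ L.+1 * (rich_cst L * eps j.+1 ^+ L.+1)%:C =
    (rich_cst L * eps j ^+ L.+1)%:C :> C.
  rewrite -(rmorph_nat (real_complex R)) -rmorphXn -rmorphM e1 exprMn /=.
  by congr (_%:C); ring.
have A2 : (rich_cst L * (1 - 2^-1 ^+ L.+2) / (2 ^+ L.+1 - 1) * eps j ^+ L.+2)%:C =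
    (rich_cst L * eps j ^+ L.+1)%:C * ((rad (j + L.+2))%:C - (rad j)%:C) /
    (2%:R ^+ L.+1 - 1) :> C.
  rewrite -rmorphB denE -fmorphV -!rmorphM; congr (_%:C); rewrite /= r1.
  by rewrite [eps j ^+ L.+2]exprSr; ring.
rewrite [2%:R ^+ L.+1 * _]mulrA [2%:R ^+ L.+1 * (_ * _)]mulrA A1 A2 [x ^+ L.+2]exprSr.
by ring.
Qed.

End Richardson.

Section ProductBounds.
Context {R : realType}.
Local Notation C := R[i].

Lemma prod_le m (a : nat -> C) (P : R) : (forall i, (i < m)%N -> normc (a i) <= P) ->
  normc (\prod_(i < m) a i) <= P ^+ m.
Proof.
elim: m => [|m IHm] aP; first by rewrite big_ord0 normc1 expr0.
rewrite big_ord_recr /= normcM exprSr ler_pM ?normc_ge0 ?aP//.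
by apply: IHm => i im; apply: aP; rewrite ltnW.
Qed.

Lemma prod_dist m (a b : nat -> C) (P e : R) : 0 <= P -> 0 <= e ->
  (forall i, (i < m)%N ->
     [/\ normc (a i) <= P, normc (b i) <= P & normc (a i - b i) <= e * P]) ->
  normc (\prod_(i < m) a i - \prod_(i < m) b i) <= m%:R * e * P ^+ m.
Proof.
move=> P0 e0; elim: m => [|m IHm] ab.
  by rewrite !big_ord0 subrr normc0 !mul0r.
have [am bm abm] := ab m (leqnn _).
rewrite !big_ord_recr /=.
have -> : (\prod_(i < m) a i) * a m - (\prod_(i < m) b i) * b m =
    (\prod_(i < m) a i) * (a m - b m) + (\prod_(i < m) a i - \prod_(i < m) b i) * b m :> C.
  by ring.
apply: le_trans (normc_leD _ _) _; rewrite !normcM.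
have ab' i : (i < m)%N -> [/\ normc (a i) <= P, normc (b i) <= P & normc (a i - b i) <= e * P].
  by move=> im; apply: ab; rewrite ltnW.
have h1 := IHm ab'; have h2 : normc (\prod_(i < m) a i) <= P ^+ m.
  by apply: prod_le => i /ab'[].
rewrite (_ : m.+1%:R * e * P ^+ m.+1 = P ^+ m * (e * P) + m%:R * e * P ^+ m * P); last first.
  by rewrite exprSr -natr1; ring.
by apply: lerD; rewrite ler_pM ?normc_ge0.
Qed.

End ProductBounds.

(** * Extrapolated Cauchy kernels sampled on circles *)

Section Kernels.
Context {R : realType}.
Local Notation C := R[i].
Variable L : nat.
Implicit Types (u v x zeta : C).

Definition kfac x i : C := (1 - (rad i)%:C * x)^-1.

(** Terms of a telescoping series: the first [M + 1] of them add up to the extrapolation at index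
    [M]. *)
Definition ker n x : C :=
  if n is j.+1 then rich L (kfac x) j.+1 - rich L (kfac x) j else rich L (kfac x) 0.

(** The sampling circle lies outside every radius [rad i], [i <= n + L], that enters [ker n], by a
    margin comparable to [eps n]. *)
Definition rho n : R := rad (n + L.+2).

Lemma rho_ge n : 2^-1 <= rho n.
Proof.
have h : rad 1 <= rho n by apply: rad_le; rewrite addnS.
by move: h; rewrite {1}/rad /eps expr1; lra.
Qed.

Lemma rho_gt0 n : 0 < rho n.
Proof. by apply: lt_le_trans (rho_ge n); rewrite invr_gt0. Qed.

Lemma rho_lt1 n : rho n < 1.
Proof. exact: rad_lt1. Qed.

Section Bounds.
Variables (n : nat) (u zeta : C).
Hypotheses (du : disk u) (dz : disk zeta).

(** With this argument [kfac _ i] is the Cauchy kernel of the circle of radius [rho n] at the point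
    [rad i * u]. *)
Definition kpt v : C := u / (rho n)%:C * v^-1.

Lemma normc_kpt v : normc v = 1 -> normc (kpt v) <= 2.
Proof.
move=> v1; rewrite !normcM !normcV v1 invr1 mulr1 normcr ?(ltW (rho_gt0 _))//.
rewrite ler_pdivrMr ?rho_gt0//; apply: le_trans (ltW du) _.
by have := rho_ge n; lra.
Qed.

Lemma kpt_dist v v' : normc v = 1 -> normc v' = 1 ->
  normc (kpt v' - kpt v) <= 2 * normc (v' - v).
Proof.
move=> v1 v1'; have [v0 v0'] : v != 0 /\ v' != 0 by rewrite -!normc_gt0 v1 v1'.
have r0 : (rho n)%:C != 0 :> C by rewrite -normc_gt0 normcr ?rho_gt0// ltW ?rho_gt0.
have -> : kpt v' - kpt v = kpt v * v'^-1 * (v - v').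
  by rewrite /kpt; field; rewrite v0 v0' r0.
rewrite normcM [normc (kpt v * _)]normcM normc_distC [normc v'^-1]normcV v1' invr1 mulr1.
by rewrite ler_wpM2r ?normc_ge0// normc_kpt.
Qed.

Lemma eps_rho i : (i <= n + L)%N -> eps (n + L.+2) <= 1 - rad i / rho n.
Proof.
move=> iL; have r0 := rho_gt0 n; have r1 := rho_lt1 n.
have h : rad i <= rad (n + L) :> R by exact: rad_le.
have h2 : eps (n + L) = 4 * eps (n + L.+2) :> R.
  by rewrite epsS [eps (n + L).+1]epsS !addnS; ring.
have e0 := @eps_gt0 R (n + L.+2).
rewrite lerBrDl -lerBrDr ler_pdivrMr//; apply: le_trans h _.
rewrite /rho in r0 r1 *; rewrite /rad h2 in r0 r1 *.
have : eps (n + L.+2) * (1 - eps (n + L.+2)) <= eps (n + L.+2) :> R.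
  by rewrite ler_piMr ?(ltW e0)// gerBl ltW.
have : 0 <= eps (n + L.+2) * eps (n + L.+2) :> R by rewrite mulr_ge0 ?ltW.
by move: e0; move: (eps _) => e; lra.
Qed.

Lemma kfac_den v i : normc v = 1 -> (i <= n + L)%N ->
  eps (n + L.+2) <= normc (1 - (rad i)%:C * kpt v).
Proof.
move=> v1 iL; apply: le_trans (normc_lerB _ _); rewrite normc1.
apply: le_trans (eps_rho iL) _; rewrite lerD2l lerN2.
rewrite !normcM !normcV v1 invr1 mulr1 !normcr ?rad_ge0 ?(ltW (rho_gt0 _))//.
rewrite ler_wpM2l ?rad_ge0// ler_piMl ?invr_ge0 ?(ltW (rho_gt0 _))//.
exact: ltW.
Qed.

Lemma kfac_neq0 v i : normc v = 1 -> (i <= n + L)%N -> 1 - (rad i)%:C * kpt v != 0.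
Proof.
by move=> v1 iL; rewrite -normc_gt0; apply: lt_le_trans (kfac_den v1 iL); exact: eps_gt0.
Qed.

Lemma kfac_le v i : normc v = 1 -> (i <= n + L)%N ->
  normc (kfac (kpt v) i) <= 2 ^+ L.+2 / eps n.
Proof.
move=> v1 iL; rewrite normcV.
have -> : 2 ^+ L.+2 / eps n = (eps (n + L.+2))^-1 :> R.
  by rewrite !epsE !invrK exprD mulrC.
by rewrite lef_pV2 ?posrE ?eps_gt0 ?normc_gt0 ?kfac_neq0// kfac_den.
Qed.

(** The data of the two denominators agree up to multiples of [eps n], and the denominator of [kfac]
    is itself at least [eps (n + L.+2)], so the perturbation is absorbed into a constant factor. *)
Lemma kfac_compare v i : normc v = 1 -> (n <= i.+1)%N -> (i <= n + L)%N ->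
  normc (zeta - (rad n)%:C * v) <= 19 * eps n ->
  normc (kfac (kpt v) i) <= (1 + 20 * 2 ^+ L.+2) / normc (1 - zeta^* * u).
Proof.
move=> v1 ni iL zv; have den := kfac_den v1 iL.
have D0 : 0 < normc (1 - zeta^* * u) by rewrite normc_gt0 kernel_neq0 ?normcJ// ltW.
have d0 : 0 < normc (1 - (rad i)%:C * kpt v) by rewrite normc_gt0 kfac_neq0.
rewrite normcV ler_pdivlMr// mulrC ler_pdivrMr//.
have vV : v^-1 = v^*.
  by apply: (mulfI (_ : v != 0)); rewrite ?mulcJ ?v1 ?expr1n ?divff// -normc_gt0 v1.
have -> : 1 - zeta^* * u = (1 - (rad i)%:C * kpt v) +
    ((rad i / rho n - rad n)%:C * v^* - (zeta - (rad n)%:C * v)^*) * u.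
  have -> : (zeta - (rad n)%:C * v)^* = zeta^* - (rad n)%:C * v^*.
    by rewrite rmorphB; congr (_ - _); rewrite [LHS]rmorphM; congr (_ * _); exact: conjc_real.
  have -> : (rad i / rho n - rad n)%:C = (rad i)%:C / (rho n)%:C - (rad n)%:C :> C.
    by rewrite rmorphB fmorph_div.
  by rewrite /kpt vV; ring.
apply: le_trans (normc_leD _ _) _; rewrite [leRHS]mulrDl mul1r lerD2l normcM.
(* 20 is 19 for [zeta] plus 1 for the radii; comparing with the lower bound of the denominator costs
   [2 ^+ L.+2]. *)
apply: (@le_trans _ _ (20 * eps n)); last first.
  by rewrite -(eps_mul2 n L.+2) mulrA; apply: ler_wpM2l => //; rewrite mulr_ge0 ?exprn_ge0.
have e0 := @eps_gt0 R n.
rewrite -[leRHS]mulr1; apply: ler_pM; rewrite ?normc_ge0 ?(ltW du)//.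
apply: le_trans (normcB_le _ _) _; rewrite normcJ normcM normcJ v1 mulr1 normc_real.
rewrite (_ : 20 * eps n = eps n + 19 * eps n); last by ring.
apply: lerD zv; rewrite ler_norml; apply/andP; split.
  have h : rad i <= rad i / rho n.
    by rewrite ler_peMr ?rad_ge0// invf_ge1 ?rho_gt0// ltW ?rho_lt1.
  have : eps i <= 2 * eps n :> R.
    case: (n) ni e0 => [|n'] ni e0; first by apply: le_trans (@eps_le1 R i) _; rewrite /eps expr0; lra.
    by rewrite -epsS; exact: eps_le.
  by move: h; rewrite /rad; lra.
have := eps_rho iL; have := @eps_gt0 R (n + L.+2); rewrite {3}/rad; lra.
Qed.

Lemma kfac_dist v v' i : normc v = 1 -> normc v' = 1 -> (i <= n + L)%N ->
  normc (kfac (kpt v') i - kfac (kpt v) i) <=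
  2 * normc (v' - v) * (2 ^+ L.+2 / eps n) * normc (kfac (kpt v) i) /\
  normc (kpt v' * kfac (kpt v') i - kpt v * kfac (kpt v) i) <=
  2 * normc (v' - v) * (2 ^+ L.+2 / eps n) * normc (kfac (kpt v) i).
Proof.
move=> v1 v1' iL; have n0 := kfac_neq0 v1 iL; have n0' := kfac_neq0 v1' iL.
have h1 := kfac_le v1' iL; have h2 := kpt_dist v1 v1'.
have w0 := normc_ge0 (kfac (kpt v) i).
have q1 : normc (rad i)%:C <= 1 :> R by rewrite normcr ?rad_ge0// ltW ?rad_lt1.
have E2 : kpt v' * kfac (kpt v') i - kpt v * kfac (kpt v) i =
    (kpt v' - kpt v) * kfac (kpt v') i * kfac (kpt v) i.
  by rewrite /kfac; field; rewrite n0 n0'.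
have E1 : kfac (kpt v') i - kfac (kpt v) i =
    (rad i)%:C * ((kpt v' - kpt v) * kfac (kpt v') i * kfac (kpt v) i).
  by rewrite /kfac; field; rewrite n0 n0'.
have H : normc ((kpt v' - kpt v) * kfac (kpt v') i * kfac (kpt v) i) <=
  2 * normc (v' - v) * (2 ^+ L.+2 / eps n) * normc (kfac (kpt v) i).
  rewrite normcM; apply: (ler_wpM2r w0); rewrite normcM.
  by apply: ler_pM => //; exact: normc_ge0.
split; last by rewrite E2.
by rewrite E1 normcM; apply: le_trans H; rewrite ler_piMl ?normc_ge0.
Qed.

End Bounds.

(** The [L + 1] powers of [x] are distributed over the first [L + 1] of the [L + 2] kernel factors,
    so that the product can be estimated factor by factor. *)
Definition kfactor n x i : C := (if (i < L.+1)%N then x else 1) * kfac x (n.-1 + i).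

Lemma kerS n v u : normc v = 1 -> disk u ->
  ker n.+1 (kpt n.+1 u v) = (rich_cst L * eps n ^+ L.+1)%:C *
    \prod_(i < L.+2) kfactor n.+1 (kpt n.+1 u v) i.
Proof.
move=> v1 du; rewrite /ker rich_kernel => [|i /andP[_ iL]]; last first.
  by apply: kfac_neq0 => //; rewrite addSn -addnS.
rewrite -mulrA; congr (_ * _); rewrite /kfactor big_split /=; congr (_ * _).
rewrite big_ord_recr /= ltnn mulr1 -[in LHS](card_ord L.+1) -prodr_const.
by apply: eq_bigr => i _; rewrite ltn_ord.
Qed.

Definition near_point n zeta v := normc (zeta - (rad n)%:C * v) <= 19 * eps n.

Lemma kfactor_le n u zeta v i : disk u -> disk zeta -> normc v = 1 -> near_point n.+1 zeta v ->
  (i < L.+2)%N ->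
  normc (kfactor n.+1 (kpt n.+1 u v) i) <=
    2 * (1 + 20 * 2 ^+ L.+2) / normc (1 - zeta^* * u).
Proof.
move=> du dz v1 zv iL; rewrite normcM -mulrA ler_pM ?normc_ge0//.
  by case: ifP => _; [exact: normc_kpt|rewrite normc1 ler1n].
by apply: kfac_compare => //; rewrite /= ?ltnS ?leq_addr// addSn -addnS leq_add2l -ltnS.
Qed.

Lemma kfactor_dist n u zeta v v' i : disk u -> disk zeta -> normc v = 1 -> normc v' = 1 ->
  near_point n.+1 zeta v -> (i < L.+2)%N ->
  normc (kfactor n.+1 (kpt n.+1 u v') i - kfactor n.+1 (kpt n.+1 u v) i) <=
    normc (v' - v) * (2 ^+ L.+2 / eps n.+1) *
    (2 * (1 + 20 * 2 ^+ L.+2) / normc (1 - zeta^* * u)).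
Proof.
move=> du dz v1 v1' zv iL.
have iL' : (n + i <= n.+1 + L)%N by rewrite addSn -addnS leq_add2l -ltnS.
have [h1 h2] := kfac_dist du v1 v1' iL'.
have h3 : normc (kfac (kpt n.+1 u v) (n + i)) <= (1 + 20 * 2 ^+ L.+2) / normc (1 - zeta^* * u).
  by apply: kfac_compare => //; rewrite ltnS leq_addr.
have e0 : 0 <= 2 * normc (v' - v) * (2 ^+ L.+2 / eps n.+1).
  apply: mulr_ge0; first by rewrite mulr_ge0 ?normc_ge0.
  by rewrite divr_ge0 ?exprn_ge0// ltW ?eps_gt0.
rewrite [leRHS](_ : _ = 2 * normc (v' - v) * (2 ^+ L.+2 / eps n.+1) *
  ((1 + 20 * 2 ^+ L.+2) / normc (1 - zeta^* * u))); last by ring.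
apply: le_trans (ler_wpM2l e0 h3); rewrite /kfactor /=.
by case: ifP => _; rewrite ?mul1r.
Qed.

Lemma disk_kernel_le2 u zeta : disk u -> disk zeta -> normc (1 - zeta^* * u) <= 2.
Proof.
move=> du dz; rewrite (le_trans (normcB_le _ _))// normc1 normcM normcJ.
by rewrite -[2]/(1 + 1) lerD2l mulr_ile1 ?normc_ge0// ltW.
Qed.

(** [b] is the size measured by [ksup] with exponent [L + 2]. For [n > 0] the product formula
    applies, with [K1] and [K2]; for [n = 0] there is no increment, but [b] is bounded below, and
    [K3] and [K4] suffice. *)
Lemma ker_bounds : exists2 K : R, 0 < K & forall n u zeta v v', disk u -> disk zeta ->
  normc v = 1 -> normc v' = 1 -> near_point n zeta v -> near_point n zeta v' ->
  let b := eps n ^+ L.+1 / normc (1 - zeta^* * u) ^+ L.+2 in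
  normc (ker n (kpt n u v)) <= K * b /\
  normc (ker n (kpt n u v') - ker n (kpt n u v)) <= K * (normc (v' - v) / eps n) * b.
Proof.
pose P : R := 2 * (1 + 20 * 2 ^+ L.+2); pose p2 : R := 2 ^+ L.+2.
have p20 : 0 < p2 by rewrite exprn_gt0.
have P0 : 0 < P by rewrite mulr_gt0// addr_gt0// mulr_gt0.
pose K1 := 2 ^+ L.+1 * P ^+ L.+2; pose K2 := L.+2%:R * p2 * K1.
pose K3 := 3 ^+ L * p2 * p2; pose K4 := 3 ^+ L * (2 * p2 * p2) * p2.
have K10 : 0 < K1 by rewrite mulr_gt0 ?exprn_gt0.
have K20 : 0 < K2 by rewrite mulr_gt0// mulr_gt0.
have t0 : 0 < 3 ^+ L :> R by rewrite exprn_gt0.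
have K30 : 0 < K3 by apply: mulr_gt0 => //; exact: mulr_gt0.
have K40 : 0 < K4.
  by apply: mulr_gt0 => //; apply: mulr_gt0 => //; apply: mulr_gt0 => //; exact: mulr_gt0.
have p2E : 2 ^+ L.+2 = p2 by []; have PE : 2 * (1 + 20 * 2 ^+ L.+2) = P by [].
clearbody p2 P.
exists (K1 + K2 + K3 + K4); first by rewrite !addr_gt0.
move=> n u zeta v v' du dz v1 v1' zv zv' b.
have D0 : 0 < normc (1 - zeta^* * u) by rewrite normc_gt0 kernel_neq0 ?normcJ// ltW.
have D2 := disk_kernel_le2 du dz.
have e0 := @eps_gt0 R n.
have b0 : 0 < b by rewrite divr_gt0// exprn_gt0.
have x0 : 0 <= normc (v' - v) / eps n by rewrite divr_ge0 ?normc_ge0 ?ltW.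
suff [H1 H2] : normc (ker n (kpt n u v)) <= (K1 + K3) * b /\
  normc (ker n (kpt n u v') - ker n (kpt n u v)) <=
    (K2 + K4) * (normc (v' - v) / eps n) * b.
  split; [apply: le_trans H1 _|apply: le_trans H2 _].
    by apply: (ler_wpM2r (ltW b0)); move: K10 K20 K30 K40; lra.
  apply: (ler_wpM2r (ltW b0)); apply: (ler_wpM2r x0).
  by move: K10 K20 K30 K40; lra.
case: n => [|n] in zv zv' b e0 b0 x0 *.
  have b1 : 1 <= p2 * b.
    rewrite /b /eps !expr0 expr1n mul1r ler_pdivlMr ?exprn_gt0// mul1r -p2E.
    by rewrite lerXn2r ?nnegrE ?(ltW D0).
  have e1 : eps 0 = 1 :> R by rewrite /eps expr0.
  have le1 w : normc w = 1 -> forall i, (0 <= i <= 0 + L)%N -> normc (kfac (kpt 0 u w) i) <= p2.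
    by move=> w1 i /andP[_ iL]; have := kfac_le du w1 iL; rewrite e1 divr1 p2E.
  split; rewrite /ker.
    apply: le_trans (rich_le (le1 v v1)) _.
    rewrite (_ : (K1 + K3) * b = K1 * b + (3 ^+ L * p2) * (p2 * b)); last by rewrite /K3; ring.
    apply: ler_wpDl; first by rewrite mulr_ge0 ?ltW.
    by rewrite ler_peMr// mulr_ge0 ?ltW.
  rewrite -richB.
  have d1 i : (0 <= i <= 0 + L)%N -> normc (kfac (kpt 0 u v') i - kfac (kpt 0 u v) i) <=
      2 * normc (v' - v) * p2 * p2.
    move=> iL; have [_ iL'] := andP iL; have [h _] := kfac_dist du v1 v1' iL'.
    rewrite e1 divr1 p2E in h; apply: le_trans h _; apply: ler_wpM2l (le1 v v1 i iL).
    by apply: mulr_ge0 (ltW p20); apply: mulr_ge0 (normc_ge0 _).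
  apply: le_trans (rich_le d1) _; rewrite e1 divr1.
  rewrite (_ : (K2 + K4) * normc (v' - v) * b = K2 * normc (v' - v) * b +
    3 ^+ L * (2 * normc (v' - v) * p2 * p2) * (p2 * b)); last by rewrite /K4; ring.
  have nv := normc_ge0 (v' - v).
  apply: ler_wpDl; first by apply: mulr_ge0 (ltW b0); apply: mulr_ge0 nv; exact: ltW.
  rewrite ler_peMr//; apply: mulr_ge0 (ltW t0) _; apply: mulr_ge0 (ltW p20).
  by apply: mulr_ge0 (ltW p20); apply: mulr_ge0.
have cst_le : normc (rich_cst L * eps n ^+ L.+1)%:C <= 2 ^+ L.+1 * eps n.+1 ^+ L.+1 :> R.
  have /andP[c0 c1] := @rich_cst_le R L.
  rewrite normcr; last by rewrite mulr_ge0// exprn_ge0// ltW ?eps_gt0.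
  by rewrite -exprMn -epsS ler_piMl// exprn_ge0// ltW ?eps_gt0.
set D := normc (1 - zeta^* * u) in D0 D2 b b0 *.
have q0 : 0 <= 2 ^+ L.+1 * eps n.+1 ^+ L.+1 :> R by rewrite mulr_ge0 ?exprn_ge0// ltW ?eps_gt0.
have PD0 : 0 <= P / D by rewrite divr_ge0 ?ltW.
have K1E : K1 * b = 2 ^+ L.+1 * eps n.+1 ^+ L.+1 * (P / D) ^+ L.+2.
  by rewrite /K1 /b expr_div_n; ring.
have f1 w i : normc w = 1 -> near_point n.+1 zeta w -> (i < L.+2)%N ->
    normc (kfactor n.+1 (kpt n.+1 u w) i) <= P / D.
  by move=> w1 zw iL; have := kfactor_le du dz w1 zw iL; rewrite PE.
have K3b : 0 <= K3 * b by apply: mulr_ge0; exact: ltW.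
have K4b : 0 <= K4 * (normc (v' - v) / eps n.+1) * b.
  by apply: mulr_ge0 (ltW b0); apply: mulr_ge0 x0; exact: ltW.
split.
  rewrite kerS// normcM mulrDl K1E; apply: ler_wpDr K3b _.
  by apply: ler_pM; rewrite ?normc_ge0//; apply: prod_le => i; exact: f1.
rewrite !kerS// -mulrBr normcM !mulrDl; apply: ler_wpDr K4b _.
set X := normc (v' - v) / eps n.+1.
rewrite (_ : K2 * X * b = K1 * b * (L.+2%:R * p2 * X)); last by rewrite /K2; ring.
rewrite K1E -mulrA [(P / D) ^+ _ * _]mulrC.
apply: ler_pM; rewrite ?normc_ge0//.
rewrite (_ : L.+2%:R * p2 * X = L.+2%:R * (normc (v' - v) * (p2 / eps n.+1))); last first.
  by rewrite /X; ring.
apply: prod_dist => //.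
  by apply: mulr_ge0 (normc_ge0 _) _; exact: divr_ge0 (ltW p20) (ltW e0).
move=> i iL; split; [exact: f1|exact: f1|].
by have := kfactor_dist du dz v1 v1' zv iL; rewrite PE p2E.
Qed.

Section Reproduction.
Variables (h : C -> C) (u : C).
Hypotheses (ha : analytic h) (du : disk u).

Definition kint n v : C := h ((rho n)%:C * v) * ker n (kpt n u v).

Let hs i := h ((rad i)%:C * u).

Lemma cvs_kfac n i : (i <= n + L)%N ->
  cvs (fun m => davg m (fun v => h ((rho n)%:C * v) * kfac (kpt n u v) i)) (hs i).
Proof.
move=> iL; have hd z : disk z -> hasd h z (derive1 h z) by exact: analytic_hasd.
have lt : normc ((rad i)%:C * u) < rho n.
  rewrite normcM normcr ?rad_ge0//.
  apply: (@le_lt_trans _ _ (rad (n + L))).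
    apply: (@le_trans _ _ (rad i)); last exact: rad_le.
    by rewrite ler_piMr ?rad_ge0// ltW.
  rewrite /rho !addnS; apply: (@le_lt_trans _ _ (rad (n + L).+1)); first exact: rad_le.
  by rewrite -subr_gt0 radS_sub eps_gt0.
have := discrete_cauchy (analytic_derive ha) hd lt (rho_lt1 n).
apply: cvs_ext => m; apply: eq_davg => k; congr (_ * _^-1).
by rewrite /kpt !mulrA.
Qed.

Lemma cvs_rich n j : (j + L <= n + L)%N ->
  cvs (fun m => davg m (fun v => h ((rho n)%:C * v) * rich L (kfac (kpt n u v)) j))
    (rich L hs j).
Proof.
move=> jn; apply: (@cvs_ext _ (fun m => rich L (fun i => davg m (fun v =>
    h ((rho n)%:C * v) * kfac (kpt n u v) i)) j)).
  move=> m; rewrite rich_davg; apply: eq_davg => k; exact: richZ.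
apply: rich_cvs => i /andP[_ ij]; apply: cvs_kfac; exact: leq_trans jn.
Qed.

Let partial n := if n is j.+1 then rich L hs j.+1 - rich L hs j else rich L hs 0.

Lemma cvs_kint n : cvs (fun m => davg m (kint n)) (partial n).
Proof.
case: n => [|j]; first exact: cvs_rich.
apply: (@cvs_ext _ (fun m =>
    davg m (fun v => h ((rho j.+1)%:C * v) * rich L (kfac (kpt j.+1 u v)) j.+1) -
    davg m (fun v => h ((rho j.+1)%:C * v) * rich L (kfac (kpt j.+1 u v)) j))).
  by move=> m; rewrite -davgB; apply: eq_davg => k; rewrite -mulrBr.
by apply: cvsB; apply: cvs_rich; rewrite // leq_add2r.
Qed.

Lemma sum_partial M : \sum_(n < M.+1) partial n = rich L hs M.
Proof.
elim: M => [|M IHM]; first by rewrite big_ord1.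
by rewrite big_ord_recr IHM /= addrC subrK.
Qed.

Lemma cvs_dilate : cvs hs (h u).
Proof.
move=> e e0; have [r r0 rP] := hasd_continuous (analytic_hasd ha du) e0.
have [N NP] := eps_small r0; exists N => i Ni; apply/ltW/rP.
rewrite /rad rmorphB rmorph1 mulrBl mul1r addrC addKr normcN normcM normcr ?(ltW (eps_gt0 _))//.
apply: le_lt_trans NP; apply: le_trans (eps_le Ni).
by rewrite ler_piMr ?(ltW (eps_gt0 _))// ltW.
Qed.

(** The circle averages converge level by level, so the refinement [M'] is chosen after the number
    of levels [M]: the limits are nested, not joint. *)
Lemma kernel_reproduces (e : R) : 0 < e -> exists M0, forall M, (M0 <= M)%N ->
  exists M0', forall M', (M0' <= M')%N ->
  normc (\sum_(n < M) davg (n + M') (kint n) - h u) <= e.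
Proof.
move=> e0; have e2 : 0 < e / 2 by rewrite divr_gt0.
have [M0 MP] := rich_lim L cvs_dilate e2; exists M0.+1 => -[//|M] M0M.
have h1 := MP M M0M; rewrite -sum_partial in h1.
have := @cvs_sum _ M.+1 (fun n m => davg (n + m) (kint n)) partial.
have H i : (i < M.+1)%N -> cvs (fun m => davg (i + m) (kint i)) (partial i).
  by move=> _; exact: cvs_shift (cvs_kint i).
move=> /(_ H) /(_ _ e2)[M' M'P]; exists M' => m /M'P h2.
rewrite [leRHS]splitr; apply: le_trans (normc_dist_trans _ _ _) (lerD h2 h1).
Qed.

End Reproduction.

End Kernels.

(** * Nuclearity from absolutely summable expansions *)

Section UniqueSums.
Context {R : realType}.

Lemma sum_uniq_subset (I : eqType) (J J' : seq I) (b : I -> R) :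
  (forall i, 0 <= b i) -> uniq J -> uniq J' -> {subset J <= J'} ->
  \sum_(i <- J) b i <= \sum_(i <- J') b i.
Proof.
move=> b0 uJ uJ' sub; rewrite [leRHS](bigID (mem J)) /=.
rewrite -[X in _ <= X + _]big_filter.
have P : perm_eq [seq i <- J' | i \in J] J.
  apply: uniq_perm => //; first exact: filter_uniq.
  by move=> i; rewrite mem_filter; case: (boolP (i \in J)) => // /sub ->.
by rewrite (perm_big _ P) lerDl sumr_ge0.
Qed.

Variable (I : countType).

(** Finite exhaustion of a countable type by the elements of code below [K]; codes that are not
    attained are dropped. *)
Definition codes_lt K : seq I := pmap pickle_inv (iota 0 K).

Lemma codes_lt_uniq K : uniq (codes_lt K).
Proof. by apply: (pmap_uniq pickle_invK); exact: iota_uniq. Qed.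

Lemma mem_codes_lt K i : (i \in codes_lt K) = (pickle i < K)%N.
Proof.
rewrite mem_pmap; apply/mapP/idP => [[k]|iK].
  rewrite mem_iota add0n => kK; case: (pickle_inv k) (@pickle_invK I k) => //= j jk [->].
  by rewrite jk.
by exists (pickle i); rewrite ?mem_iota ?add0n// pickleK_inv.
Qed.

Lemma codes_ltS K : codes_lt K.+1 = codes_lt K ++ seq_of_opt (pickle_inv K).
Proof.
by rewrite /codes_lt -addn1 iotaD pmap_cat add0n /=; case: (pickle_inv K).
Qed.

Lemma sum_codes_lt (V : nmodType) (F : I -> V) (G : nat -> V) K :
  (forall k, G k = oapp F 0 (pickle_inv k)) ->
  \sum_(0 <= k < K) G k = \sum_(i <- codes_lt K) F i.
Proof.
move=> GE; elim: K => [|K IHK]; first by rewrite big_geq// big_nil.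
rewrite big_nat_recr//= IHK codes_ltS big_cat /= GE; congr (_ + _).
by case: (pickle_inv K) => [i|] /=; rewrite ?big_seq1 ?big_nil.
Qed.

Lemma codes_lt_cover (J : seq I) : exists K, {subset J <= codes_lt K}.
Proof.
exists (\max_(i <- J) pickle i).+1 => i iJ.
by rewrite mem_codes_lt ltnS; apply: leq_bigmax_seq.
Qed.

Lemma codes_lt_mono K K' : (K <= K')%N -> {subset codes_lt K <= codes_lt K'}.
Proof. by move=> KK' i; rewrite !mem_codes_lt => /leq_trans; exact. Qed.

(** Cauchy criterion for unordered sums: a partial sum within [e] of the supremum leaves at most [e]
    for any disjoint finite set. *)
Lemma codes_tail (b : I -> R) (B e : R) : (forall i, 0 <= b i) -> 0 < e ->
  (forall J, uniq J -> \sum_(i <- J) b i <= B) ->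
  exists K0, forall K J, (K0 <= K)%N -> uniq J ->
    {in J, forall i, i \notin codes_lt K} -> \sum_(i <- J) b i <= e.
Proof.
move=> b0 e0 bB; pose S K := \sum_(i <- codes_lt K) b i.
have hS : has_sup (range S).
  by split; [exists (S 0%N), 0%N|exists B => _ [K _ <-]; apply: bB; exact: codes_lt_uniq].
have [_ [K0 _ <-] K0P] := sup_adherent e0 hS.
exists K0 => K J K0K uJ dJ; have [K' K'P] := codes_lt_cover (codes_lt K ++ J).
have uc : uniq (codes_lt K ++ J).
  rewrite cat_uniq codes_lt_uniq uJ andbT /=; apply/hasPn => i /dJ.
  by [].
have := sum_uniq_subset b0 uc (codes_lt_uniq K') K'P; rewrite big_cat /= -/(S K) -/(S K').
have h1 : S K' <= sup (range S) by apply: sup_upper_bound => //; exists K'.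
have h2 : S K0 <= S K.
  apply: sum_uniq_subset => //; try exact: codes_lt_uniq; exact: codes_lt_mono.
by move: K0P h1 h2; lra.
Qed.

End UniqueSums.

Section NuclearCriterion.
Context {R : realType}.
Local Notation C := R[i].

(** The error is controlled by tails of [b] over arbitrary finite sets, independently of any order
    of summation; the codes then provide an order. *)
Lemma nuclear_of_sum (X Y : normedModType C) (T : X -> Y) (I : countType) (i0 : I)
    (x' : I -> {scalar X}) (y : I -> Y) (b : I -> R) (B : R) :
  (forall i, continuous (x' i)) ->
  (forall i, (dual_norm (x' i) * (rnorm (y i))%:E <= (b i)%:E)%E) ->
  (forall i, 0 <= b i) ->
  (forall J, uniq J -> \sum_(i <- J) b i <= B) ->
  (forall f, exists2 c : R, 0 <= c & forall J0 (t : R), uniq J0 -> 0 <= t ->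
    (forall J, uniq J -> {in J, forall i, i \notin J0} -> \sum_(i <- J) b i <= t) ->
    rnorm (T f - \sum_(i <- J0) x' i f *: y i) <= c * t) ->
  nuclear T.
Proof.
move=> x'c yb b0 bB TP.
(* The default [i0] is harmless: at codes that are not attained the vector [ys k] is 0. *)
pose xs k := x' (odflt i0 (pickle_inv k)).
pose ys k : Y := oapp y 0 (pickle_inv k).
exists xs, ys; split; first by move=> k; exact: x'c.
  have bs k : (dual_norm (xs k) * (rnorm (ys k))%:E <= (oapp b 0 (pickle_inv k))%:E)%E.
    rewrite /xs /ys; case: (pickle_inv k) => [i|] /=; first exact: yb.
    by rewrite rnorm0 mule0.
  apply: (@le_lt_trans _ _ B%:E); last exact: ltry.
  apply: lime_le.
    apply: is_cvg_nneseries => k _ _; apply: mule_ge0; first exact: dual_norm_ge0.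
    by rewrite lee_fin N_ge0.
  apply: nearW => n.
  apply: (@le_trans _ _ (\sum_(0 <= k < n) (oapp b 0 (pickle_inv k))%:E)%E).
    by apply: lee_sum => k _; exact: bs.
  rewrite sumEFin lee_fin (@sum_codes_lt I R b)//; apply: bB; exact: codes_lt_uniq.
move=> f; have [c c0 cP] := TP f.
apply/cvgrPdist_le => -[e e']; rewrite ltcE /= => /andP[/eqP -> e0].
have c1 : 0 < c + 1 by rewrite ltr_wpDl.
have [K0 K0P] := codes_tail b0 (divr_gt0 e0 c1) bB.
exists K0 => // K /= K0K; rewrite -[_ +i* _]/(e%:C) Nle /series /=.
rewrite (@sum_codes_lt I Y (fun i => x' i f *: y i)); last first.
  by move=> k; rewrite /xs /ys; case: (pickle_inv k) => [i|] //=; rewrite scaler0.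
apply: le_trans (cP _ (e / (c + 1)) (codes_lt_uniq I K) _ _) _.
- by rewrite divr_ge0 ?ltW.
- by move=> J uJ dJ; apply: K0P dJ.
by rewrite mulrCA ler_piMr ?(ltW e0)// ler_pdivrMr// mul1r lerDl.
Qed.

End NuclearCriterion.

(** * Functionals and integrated kernels *)

Section Functionals.
Context {R : realType}.
Local Notation C := R[i].

Lemma num_shift (nu : weight R) p : (exists beta, normal_exp_I nu beta) ->
  exists2 c : R, 0 < c & forall n, num nu n <= c * num nu (n + p).
Proof.
move=> /numS[c c0 cP]; exists (c ^+ p) => [|n]; first exact: exprn_gt0.
elim: p => [|p IHp]; first by rewrite expr0 mul1r addn0.
apply: le_trans IHp _; rewrite exprSr -mulrA addnS ler_pM2l ?exprn_gt0//.
Qed.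

(** The sampling points lie [p] levels beyond [n] with [p] fixed, so the comparison with level [n]
    only costs a constant. *)
Lemma derive_le (nu : weight R) p : (exists beta, normal_exp_I nu beta) ->
  exists2 c : R, 0 < c & forall n y (K : R), analytic y ->
    (forall w, disk w -> nu w * normc (y w) <= K) ->
    forall z, normc z <= rad (n + p) -> normc (derive1 y z) <= c * K / (num nu n * eps n).
Proof.
move=> /(num_shift p.+1)[c c0 cP]; exists (4 * c * 2 ^+ p.+1).
  by rewrite !mulr_gt0 ?exprn_gt0.
move=> n y K ya yK z zn; apply: le_trans (derive1_le_num ya yK zn) _.
have K0 : 0 <= K.
  by apply: le_trans (yK 0 (@disk0 R)); rewrite mulr_ge0 ?normc_ge0// ltW ?weight_gt0//; exact: disk0.
have n0 := num_gt0 nu n; have n1 := num_gt0 nu (n + p.+1); have e0 := @eps_gt0 R n.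
rewrite -addnS -(eps_mul2 n p.+1) in e0 *; have e1 := @eps_gt0 R (n + p.+1).
rewrite ler_pdivrMr ?mulr_gt0//.
rewrite [leRHS](_ : _ = 4 * K * (c * num nu (n + p.+1) / num nu n)); last first.
  by field; rewrite !gt_eqF ?exprn_gt0.
by rewrite ler_peMr ?mulr_ge0// ler_pdivlMr// mul1r.
Qed.

Lemma derive_dist (nu : weight R) p : (exists beta, normal_exp_I nu beta) ->
  exists2 c : R, 0 < c & forall n y (K : R), analytic y ->
    (forall w, disk w -> nu w * normc (y w) <= K) ->
    forall z z', normc z <= rad (n + p) -> normc z' <= rad (n + p) ->
    normc (derive1 y z' - derive1 y z) <= c * K / (num nu n * eps n ^+ 2) * normc (z' - z).
Proof.
move=> /(derive_le p.+1)[c c0 cP]; exists (4 * c * 2 ^+ p.+1).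
  by rewrite !mulr_gt0 ?exprn_gt0.
move=> n y K ya yK z z' zn zn'; have ya' := analytic_derive ya.
apply: (@mean_value_le _ _ (derive1 (derive1 y))) => t t01.
  apply: analytic_hasd => //; apply: le_lt_trans (normc_seg zn zn' t01) _.
  exact: rad_lt1.
have xn := normc_seg zn zn' t01; set x := z + _ in xn *.
have := @cauchy_estimate _ _ x (eps (n + p.+1)) (c * K / (num nu n * eps n)) ya'.
move=> /(_ (eps_gt0 _)) H; apply: le_trans (H _) _.
  move=> w wx; rewrite addnS in wx; have wn := rad_near xn wx; split.
    exact: le_lt_trans wn (rad_lt1 _).
  by apply: cP => //; rewrite addnS.
rewrite -(eps_mul2 n p.+1) le_eqVlt; apply/orP; left; apply/eqP.
by field; rewrite !gt_eqF ?num_gt0 ?eps_gt0 ?exprn_gt0.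
Qed.

Lemma scalar_of (X : lmodType C) (F : X -> C) :
  (forall a x y, F (a *: x + y) = a * F x + F y) ->
  exists x' : {scalar X}, forall x, x' x = F x.
Proof.
move=> lin; pose FL := GRing.isLinear.Build C X C *%R F lin.
pose x' : {scalar X} := HB.pack F FL.
by exists x'.
Qed.

Lemma scalar_continuous (X : normedModType C) (x' : {scalar X}) (K : R) : 0 <= K ->
  (forall f, normc (x' f) <= K * rnorm f) -> continuous x'.
Proof.
move=> K0 xK f; apply/cvgrPdist_le => -[e e']; rewrite ltcE /= => /andP[/eqP -> e0].
have K1 : 0 < K + 1 by rewrite ltr_wpDl.
have /cvgrPdist_le/(_ (e / (K + 1))%:C) := @cvg_id _ (nbhs f).
rewrite ltcR divr_gt0// => /(_ isT); apply: filterS => h; rewrite Nle => fh.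
have -> : x' f - x' h = x' (f - h) by rewrite raddfB.
rewrite -[leLHS]/((normc (x' (f - h)))%:C) -[leRHS]/(e%:C) lecR; apply: le_trans (xK _) _.
apply: le_trans (ler_wpM2l K0 fh) _.
by rewrite mulrCA ler_piMr ?(ltW e0)// ler_pdivrMr// mul1r lerDl.
Qed.

Lemma dual_norm_le (X : normedModType C) (x' : {scalar X}) (K : R) : 0 <= K ->
  (forall f, normc (x' f) <= K * rnorm f) -> (dual_norm x' <= K%:E)%E.
Proof.
move=> K0 xK; apply: ub_ereal_sup => _ [f f1 <-]; rewrite lee_fin.
apply: le_trans (xK f) _; rewrite -[leRHS]mulr1; apply: ler_wpM2l => //.
by rewrite -Nle.
Qed.

Lemma elements_derive_lin (E : weighted_space R) (a : C) (f h : elements E) p :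
  analytic f -> analytic h -> disk p ->
  derive1 (a *: f + h : elements E) p = a * derive1 f p + derive1 h p.
Proof.
move=> fa ha dp; apply: etrans (_ : _ = derive1 (fun w => a * f w + h w) p) _ => //.
exact: (hasd_derive1 (hasdD (hasdZ a (analytic_hasd fa dp)) (analytic_hasd ha dp))).
Qed.

(** Two evaluation points, since refinement terms contain differences of the derivative at adjacent
    nodes. *)
Lemma derive_functional (nu : weight R) (a b p q : C) (K : R) : disk p -> disk q ->
  0 <= K -> (forall f : elements (Hinf nu),
    normc (a * derive1 f p + b * derive1 f q) <= K * rnorm f) ->
  exists x' : {scalar elements (Hinf nu)},
    [/\ continuous x', (dual_norm x' <= K%:E)%E
      & forall f, x' f = a * derive1 f p + b * derive1 f q].
Proof.
move=> dp dq K0 fK; have an (f : elements (Hinf nu)) : analytic f.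
  by have [] := elements_mem f.
have [|x' x'E] := @scalar_of (elements (Hinf nu)) (fun f => a * derive1 f p + b * derive1 f q).
  move=> c f h; rewrite (elements_derive_lin c (an f) (an h) dp).
  rewrite (elements_derive_lin c (an f) (an h) dq).
  move: (derive1 f p) (derive1 h p) (derive1 f q) (derive1 h q) => A B D E; ring.
have xK (f : elements (Hinf nu)) : normc (x' f) <= K * rnorm f by rewrite x'E.
exists x'; split=> //; first exact: scalar_continuous K0 xK.
exact: dual_norm_le K0 xK.
Qed.

End Functionals.

(** * Kernels integrated against [g]: the vectors of the expansion *)

Section IntegratedKernels.
Context {R : realType}.
Local Notation C := R[i].

Lemma analytic_lin (a b : C) (f h : C -> C) : analytic f -> analytic h ->
  analytic (fun u => a * f u + b * h u).
Proof.
move=> fa ha; apply: (@hasd_analytic _ _ (fun u => a * derive1 f u + b * derive1 h u)) => z dz.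
by apply: hasdD; apply: hasdZ; exact: analytic_hasd.
Qed.

Lemma rich_analytic L (s : C -> nat -> C) j :
  (forall i, (j <= i <= j + L)%N -> analytic (s ^~ i)) ->
  analytic (fun u => rich L (s u) j).
Proof.
elim: L j => [|L IHL] j sa /=; first by apply: sa; rewrite leqnn leq_addr.
have a1 : analytic (fun u => rich L (s u) j.+1).
  by apply: IHL => i /andP[h1 h2]; apply: sa; rewrite (ltnW h1) addnS -addSn.
have a2 : analytic (fun u => rich L (s u) j).
  by apply: IHL => i /andP[h1 h2]; apply: sa; rewrite h1 (leq_trans h2)// leq_add2l.
have := @analytic_lin (2%:R ^+ L.+1 / (2%:R ^+ L.+1 - 1)) (- (2%:R ^+ L.+1 - 1)^-1) _ _ a1 a2.
by apply: eq_analytic => u _; ring.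
Qed.

Lemma ker_analytic L n v : normc v = 1 -> analytic (fun u : C => ker L n (kpt L n u v)).
Proof.
move=> v1; have kf i : (i <= n + L)%N -> analytic (fun u : C => kfac (kpt L n u v) i).
  move=> iL; apply: (@hasd_analytic _ _ (fun u =>
    - (0 - (rad i)%:C * ((rho L n)%:C^-1 * v^-1)) / (1 - (rad i)%:C * kpt L n u v) ^+ 2)) => u du.
  apply: (@hasdV _ (fun u => 1 - (rad i)%:C * kpt L n u v)); last exact: kfac_neq0.
  apply: hasdB; first exact: hasd_cst.
  have := hasdZ ((rad i)%:C * ((rho L n)%:C^-1 * v^-1)) (hasd_id u); rewrite mulr1.
  by congr hasd; apply/funext => w; rewrite /kpt; ring.
case: n kf => [|n] kf; first by apply: rich_analytic => i /andP[_]; exact: kf.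
have a1 : analytic (fun u : C => rich L (kfac (kpt L n.+1 u v)) n.+1).
  by apply: rich_analytic => i /andP[_]; exact: kf.
have a2 : analytic (fun u : C => rich L (kfac (kpt L n.+1 u v)) n).
  by apply: rich_analytic => i /andP[_ iL]; apply: kf; rewrite (leq_trans iL)// leq_add2r.
by have := @analytic_lin 1 (-1) _ _ a1 a2; apply: eq_analytic => u _; rewrite mul1r mulN1r.
Qed.

(** Taking [zeta = rad n * v] makes [near_point] immediate. The bound grows with [n]; it is meant
    for membership in the little space, not for summation. *)
Lemma ker_bounded L n v : normc v = 1 -> exists B : R, forall u, disk u ->
  normc (ker L n (kpt L n u v)) <= B.
Proof.
move=> v1; have [K K0 KP] := @ker_bounds R L; pose zeta := (rad n)%:C * v.
have nz : normc zeta = rad n by rewrite normcM v1 mulr1 normcr ?rad_ge0.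
have dz : disk zeta by rewrite /disk /= nz rad_lt1.
have nr : near_point n zeta v.
  by rewrite /near_point subrr normc0 mulr_ge0// ltW ?eps_gt0.
exists (K * (eps n ^+ L.+1 / eps n ^+ L.+2)) => u du.
have [+ _] := KP n u zeta v v du dz v1 v1 nr nr; move/le_trans; apply.
apply: ler_wpM2l; first exact: ltW.
have e0 := @eps_gt0 R n.
have h : eps n <= normc (1 - zeta^* * u).
  by rewrite -onem_rad -nz -[normc zeta]normcJ kernel_norm ?normcJ// ltW.
apply: ler_wpM2l; first by rewrite exprn_ge0 ?ltW.
have D0 := lt_le_trans e0 h.
rewrite lef_pV2 ?posrE ?exprn_gt0//; apply: lerXn2r => //; rewrite nnegrE; exact: ltW.
Qed.

Variables (mu : weight R) (g phi : C -> C).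
Hypotheses (nmu : normal mu) (phi_self : self_map phi).
Hypothesis g_H0 : in_H0 (fun z => (1 - normc z ^+ 2) * mu z) g.

Lemma integrated_kernel : exists2 cm : R, 0 < cm & forall (kappa : C -> C) (B G : R),
  analytic kappa -> (forall u, disk u -> normc (kappa u) <= B) -> 0 <= G ->
  (forall z, disk z -> (1 - normc z ^+ 2) * mu z * normc (g z) * normc (kappa (phi z)) <= G) ->
  exists y : elements (H0 mu), [/\ rnorm y <= cm * G, y 0 = 0 &
    forall z, disk z -> hasd y z (kappa (phi z) * g z)].
Proof.
have [cm cm0 cmP] := weighted_le_of_derive1 nmu; exists cm => // kappa B G ka kB G0 kG.
have [ga glim] := g_H0; have [_ phid] := phi_self.
pose F z := kappa (phi z) * g z.
have Fa : analytic F by exact: comp_analytic.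
have Fh z : disk z -> hasd (segment_integral F) z (F z) by exact: segment_integral_hasd.
have Ia : analytic (segment_integral F) by exact: hasd_analytic Fh.
have dI z : disk z -> derive1 (segment_integral F) z = F z.
  by move=> dz; exact: hasd_derive1 (Fh z dz).
have B0 : 0 <= B by apply: le_trans (normc_ge0 _) (kB 0 (@disk0 R)).
have wpos z : disk z -> 0 <= (1 - normc z ^+ 2) * mu z.
  by move=> dz; rewrite mulr_ge0 ?ltW ?weight_gt0 ?onem_sqr_gt0.
have IH0 : in_H0 mu (segment_integral F).
  apply: (in_H0_of_derive1 nmu Ia); split; first exact: (analytic_derive Ia).
  move=> e e0; have B1 : 0 < B + 1 by rewrite ltr_wpDl.
  have [r r1 rP] := glim _ (divr_gt0 e0 B1); exists r => // z rz dz.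
  rewrite dI// normcM; apply: (@le_lt_trans _ _ ((1 - normc z ^+ 2) * mu z * normc (g z) * (B + 1))).
    rewrite -[leRHS]mulrA; apply: ler_wpM2l; first exact: wpos.
    rewrite mulrC; apply: ler_wpM2l; first exact: normc_ge0.
    by apply: le_trans (kB _ (phid _ dz)) _; rewrite lerDl.
  by rewrite -ltr_pdivlMr// rP.
have [|y yE] := @elements_ext _ (H0 mu) (segment_integral F).
  by apply: eq_in_H0 IH0 => z dz; rewrite ext0E.
exists y; split.
- apply: elements_norm_le => z dz; rewrite yE//.
  apply: (cmP _ G Ia _ G0 _ z dz); first exact: segment_integral0.
  by move=> w dw; rewrite dI// normcM [normc _ * normc (g w)]mulrC mulrA; exact: kG.
- by rewrite yE ?segment_integral0//; exact: disk0.
- move=> z dz; apply: (@disk_hasd _ (segment_integral F)) => //; last exact: Fh.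
  by move=> w dw; rewrite yE.
Qed.

End IntegratedKernels.

(** * Sufficiency *)

Section BoxSums.
(** Level, refinement, node and tag of a term of the expansion. *)
Definition term_index : countType := (nat * nat * nat * 'I_3)%type.

Definition box M M' K : seq term_index :=
  [seq (nat_of_ord x.1.1.1, nat_of_ord x.1.1.2, nat_of_ord x.1.2, x.2) |
     x <- enum {: 'I_M * 'I_M' * 'I_K * 'I_3}].

Lemma box_uniq M M' K : uniq (box M M' K).
Proof.
rewrite map_inj_uniq ?enum_uniq// => -[[[a b] c] d] [[[a' b'] c'] d'] /= [].
by move=> /val_inj -> /val_inj -> /val_inj -> ->.
Qed.

Lemma mem_box M M' K n i k t : (n < M)%N -> (i < M')%N -> (k < K)%N ->
  (n, i, k, t) \in box M M' K.
Proof.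
move=> nM iM' kK; apply/mapP.
by exists (Ordinal nM, Ordinal iM', Ordinal kK, t); rewrite ?mem_enum.
Qed.

Lemma box_cover (J : seq term_index) : exists M, forall M' M'' K,
  (M <= M')%N -> (M <= M'')%N -> (M <= K)%N -> {subset J <= box M' M'' K}.
Proof.
exists (\max_(x <- J) (x.1.1.1 + x.1.1.2 + x.1.2)).+1 => M' M'' K h1 h2 h3 [[[n i] k] t] xJ.
have h : (n + i + k <= \max_(x <- J) (x.1.1.1 + x.1.1.2 + x.1.2))%N.
  exact: (@leq_bigmax_seq _ _ xpredT (fun x : term_index => (x.1.1.1 + x.1.1.2 + x.1.2)%N) _ xJ).
by apply: mem_box; lia.
Qed.

Lemma sum_box (V : nmodType) M M' K (F : nat -> nat -> nat -> 'I_3 -> V) :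
  \sum_(x <- box M M' K) F x.1.1.1 x.1.1.2 x.1.2 x.2 =
  \sum_(n < M) \sum_(i < M') \sum_(k < K) \sum_(t < 3) F n i k t.
Proof.
rewrite big_map big_enum /=.
rewrite -(pair_bigA _ (fun (y : 'I_M * 'I_M' * 'I_K) t => F y.1.1 y.1.2 y.2 t)) /=.
rewrite -(pair_bigA _ (fun (y : 'I_M * 'I_M') (k : 'I_K) => \sum_t F y.1 y.2 k t)) /=.
by rewrite -(pair_bigA _ (fun (n : 'I_M) (i : 'I_M') => \sum_(k < K) \sum_(t < 3) F n i k t)).
Qed.

Lemma sum_widen (V : nmodType) m K (F : nat -> V) : (m <= K)%N ->
  \sum_(k < K) (if (k < m)%N then F k else 0) = \sum_(k < m) F k.
Proof. by move=> mK; rewrite (big_ord_widen K F mK) [RHS]big_mkcond. Qed.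

End BoxSums.

Section Sufficiency.
Context {R : realType}.
Local Notation C := R[i].
Variables (nu mu : weight R) (g phi : C -> C) (A : R) (N : nat).
Hypotheses (nu_I : exists beta, normal_exp_I nu beta) (nmu : normal mu).
Hypotheses (phi_self : self_map phi).
Hypothesis g_H0 : in_H0 (fun z => (1 - normc z ^+ 2) * mu z) g.

Let c (z : C) : R := (1 - normc z ^+ 2) * mu z * normc (g z).
Hypothesis c_le : forall z, disk z -> c z <= A.
Hypothesis summable : ksummable c phi nu (N%:R + 3).

(** Extrapolation of this order produces [L + 2 = N + 3] kernel factors, the exponent [s]. *)
Let L := N.+1.
Let s : R := N%:R + 3.
Let q : R := 2^-1.

Let c_ge0 z : disk z -> 0 <= c z.
Proof.
move=> dz; rewrite /c mulr_ge0 ?normc_ge0// mulr_ge0//.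
  exact/ltW/onem_sqr_gt0.
exact/ltW/weight_gt0.
Qed.

Let s_ge0 : 0 <= s. Proof. by rewrite addr_ge0. Qed.

Definition node n i k : C := rou (n + i).+1 ^+ (2 * k).
Definition node' n i k : C := rou (n + i).+1 ^+ (2 * k).+1.

(* Functionals [f |-> coef.1 f'(p) + coef.2 f'(p')] and kernels at the two
   adjacent nodes; tag 0 is the coarsest average, tags 1 and 2 come from
   [h' k' - h k = (h' - h) k' + h (k' - k)]. *)
Definition coefs n i k (t : 'I_3) : C * C :=
  if (k < 2 ^ (n + i))%N then
    match nat_of_ord t with
    | 0 => (if i == 0%N then (2%:R ^+ (n + i))^-1 else 0, 0)
    | 1 => (- (2%:R ^+ (n + i).+1)^-1, (2%:R ^+ (n + i).+1)^-1)
    | _ => ((2%:R ^+ (n + i).+1)^-1, 0)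
    end
  else (0, 0).

Definition kap n i k (t : 'I_3) (u : C) : C :=
  if (k < 2 ^ (n + i))%N then
    match nat_of_ord t with
    | 0 => ker L n (kpt L n u (node n i k))
    | 1 => ker L n (kpt L n u (node' n i k))
    | _ => ker L n (kpt L n u (node' n i k)) - ker L n (kpt L n u (node n i k))
    end
  else 0.

Definition lam (h : C -> C) n i k t : C :=
  (coefs n i k t).1 * h ((rho L n)%:C * node n i k) +
  (coefs n i k t).2 * h ((rho L n)%:C * node' n i k).

(** One factor [q ^+ i] is the weight of a node in the average, the other the distance of adjacent
    nodes; each ancestor has [2 ^ i] nodes, so the sum over [k] leaves [q ^+ i]. *)
Definition bnd n i k : R :=
  if (k < 2 ^ (n + i))%N
  then kw nu s n * ksup c phi s (dpt n (k %/ 2 ^ i)) * (q ^+ i * q ^+ i) else 0.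

Lemma bnd_ge0 n i k : 0 <= bnd n i k.
Proof.
rewrite /bnd; case: ifP => // _; apply: mulr_ge0; last by rewrite mulr_ge0 ?exprn_ge0 ?invr_ge0.
apply: mulr_ge0; first exact: kw_ge0.
by apply: (ksup_ge0 c_ge0 c_le) => //; [case: phi_self|exact: disk_dpt].
Qed.

Lemma normc_node n i k : normc (node n i k) = 1. Proof. exact: normc_rou. Qed.
Lemma normc_node' n i k : normc (node' n i k) = 1. Proof. exact: normc_rou. Qed.

Lemma node_dist n i k : normc (node' n i k - node n i k) <= 8 * (eps n * q ^+ i).
Proof.
rewrite /node' exprS /node -{2}[_ ^+ (2 * k)]mul1r -mulrBl normcM normc_rou mulr1.
apply: le_trans (rou_sub1 _) _; rewrite -epsE /q -exprD -/(eps (n + i)) (epsS (n + i)).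
by lra.
Qed.

Lemma node_near n i k : near_point n (dpt n (k %/ 2 ^ i)) (node n i k) /\
  near_point n (dpt n (k %/ 2 ^ i)) (node' n i k).
Proof.
have H j : (j %/ 2)%N = k -> near_point n (dpt n (k %/ 2 ^ i)) (rou (n + i).+1 ^+ j : C).
  move=> jk; have := @dpt_ancestor R n i.+1 j; rewrite expnS divnMA jk => h.
  rewrite /near_point; apply: le_trans (normc_dist_trans (dpt (n + i.+1) j) _ _) _.
  (* 17 for the ancestor, 2 for the radii. *)
  rewrite normc_distC; rewrite (_ : 19 * eps n = 17 * eps n + 2 * eps n); last by ring.
  apply: lerD => //; rewrite /dpt addnS -mulrBl normcM normc_rou mulr1 -rmorphB.
  rewrite normcr ?subr_ge0 ?rad_le// ?leqW ?leq_addr//.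
  by rewrite /rad; have := @eps_gt0 R n; have := @eps_gt0 R (n + i).+1; lra.
by split; apply: H; lia.
Qed.

Lemma kw_nat n : kw nu s n = eps n ^+ N.+2 / num nu n.
Proof.
rewrite /kw; congr (_ / _); rewrite -powR_mulrn ?(ltW (eps_gt0 _))//; congr (_ `^ _).
by rewrite /s -[N.+2]addn2 natrD; ring.
Qed.

(** [Lam] bounds the functional and [G] the weighted kernel. The gain from adjacent nodes falls on
    [Lam] for tag 1 and on [G] for tag 2; tag 0 contributes at [i = 0] alone. *)
Lemma term_bounds : exists2 K : R, 0 < K & forall n i k t, exists Lam G : R,
  [/\ 0 <= Lam, 0 <= G, Lam * G <= K * bnd n i k,
    (forall f : elements (Hinf nu), normc (lam (derive1 f) n i k t) <= Lam * rnorm f)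
  & forall z, disk z -> c z * normc (kap n i k t (phi z)) <= G].
Proof.
have [K K0 KP] := @ker_bounds R L; have [_ phid] := phi_self.
have [c1 c10 P1] := derive_le L.+2 nu_I; have [c2 c20 P2] := derive_dist L.+2 nu_I.
exists (8 * (c1 + c2) * K); first by rewrite !mulr_gt0 ?addr_gt0.
move=> n i k t; rewrite /lam /coefs /kap /bnd.
have [kl|_] := ifP; last first.
  exists 0, 0; split=> //; first by rewrite mul0r mulr0.
    have Z (x y : C) (B : R) : normc ((0, 0).1 * x + (0, 0).2 * y) <= 0 * B.
      by rewrite /= !mul0r addr0 normc0.
    by move=> f; exact: Z.
  by move=> z dz'; rewrite normc0 mulr0.
have e0 := @eps_gt0 R n; have n0 := num_gt0 nu n.
set v := node n i k; set v' := node' n i k; set zeta := dpt n _.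
have dz : disk zeta by exact: disk_dpt.
have v1 : normc v = 1 by exact: normc_node.
have v1' : normc v' = 1 by exact: normc_node'.
have [nv nv'] := node_near n i k; have dv := node_dist n i k.
rewrite -/v -/v' -/zeta in nv nv' dv.
set S := ksup c phi s zeta.
have S0 : 0 <= S by apply: (ksup_ge0 c_ge0 c_le).
have qi : 0 < q ^+ i by rewrite exprn_gt0 ?invr_gt0.
have qi1 : q ^+ i <= 1 by rewrite exprn_ile1 ?invr_ge0// invf_le1// ler1n.
have er : normc ((rho L n)%:C * v) <= rad (n + L.+2) /\ normc ((rho L n)%:C * v') <= rad (n + L.+2).
  by rewrite !normcM v1 v1' !mulr1 normcr ?(ltW (rho_gt0 _ _)).
have [rv rv'] := er.
have fan (f : elements (Hinf nu)) : analytic f by have [] := elements_mem f.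
have fb (f : elements (Hinf nu)) : normc (derive1 f ((rho L n)%:C * v)) <= c1 * rnorm f / (num nu n * eps n).
  exact: (P1 n f (rnorm f) (fan f) (fun w dw => elements_le f dw) _ rv).
have fd (f : elements (Hinf nu)) : normc (derive1 f ((rho L n)%:C * v') - derive1 f ((rho L n)%:C * v)) <=
    8 * c2 * rnorm f * q ^+ i / (num nu n * eps n).
  apply: le_trans (P2 n f (rnorm f) (fan f) (fun w dw => elements_le f dw) _ _ rv rv') _.
  rewrite -mulrBr normcM normcr ?(ltW (rho_gt0 _ _))//.
  have h0 : 0 <= c2 * rnorm f / (num nu n * eps n ^+ 2).
    by rewrite divr_ge0 ?mulr_ge0 ?N_ge0 ?exprn_ge0 ?ltW.
  apply: le_trans (ler_wpM2l h0 (_ : _ <= 8 * (eps n * q ^+ i))) _.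
    by apply: le_trans dv; rewrite ler_piMl ?normc_ge0// ltW ?rho_lt1.
  by rewrite le_eqVlt; apply/orP; left; apply/eqP; field; rewrite !gt_eqF.
have kb z : disk z -> c z * (K * (eps n ^+ L.+1 / normc (1 - zeta^* * phi z) ^+ L.+2)) <=
    K * eps n ^+ L.+1 * S.
  move=> dz'; have := ksup_ge c_ge0 c_le phid s_ge0 dz dz'; rewrite -/S.
  have kd0 : 0 < kd phi zeta z by exact: kd_gt0.
  have -> : kd phi zeta z `^ s = kd phi zeta z ^+ L.+2.
    rewrite -powR_mulrn ?(ltW kd0)//; congr (_ `^ _).
    by rewrite /s /L -[N.+3]addn3 natrD.
  move=> h; rewrite [leLHS](_ : _ = K * eps n ^+ L.+1 * (c z / kd phi zeta z ^+ L.+2)).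
    by apply: ler_wpM2l h; rewrite mulr_ge0 ?exprn_ge0// ltW.
  by rewrite /kd; ring.
have kb1 w z : normc w = 1 -> near_point n zeta w -> disk z ->
    c z * normc (ker L n (kpt L n (phi z) w)) <= K * eps n ^+ L.+1 * S.
  move=> w1 nw dz'; apply: le_trans (kb z dz'); apply: ler_wpM2l; first exact: c_ge0.
  by have [] := KP n (phi z) zeta w w (phid _ dz') dz w1 w1 nw nw.
have KS0 : 0 <= K * eps n ^+ L.+1 * S.
  by apply: mulr_ge0 S0; rewrite mulr_ge0 ?exprn_ge0// ltW.
have al : normc ((2%:R ^+ (n + i).+1)^-1 : C) <= eps n * q ^+ i.
  rewrite normcV normcX normc_nat -epsE /q -exprD -/(eps (n + i)).
  by apply: eps_le.
have q2 : 0 <= q ^+ i * q ^+ i by rewrite mulr_ge0 ?ltW.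
have kwS : 0 <= kw nu s n * S * (q ^+ i * q ^+ i).
  by apply: mulr_ge0 q2; apply: mulr_ge0 S0; exact: kw_ge0.
have final y : 0 <= y -> y <= 8 * (c1 + c2) ->
    y * (K * eps n ^+ L.+1 * S / num nu n * (q ^+ i * q ^+ i)) <=
    8 * (c1 + c2) * K * (kw nu s n * S * (q ^+ i * q ^+ i)).
  move=> y0 yl; rewrite [leRHS](_ : _ = 8 * (c1 + c2) *
    (K * eps n ^+ L.+1 * S / num nu n * (q ^+ i * q ^+ i))).
    by apply: ler_wpM2r yl; apply: mulr_ge0 q2; exact: divr_ge0 KS0 (ltW n0).
  by rewrite kw_nat /L; ring.
case: t => -[|[|[|//]]] /= _.
- exists (if i == 0%N then c1 / num nu n else 0), (K * eps n ^+ L.+1 * S); split=> //.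
  + by case: ifP => // _; rewrite divr_ge0 ?ltW.
  + case: eqP => [i0|_]; last first.
      by rewrite mul0r; apply: mulr_ge0 kwS; rewrite !mulr_ge0 ?addr_ge0 ?ltW.
    have qq : q ^+ i * q ^+ i = 1 by rewrite i0 expr0 mulr1.
    apply: le_trans (final c1 (ltW c10) _); last by move: c10 c20; lra.
    by rewrite qq mulr1 le_eqVlt; apply/orP; left; apply/eqP; ring.
  + move=> f; rewrite mul0r addr0; case: eqP => [i0|_]; last by rewrite !mul0r normc0.
    rewrite normcM; have -> : normc ((2%:R ^+ (n + i))^-1 : C) = eps n.
      by rewrite normcV normcX normc_nat -epsE i0 addn0.
    apply: le_trans (ler_wpM2l (ltW e0) (fb f)) _.
    by rewrite le_eqVlt; apply/orP; left; apply/eqP; field; rewrite !gt_eqF.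
  + by move=> z dz'; exact: kb1.
- exists (8 * c2 / num nu n * (q ^+ i * q ^+ i)), (K * eps n ^+ L.+1 * S); split=> //.
  + by apply: mulr_ge0 q2; rewrite divr_ge0 ?mulr_ge0 ?ltW.
  + apply: le_trans (final (8 * c2) _ _); [|by rewrite mulr_ge0 ?ltW|by move: c10; lra].
    by rewrite le_eqVlt; apply/orP; left; apply/eqP; ring.
  + move=> f; rewrite mulNr addrC -mulrBr normcM.
    apply: le_trans (ler_pM (normc_ge0 _) (normc_ge0 _) al (fd f)) _.
    by rewrite le_eqVlt; apply/orP; left; apply/eqP; field; rewrite !gt_eqF.
  + by move=> z dz'; exact: kb1.
- exists (c1 / num nu n * q ^+ i), (8 * q ^+ i * (K * eps n ^+ L.+1 * S)); split=> //.
  + by apply: mulr_ge0 (ltW qi); rewrite divr_ge0 ?ltW.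
  + by apply: mulr_ge0 KS0; rewrite mulr_ge0 ?ltW.
  + apply: le_trans (final (8 * c1) _ _); [|by rewrite mulr_ge0 ?ltW|by move: c20; lra].
    by rewrite le_eqVlt; apply/orP; left; apply/eqP; ring.
  + move=> f; rewrite mul0r addr0 normcM.
    apply: le_trans (ler_pM (normc_ge0 _) (normc_ge0 _) al (fb f)) _.
    by rewrite le_eqVlt; apply/orP; left; apply/eqP; field; rewrite !gt_eqF.
  + move=> z dz'.
    have [_ h] := KP n (phi z) zeta v v' (phid _ dz') dz v1 v1' nv nv'.
    apply: le_trans (ler_wpM2l (c_ge0 dz') h) _.
    have x8 : normc (v' - v) / eps n <= 8 * q ^+ i.
      by rewrite ler_pdivrMr//; apply: le_trans dv _; rewrite mulrCA mulrC.
    rewrite [leLHS](_ : _ = normc (v' - v) / eps n *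
      (c z * (K * (eps n ^+ L.+1 / normc (1 - zeta^* * phi z) ^+ L.+2)))); last by ring.
    apply: ler_pM x8 (kb z dz'); first by rewrite divr_ge0 ?normc_ge0 ?ltW.
    apply: mulr_ge0 (c_ge0 dz') _; apply: mulr_ge0; first exact: ltW.
    by rewrite divr_ge0 ?exprn_ge0 ?normc_ge0// ltW.
Qed.

(** The last clause bounds single terms pointwise; unlike the norm bound, it applies to tails before
    the image is known to lie in [H0 mu]. *)
Definition term_ok K (x : term_index) (x' : {scalar elements (Hinf nu)}) (y : elements (H0 mu)) :=
  let: (n, i, k, t) := x in
  [/\ continuous x', (dual_norm x' * (rnorm y)%:E <= (K * bnd n i k)%:E)%E,
    forall f, x' f = lam (derive1 f) n i k t,
    y 0 = 0 /\ (forall z, disk z -> hasd y z (kap n i k t (phi z) * g z))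
  & forall f z, disk z ->
      normc (x' f) * (c z * normc (kap n i k t (phi z))) <= K * bnd n i k * rnorm f].

Lemma kap_analytic n i k t : analytic (kap n i k t).
Proof.
rewrite /kap; case: (k < 2 ^ (n + i))%N; last exact: analytic0.
have a1 := @ker_analytic R L n _ (normc_node n i k).
have a2 := @ker_analytic R L n _ (normc_node' n i k).
case: t => -[|[|m]] /= _; [exact: a1|exact: a2|].
by have := @analytic_lin R 1 (-1) _ _ a2 a1; apply: eq_analytic => u _; rewrite mul1r mulN1r.
Qed.

Lemma kap_bounded n i k t : exists B : R, forall u, disk u -> normc (kap n i k t u) <= B.
Proof.
rewrite /kap; case: (k < 2 ^ (n + i))%N; last by exists 0 => u _; rewrite normc0.
have [B1 h1] := ker_bounded L n (normc_node n i k).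
have [B2 h2] := ker_bounded L n (normc_node' n i k).
case: t => -[|[|m]] /= _; [by exists B1|by exists B2|exists (B2 + B1) => u du].
by apply: le_trans (normcB_le _ _) (lerD _ _); [exact: h2|exact: h1].
Qed.

Lemma terms_exist : exists2 K : R, 0 < K & exists x' y, forall x, term_ok K x (x' x) (y x).
Proof.
have [K K0 KP] := term_bounds; have [cm cm0 cmP] := integrated_kernel nmu phi_self g_H0.
exists (K * (1 + cm)); first by rewrite mulr_gt0 ?addr_gt0.
suff H x : exists p : {scalar elements (Hinf nu)} * elements (H0 mu),
    term_ok (K * (1 + cm)) x p.1 p.2.
  have [p pP] := choice H; by exists (fun x => (p x).1), (fun x => (p x).2).
move: x => [[[n i] k] t]; have [Lam [G [L0 G0 LG fL zG]]] := KP n i k t.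
have dp (w : C) : normc w = 1 -> disk ((rho L n)%:C * w).
  by move=> w1; rewrite /disk /= normcM w1 mulr1 normcr ?(ltW (rho_gt0 _ _))// rho_lt1.
have [x' [x'c x'd x'E]] := derive_functional (dp _ (normc_node n i k))
  (dp _ (normc_node' n i k)) L0 fL.
have [B BP] := kap_bounded n i k t.
have [y [yG y0 yh]] := cmP _ B G (@kap_analytic n i k t) BP G0 zG.
have b0 := bnd_ge0 n i k.
exists (x', y); split=> //.
- apply: (@le_trans _ _ (Lam * (cm * G))%:E).
    rewrite EFinM; apply: lee_pmul => //; first exact: dual_norm_ge0.
      by rewrite lee_fin N_ge0.
  rewrite lee_fin; have := ler_wpM2l (ltW cm0) LG.
  by have : 0 <= K * bnd n i k := mulr_ge0 (ltW K0) b0; lra.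
- move=> f z dz; apply: (@le_trans _ _ (Lam * rnorm f * G)).
    apply: ler_pM; rewrite ?normc_ge0//.
    + by apply: mulr_ge0 (c_ge0 dz) (normc_ge0 _).
    + by rewrite x'E; exact: fL.
    + exact: zG.
  rewrite mulrAC; apply: ler_wpM2r; first exact: N_ge0.
  apply: le_trans LG _; apply: ler_wpM2r => //.
  by rewrite ler_peMr ?(ltW K0)// lerDl ltW.
Qed.

(** 3 counts the tags, 2 is the sum of the [q ^+ i]. The box has room for all [2 ^ (n + i)] nodes,
    so its sum contains complete levels. *)
Lemma sum_bnd : exists B : R, forall J : seq term_index, uniq J ->
  \sum_(x <- J) bnd x.1.1.1 x.1.1.2 x.1.2 <= B.
Proof.
have [B BP] := summable; exists (3 * (2 * B)) => J uJ.
have [M MP] := box_cover J.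
have Mlt : (M <= 2 ^ (M + M))%N.
  by apply: leq_trans (ltnW (ltn_expl M (ltnSn 1))) _; rewrite leq_exp2l ?leq_addr.
apply: le_trans (sum_uniq_subset _ uJ (box_uniq M M (2 ^ (M + M))) (MP _ _ _ (leqnn _) (leqnn _) Mlt)) _.
  by move=> x; exact: bnd_ge0.
rewrite (sum_box _ _ _ (fun n i k (t : 'I_3) => bnd n i k)).
have inner n i : (n < M)%N -> (i < M)%N ->
    \sum_(k < 2 ^ (M + M)) \sum_(t < 3) bnd n i k =
    3 * (kw nu s n * \sum_(k < 2 ^ n) ksup c phi s (dpt n k)) * q ^+ i.
  move=> nM iM; under eq_bigr do rewrite sumr_const card_ord -mulr_natl.
  rewrite -mulr_sumr -[RHS]mulrA; congr (_ * _).
  have le : (2 ^ (n + i) <= 2 ^ (M + M))%N by rewrite leq_exp2l// leq_add// ltnW.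
  have := sum_widen (fun k => kw nu s n * ksup c phi s (dpt n (k %/ 2 ^ i)) *
    (q ^+ i * q ^+ i)) le; rewrite /bnd => ->.
  rewrite -mulr_suml -mulr_sumr (sum_div n i (fun k => ksup c phi s (dpt n k))).
  rewrite -[X in _ * X * _]mulr_natr natrX.
  have qq : 2 ^+ i * q ^+ i = 1 by rewrite -exprMn /q mulfV// expr1n.
  apply: (@etrans _ _ (2 ^+ i * q ^+ i * (kw nu s n *
    (\sum_(k < 2 ^ n) ksup c phi s (dpt n k)) * q ^+ i))); last by rewrite qq mul1r.
  move: (kw nu s n) (\sum_(k < 2 ^ n) _) (q ^+ i) (2 ^+ i) => x y p2 z; ring.
apply: (@le_trans _ _ (\sum_(n < M) 3 *
    (kw nu s n * \sum_(k < 2 ^ n) ksup c phi s (dpt n k)) * 2)).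
  apply: ler_sum => n _; rewrite (eq_bigr (fun i : 'I_M => 3 *
    (kw nu s n * \sum_(k < 2 ^ n) ksup c phi s (dpt n k)) * q ^+ i)); last first.
    by move=> i _; exact: inner.
  rewrite -mulr_sumr; apply: ler_wpM2l.
    rewrite mulr_ge0// mulr_ge0//; first exact: kw_ge0.
    apply: sumr_ge0 => k _; apply: (ksup_ge0 c_ge0 c_le) => //; first by case: phi_self.
    exact: disk_dpt.
  have := @geo_sum R q M; rewrite /q invr_ge0 ler0n invf_lt1// ltr1n => /(_ isT isT).
  by rewrite (_ : (1 - 2^-1)^-1 = 2 :> R)//; field.
rewrite -mulr_suml -mulr_sumr -mulrA ler_pM2l// mulrC ler_pM2l//; exact: BP.
Qed.

Lemma lam_sum h n i k u : (k < 2 ^ (n + i))%N ->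
  \sum_(t < 3) lam h n i k t * kap n i k t u =
  (if i == 0%N then (2%:R ^+ n)^-1 * kint L h u n (rou n ^+ k) else 0) +
  (kint L h u n (node' n i k) - kint L h u n (node n i k)) / 2%:R ^+ (n + i).+1.
Proof.
move=> kl; rewrite !big_ord_recl big_ord0 /lam /coefs /kap kl /= /kint addr0.
case: eqP => [i0|_]; last by ring.
have -> : rou n ^+ k = node n i k by rewrite /node i0 addn0 exprM rouS.
by rewrite i0 addn0; ring.
Qed.

(** The sum over [i] telescopes the refinements, starting from the coarsest average, which tag 0
    contributes at [i = 0]; hence [M'.+1]. *)
Lemma sum_box_terms h u M M' K : (2 ^ (M + M'.+1) <= K)%N ->
  \sum_(x <- box M M'.+1 K) lam h x.1.1.1 x.1.1.2 x.1.2 x.2 *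
    kap x.1.1.1 x.1.1.2 x.1.2 x.2 u =
  \sum_(n < M) davg (n + M'.+1) (kint L h u n).
Proof.
move=> Kl; rewrite (sum_box _ _ _ (fun n i k t => lam h n i k t * kap n i k t u)).
apply: eq_bigr => n _.
have inner (i : nat) : (i < M'.+1)%N ->
    \sum_(k < K) \sum_(t < 3) lam h n i k t * kap n i k t u =
    (if i == 0%N then davg n (kint L h u n) else 0) +
    (davg (n + i).+1 (kint L h u n) - davg (n + i) (kint L h u n)).
  move=> iM; pose F k := \sum_(t < 3) lam h n i k t * kap n i k t u.
  have le : (2 ^ (n + i) <= K)%N.
    by apply: leq_trans Kl; rewrite leq_exp2l// leq_add// ltnW.
  have -> : \sum_(k < K) \sum_(t < 3) lam h n i k t * kap n i k t u = \sum_(k < 2 ^ (n + i)) F k.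
    rewrite -(sum_widen F le); apply: eq_bigr => k _; case: ifPn => // kl.
    by apply: big1 => t _; rewrite /kap (negbTE kl) mulr0.
  rewrite (eq_bigr (fun k : 'I_(2 ^ (n + i)) =>
    (if i == 0%N then (2%:R ^+ n)^-1 * kint L h u n (rou n ^+ k) else 0) +
    (kint L h u n (node' n i k) - kint L h u n (node n i k)) / 2%:R ^+ (n + i).+1)); last first.
    by move=> k _; exact: lam_sum.
  rewrite big_split -mulr_suml davgS /=; congr (_ + _).
  case: eqP => [->|_]; last by rewrite big1.
  by rewrite addn0 -mulr_sumr mulrC.
rewrite (eq_bigr (fun i : 'I_M'.+1 => (if i == 0 :> nat then davg n (kint L h u n) else 0) +
    (davg (n + i).+1 (kint L h u n) - davg (n + i) (kint L h u n)))); last first.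
  by move=> i _; exact: inner.
rewrite big_split /= big_ord_recl /= big1 ?addr0 => [|//].
have -> : \sum_(i < M'.+1) (davg (n + i).+1 (kint L h u n) - davg (n + i) (kint L h u n)) =
    davg (n + M'.+1) (kint L h u n) - davg n (kint L h u n).
  elim: M'.+1 => [|m IHm]; first by rewrite big_ord0 addn0 subrr.
  by rewrite big_ord_recr IHm /= addnS; ring.
by rewrite addrC subrK.
Qed.

Section Estimates.
Variables (K B : R) (x' : term_index -> {scalar elements (Hinf nu)}) (y : term_index -> elements (H0 mu)).
Hypotheses (K0 : 0 < K) (ok : forall x, term_ok K x (x' x) (y x)).

Let b (x : term_index) : R := K * bnd x.1.1.1 x.1.1.2 x.1.2.
Let kp (x : term_index) := kap x.1.1.1 x.1.1.2 x.1.2 x.2.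
Hypothesis b_le : forall J : seq term_index, uniq J -> \sum_(x <- J) b x <= B.

Let b_ge0 x : 0 <= b x.
Proof. by rewrite mulr_ge0 ?bnd_ge0// ltW. Qed.

Let f_analytic (f : elements (Hinf nu)) : analytic f.
Proof. by have [] := elements_mem f. Qed.

(** Boxes are cofinal among finite index sets, and the sums over suitable large boxes are the
    averages that reproduce the derivative. *)
Lemma finite_approx (f : elements (Hinf nu)) (J0 : seq term_index) u (e : R) :
  disk u -> 0 < e -> exists J : seq term_index, [/\ uniq J, {subset J0 <= J} &
    normc (\sum_(x <- J) x' x f * kp x u - derive1 f u) <= e].
Proof.
move=> du e0; have [M0 M0P] := kernel_reproduces L (analytic_derive (@f_analytic f)) du e0.
have [M1 M1P] := box_cover J0; pose M := maxn M0 M1.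
have [M2 M2P] := M0P M (leq_maxl _ _); pose M' := maxn M1 M2.
exists (box M M'.+1 (2 ^ (M + M'.+1))); split; first exact: box_uniq.
  apply: M1P; first exact: leq_maxr.
    by rewrite leqW ?leq_maxl.
  apply: leq_trans (ltnW (ltn_expl M1 (ltnSn 1))) _; rewrite leq_exp2l//.
  by rewrite (leq_trans (leq_maxr M0 M1))// leq_addr.
have -> : \sum_(x <- box M M'.+1 (2 ^ (M + M'.+1))) x' x f * kp x u =
    \sum_(n < M) davg (n + M'.+1) (kint L (derive1 f) u n).
  rewrite -(@sum_box_terms _ _ _ _ (2 ^ (M + M'.+1)))//; apply: eq_bigr => x _.
  congr (_ * _); have := ok x; case: x => [[[n i] k] t] [_ _ + _ _]; exact.
by apply: M2P; rewrite leqW ?leq_maxr.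
Qed.

(** Comparison with a larger finite set on which the expansion is accurate at [phi z]: what is added
    lies outside [J0] and is bounded termwise by [b], whatever the accuracy. *)
Lemma tail_le (f : elements (Hinf nu)) (J0 : seq term_index) (t : R) : uniq J0 -> 0 <= t ->
  (forall J, uniq J -> {in J, forall x, x \notin J0} -> \sum_(x <- J) b x <= t) ->
  forall z, disk z ->
  c z * normc (derive1 f (phi z) - \sum_(x <- J0) x' x f * kp x (phi z)) <= t * rnorm f.
Proof.
move=> uJ0 t0 tP z dz; have [_ phid] := phi_self.
have A0 : 0 <= A by apply: le_trans (c_ge0 dz) (c_le dz).
apply/ler_addgt0Pr => e e0; have A1 : 0 < A + 1 by rewrite ltr_wpDl.
have [J [uJ sJ JP]] := finite_approx f J0 (phid _ dz) (divr_gt0 e0 A1).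
set a := fun x : term_index => x' x f * kp x (phi z) in JP *.
have split : \sum_(x <- J) a x = \sum_(x <- J0) a x + \sum_(x <- [seq x <- J | x \notin J0]) a x.
  rewrite (bigID (mem J0)) /= -big_filter; congr (_ + _); last by rewrite -big_filter.
  apply: perm_big; apply: uniq_perm => //; first exact: filter_uniq.
  by move=> x; rewrite mem_filter; case: (boolP (x \in J0)) => // /sJ ->.
apply: (@le_trans _ _ (c z * (e / (A + 1) + normc (\sum_(x <- [seq x <- J | x \notin J0]) a x)))).
  apply: (ler_wpM2l (c_ge0 dz)); apply: le_trans (lerD JP (lexx _)).
  rewrite normc_distC; apply: le_trans (normcB_le _ _).
  by rewrite -/(\sum_(x <- J) a x) split [X in _ <= normc X]addrAC addrK.
rewrite mulrDr addrC; apply: lerD; last first.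
  rewrite mulrCA -[leRHS]mulr1; apply: (ler_wpM2l (ltW e0)).
  by rewrite ler_pdivrMr// mul1r (le_trans (c_le dz))// lerDl.
apply: le_trans (ler_wpM2l (c_ge0 dz) (normc_sum _ _ _)) _.
rewrite mulr_sumr; apply: (@le_trans _ _ (\sum_(x <- [seq x <- J | x \notin J0]) b x * rnorm f)).
  apply: ler_sum => x _; rewrite /a normcM mulrCA.
  by have := ok x; rewrite /b /kp; case: x => [[[n i] k] t'] [_ _ _ _]; exact.
rewrite -mulr_suml; apply: ler_wpM2r; first exact: N_ge0.
by apply: tP; [exact: filter_uniq|move=> x; rewrite mem_filter => /andP[]].
Qed.

(** The tail is small uniformly in [z]; the remaining finite kernel sum is bounded, so the decay of
    [g] handles it near the boundary. *)
Lemma image_H0 (f : elements (Hinf nu)) : in_H0 mu (S_op g phi f).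
Proof.
have [ga glim] := g_H0; have fa := @f_analytic f; have [_ phid] := phi_self.
have Sa := S_op_analytic ga phi_self fa.
apply: (in_H0_of_derive1 nmu Sa); split; first exact: (analytic_derive Sa).
move=> e e0; have f1 : 0 < rnorm f + 1 by rewrite ltr_wpDl// N_ge0.
have e2 : 0 < e / 2 by rewrite divr_gt0.
have [k0 k0P] := codes_tail b_ge0 (divr_gt0 e2 f1) b_le.
set J0 := codes_lt term_index k0.
have [D [D0 DP]] : exists D : R, 0 <= D /\ forall u, disk u ->
    normc (\sum_(x <- J0) x' x f * kp x u) <= D.
  elim: J0 => [|x J [D [D0 DP]]].
    by exists 0; split=> // u du; rewrite big_nil normc0.
  have [B' B'P] := kap_bounded x.1.1.1 x.1.1.2 x.1.2 x.2.
  have B'0 : 0 <= B' by apply: le_trans (normc_ge0 _) (B'P 0 (@disk0 R)).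
  exists (normc (x' x f) * B' + D); split; first by rewrite addr_ge0 ?mulr_ge0 ?normc_ge0.
  move=> u du; rewrite big_cons; apply: le_trans (normc_leD _ _) (lerD _ (DP u du)).
  by rewrite normcM ler_wpM2l ?normc_ge0//; exact: B'P.
have D1 : 0 < D + 1 by rewrite ltr_wpDl.
have [r r1 rP] := glim _ (divr_gt0 e2 D1); exists r => // z rz dz.
have t0 : 0 <= e / 2 / (rnorm f + 1) by rewrite divr_ge0 ?ltW.
have := tail_le f (codes_lt_uniq _ k0) t0 (fun J uJ dJ => k0P k0 J (leqnn _) uJ dJ) dz.
rewrite S_op_derive1// -/J0; set h := derive1 f (phi z); set Sg := \sum_(x <- J0) _ => tl.
rewrite normcM mulrCA mulrC -/(c z).
have -> : (1 - normc z ^+ 2) * mu z * normc (g z) * normc h = c z * normc h by [].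
apply: (@le_lt_trans _ _ (c z * normc (h - Sg) + c z * normc Sg)).
  rewrite -mulrDr; apply: (ler_wpM2l (c_ge0 dz)).
  by rewrite -{1}[h](subrK Sg) normc_leD.
rewrite [ltRHS]splitr; apply: ler_ltD.
  by apply: le_trans tl _; rewrite -[leLHS]mulrA -[leRHS]mulr1 (ler_wpM2l (ltW e2))// ler_pdivrMl// mulr1 lerDl.
have := rP z rz dz; rewrite -/(c z) ltr_pdivlMr//; apply: le_lt_trans.
apply: (ler_wpM2l (c_ge0 dz)); apply: le_trans (DP _ (phid _ dz)) _.
by rewrite lerDl.
Qed.

Lemma hasd_sum_seq (I : Type) (J : seq I) (F : I -> C -> C) (d : I -> C) z :
  (forall i, hasd (F i) z (d i)) ->
  hasd (fun w => \sum_(i <- J) F i w) z (\sum_(i <- J) d i).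
Proof.
move=> Fd; elim: J => [|i J IHJ].
  rewrite big_nil (_ : (fun w => _) = fun=> 0); first exact: hasd_cst.
  by apply/funext => w; rewrite big_nil.
rewrite big_cons (_ : (fun w => _) = fun w => F i w + \sum_(j <- J) F j w).
  exact: hasdD.
by apply/funext => w; rewrite big_cons.
Qed.

(** The error [E] vanishes at 0 and its weighted derivative is bounded by [tail_le]; integration
    bounds its norm by the same tail. *)
Lemma nuclear_image (T : elements (Hinf nu) -> elements (H0 mu)) :
  (forall f z, disk z -> T f z = S_op g phi f z) -> nuclear T.
Proof.
move=> TS; have [cm cm0 cmP] := weighted_le_of_derive1 nmu; have [ga _] := g_H0.
apply: (@nuclear_of_sum _ _ _ T term_index (0, 0, 0, ord0)%N x' y b B) => //.
- by move=> x; have := ok x; case: x => [[[n i] k] t] [].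
- by move=> x; have := ok x; rewrite /b; case: x => [[[n i] k] t] [].
move=> f; have fa := @f_analytic f; exists (cm * rnorm f).
  by rewrite mulr_ge0 ?N_ge0// ltW.
move=> J0 t uJ0 t0 tP; pose E : C -> C := fun z => T f z - \sum_(x <- J0) x' x f * y x z.
have EE : elements_fun (T f - \sum_(x <- J0) x' x f *: y x) = E.
  apply/funext => z; rewrite /E; apply: (@etrans _ _ (T f z - (\sum_(x <- J0) x' x f *: y x) z)) => //.
  congr (_ - _); elim: J0 {uJ0 tP E} => [|x J0 IHJ]; rewrite ?big_nil// !big_cons -IHJ //.
have Ed z : disk z -> hasd E z ((derive1 f (phi z) - \sum_(x <- J0) x' x f * kp x (phi z)) * g z).
  move=> dz; rewrite mulrBl mulr_suml; apply: hasdB.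
    by apply: (disk_hasd dz _ (S_op_hasd ga phi_self fa dz)) => w dw; rewrite TS.
  apply: hasd_sum_seq => x; rewrite -mulrA; apply: hasdZ.
  by have := ok x; rewrite /kp; case: x => [[[n i] k] t'] [_ _ _ [_ +] _]; exact.
have Ea : analytic E by exact: hasd_analytic Ed.
have E0 : E 0 = 0.
  rewrite /E TS ?S_op0//; last exact: disk0.
  rewrite big1 ?subrr// => x _; have := ok x; case: x => [[[n i] k] t'] [_ _ _ [-> _] _].
  by rewrite mulr0.
have M0 : 0 <= t * rnorm f by rewrite mulr_ge0 ?N_ge0.
have dE w : disk w -> (1 - normc w ^+ 2) * mu w * normc (derive1 E w) <= t * rnorm f.
  move=> dw; rewrite (hasd_derive1 (Ed w dw)) normcM [normc _ * normc (g w)]mulrC mulrA.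
  exact: tail_le uJ0 t0 tP _ dw.
apply: elements_norm_le => z dz.
have := cmP E _ Ea E0 M0 dE z dz; rewrite -EE -[cm * rnorm f * t]mulrA [rnorm f * t]mulrC.
exact.
Qed.

End Estimates.

Lemma nuclear_of_ksummable : bounded_between (S_op g phi) (Hinf nu) (Hinf mu) ->
  nuclear_between (S_op g phi) (Hinf nu) (H0 mu).
Proof.
move=> [T0 T0S _]; have [K K0 [x' [y ok]]] := terms_exist; have [B BP] := sum_bnd.
have b_le (J : seq term_index) : uniq J -> \sum_(x <- J) K * bnd x.1.1.1 x.1.1.2 x.1.2 <= K * B.
  by move=> uJ; rewrite -mulr_sumr; apply: (ler_wpM2l (ltW K0)); exact: BP.
have [T TS] : exists T : elements (Hinf nu) -> elements (H0 mu),
    forall f z, disk z -> T f z = S_op g phi f z.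
  suff H : forall f : elements (Hinf nu), exists Tf : elements (H0 mu),
      forall z, disk z -> Tf z = S_op g phi f z.
    by have [T TP] := choice H; exists T.
  move=> f; apply: (@elements_ext _ (H0 mu)).
  by apply: eq_in_H0 (image_H0 K0 ok b_le f) => z dz; rewrite ext0E.
(* Linearity is inherited from [T0], which represents the same transformation. *)
have lin : forall a f h, T (a *: f + h) = a *: T f + T h.
  move=> a f h; apply/val_inj/funext => z /=.
  have [dz|ndz] := pselect (disk z); last first.
    have o (e : elements (H0 mu)) : elements_fun e z = 0 by exact: elements_out.
    exact: (etrans (o (T (a *: f + h))) (esym (o (a *: T f + T h)))).
  rewrite -[RHS]/(a * T f z + T h z) !TS// -!T0S// linearD linearZ.
  by [].
pose TL := GRing.isLinear.Build C (elements (Hinf nu)) (elements (H0 mu)) *:%R T lin.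
pose T' : {linear elements (Hinf nu) -> elements (H0 mu)} := HB.pack T TL.
exists T'; first exact: TS.
exact: (nuclear_image K0 ok b_le TS).
Qed.

End Sufficiency.

(** * Inclusions and the equivalences *)

Section Inclusions.
Context {R : realType}.
Local Notation C := R[i].

Lemma in_H0_Hinf (w : weight R) f : in_H0 w f -> in_Hinf w f.
Proof. by move=> Hf; split; [case: Hf|exact: H0_bounded]. Qed.

Lemma inclusion_exists (w : weight R) :
  exists J : {linear elements (H0 w) -> elements (Hinf w)}, forall f z, J f z = f z.
Proof.
have [J JP] : exists J : elements (H0 w) -> elements (Hinf w), forall f z, J f z = f z.
  suff H : forall f : elements (H0 w), exists h : elements (Hinf w), forall z, h z = f z.
    by have [J JP] := choice H; exists J.
  move=> f; have [|h hP] := @elements_ext _ (Hinf w) f.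
    have := in_H0_Hinf (elements_mem f); apply: eq_in_Hinf => z dz; by rewrite ext0E.
  exists h => z; have [dz|ndz] := pselect (disk z); first exact: hP.
  by rewrite (elements_out h ndz) (elements_out f ndz).
have lin : forall a f h, J (a *: f + h) = a *: J f + J h.
  move=> a f h; apply/val_inj/funext => z /=.
  by rewrite -[RHS]/(a * J f z + J h z) !JP.
pose JL := GRing.isLinear.Build C (elements (H0 w)) (elements (Hinf w)) *:%R J lin.
by exists (HB.pack J JL : {linear elements (H0 w) -> elements (Hinf w)}).
Qed.

Lemma rnorm_inclusion (w : weight R) (f : elements (H0 w)) (h : elements (Hinf w)) :
  (forall z, h z = f z) -> rnorm h = rnorm f.
Proof. by move=> hf; rewrite !rnorm_elements; congr weighted_norm; exact/funext. Qed.

(** The functionals are composed with the isometry [J], which maps the unit ball into the unit ball,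
    so dual norms do not increase. *)
Lemma nuclear_restrict (X X' Y : normedModType C) (J : {linear X' -> X})
    (T : {linear X -> Y}) :
  (forall x, rnorm (J x) = rnorm x) -> nuclear T -> nuclear (fun x => T (J x)).
Proof.
move=> JN [x' [y [x'c Dlt Tcvg]]].
have H k : exists z' : {scalar X'}, forall x, z' x = x' k (J x).
  by apply: scalar_of => a u v; rewrite linearP linearD linearZ.
have [z' z'E] := choice H.
exists z', y; split=> [k||x].
- move=> x; have c1 := x'c k (J x).
  apply/cvgrPdist_le => e e0; have /cvgrPdist_le/(_ e e0) := c1.
  move=> /nbhs_ballP[[d d'] /= + dP]; rewrite ltcE /= => /andP[/eqP d'0 d0].
  have : \forall t \near x, `|x - t| < d%:C :> C.
    by have /cvgrPdist_lt/(_ d%:C) := @cvg_id _ (nbhs x); apply; rewrite ltcR.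
  apply: filterS => t xt; rewrite !z'E; apply: dP.
  rewrite -ball_normE /ball_ /= -linearB d'0 -[_ +i* _]/(d%:C).
  by rewrite norm_ReE -/(rnorm _) JN -norm_ReE.
- apply: le_lt_trans Dlt; apply: lee_nneseries => [k _ _|k _].
    by rewrite mule_ge0 ?dual_norm_ge0// lee_fin N_ge0.
  apply: lee_wpmul2r; first by rewrite lee_fin N_ge0.
  apply: ub_ereal_sup => _ [x x1 <-]; rewrite z'E; apply: ereal_sup_ubound.
  by exists (J x) => //; move: x1; rewrite /= !norm_ReE -!/(rnorm _) JN.
- rewrite (_ : [series z' k x *: y k]_k = [series x' k (J x) *: y k]_k); first exact: Tcvg.
  by apply/funext => n; rewrite /series /=; apply: eq_bigr => k _; rewrite z'E.
Qed.

Lemma nuclear_extend (X Y Y' : normedModType C) (J : {linear Y -> Y'}) (T : X -> Y) :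
  (forall y, rnorm (J y) = rnorm y) -> nuclear T -> nuclear (fun x => J (T x)).
Proof.
move=> JN [x' [y [x'c Dlt Tcvg]]]; exists x', (fun k => J (y k)); split=> // [|x].
  rewrite (eq_eseriesr (g := fun k => (dual_norm (x' k) * (rnorm (y k))%:E)%E))// => k _.
  by rewrite -/(rnorm _) JN.
apply/cvgrPdist_le => e e0; have /cvgrPdist_le/(_ e e0) := Tcvg x.
apply: filterS => n h; apply: le_trans h.
have -> : [series x' k x *: J (y k)]_k n = J ([series x' k x *: y k]_k n).
  by rewrite /series /= linear_sum; apply: eq_bigr => k _; rewrite linearZ.
by rewrite -linearB !norm_ReE JN.
Qed.

Lemma nuclear_between_restrict S (w : weight R) (F : weighted_space R) :
  nuclear_between S (Hinf w) F -> nuclear_between S (H0 w) F.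
Proof.
move=> [T TS Tn]; have [J JE] := inclusion_exists w.
have JN f : rnorm (J f) = rnorm f by exact: rnorm_inclusion.
exists (T \o J)%FUN; last exact: (nuclear_restrict JN Tn).
move=> f z dz; rewrite /= TS//; congr (S _ z); apply/funext => u; exact: JE.
Qed.

Lemma nuclear_between_extend S (w : weight R) (E : weighted_space R) :
  nuclear_between S E (H0 w) -> nuclear_between S E (Hinf w).
Proof.
move=> [T TS Tn]; have [J JE] := inclusion_exists w.
have JN f : rnorm (J f) = rnorm f by exact: rnorm_inclusion.
exists (J \o T)%FUN; last exact: (nuclear_extend JN Tn).
by move=> f z dz; rewrite /= JE TS.
Qed.

End Inclusions.

Section Equivalences.
Context {R : realType}.
Local Notation C := R[i].
Variables (nu mu : weight R) (alpha beta : R) (g phi : C -> C).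
Hypotheses (nnu : normal nu) (nmu : normal mu).
Hypotheses (beta_I : normal_exp_I nu beta) (beta_lt : beta - 1 < alpha).
Hypothesis g_H0 : in_H0 (fun z => (1 - normc z ^+ 2) * mu z) g.
Hypothesis phi_self : self_map phi.

Let c (z : C) : R := (1 - normc z ^+ 2) * mu z * normc (g z).

Let c_ge0 z : disk z -> 0 <= c z.
Proof.
move=> dz; rewrite /c mulr_ge0 ?normc_ge0// mulr_ge0//.
  exact/ltW/onem_sqr_gt0.
exact/ltW/weight_gt0.
Qed.

Lemma weighted_bounded : exists A : R, forall z, disk z -> c z <= A.
Proof.
have [ga glim] := g_H0; have [r r1 rP] := glim 1 ltr01.
have [M M0 MP] := analytic_bounded ga r1.
have m0 : 0 <= mu 0 by apply/ltW/weight_gt0; exact: disk0.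
exists (1 + mu 0 * M) => z dz; have [zr|rz] := leP (normc z) r; last first.
  by apply: le_trans (ltW (rP z rz dz)) _; rewrite lerDl mulr_ge0.
apply: ler_wpDl => //; rewrite /c -mulrA; have muz := ltW (weight_gt0 mu dz).
apply: (@le_trans _ _ (mu z * normc (g z))).
  rewrite ler_piMl ?mulr_ge0 ?normc_ge0// gerBl exprn_ge0 ?normc_ge0//.
apply: ler_pM; rewrite ?normc_ge0//; last exact: MP.
by apply: weight_noninc => //; rewrite [normc 0](normc0 R) normc_ge0.
Qed.

(** [alpha] may be negative, whence the absolute value before truncation. *)
Let N := (Num.truncn `|alpha|).+1.

Let alpha_le : alpha <= N%:R.
Proof. exact: le_trans (ler_norm _) (ltW (truncnS_gt _)). Qed.

Let alpha3 : 0 <= alpha + 3.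
Proof. by have [b0 _] := beta_I; move: beta_lt b0; lra. Qed.

Let exponent : alpha + 3 + (N%:R - alpha) = N%:R + 3.
Proof. by ring. Qed.

Let psi (zeta : C) : \bar R :=
  (ereal_sup [set (c z / normc (1 - zeta^* * phi z) `^ (alpha + 3))%:E | z in disk] *
   ((1 - normc zeta ^+ 2) `^ alpha / nu zeta)%:E)%E.

Lemma integral_of_nuclear : nuclear_between (S_op g phi) (H0 nu) (Hinf mu) ->
  (disk_integral psi < +oo)%E.
Proof.
have [A c_le] := weighted_bounded; have [ga _] := g_H0; have [_ phid] := phi_self.
have [mu_I _] := nmu; have [nu_I nu_II] := nnu.
have b1 : beta < N.+1%:R by rewrite -natr1; move: alpha_le beta_lt; lra.
move=> /(ksummable_of_nuclear beta_I nu_II mu_I b1 ga phi_self c_le).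
(* The descent from [N + 3] to [alpha + 3] asks for [beta < alpha + 1], the condition of a normal
   pair. *)
rewrite -exponent => /(ksummable_decr c_ge0 c_le phid beta_I) H.
have /(integral_of_ksummable c_ge0 c_le phid nu_I alpha3) fin : ksummable c phi nu (alpha + 3).
  by apply: H; [move: beta_lt; lra|rewrite subr_ge0].
by rewrite /disk_integral; apply: lte_mul_pinfty; rewrite ?lee_fin ?invr_ge0 ?pi_ge0.
Qed.

Lemma nuclear_of_integral : bounded_between (S_op g phi) (Hinf nu) (Hinf mu) ->
  (disk_integral psi < +oo)%E -> nuclear_between (S_op g phi) (Hinf nu) (H0 mu).
Proof.
have [A c_le] := weighted_bounded; have [_ phid] := phi_self; have [nu_I _] := nnu.
move=> Sb; rewrite /disk_integral => fin.
have sum : ksummable c phi nu (alpha + 3).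
  apply: (ksummable_of_integral c_ge0 c_le phid nu_I alpha3).
  rewrite ltNge leye_eq; apply/negP => /eqP E.
  move: fin; rewrite [X in (_ * X)%E]E gt0_muley ?ltxx// lte_fin invr_gt0 pi_gt0.
  by [].
apply: (nuclear_of_ksummable (N := N) nu_I nmu phi_self g_H0 c_le _ Sb).
rewrite -exponent; apply: (ksummable_incr c_ge0 c_le phid alpha3) sum.
by rewrite subr_ge0.
Qed.

End Equivalences.
Theorem corollary7 (R : realType) (nu mu : weight R) (omega : R[i] -> R)
    (alpha : R) (g phi : R[i] -> R[i]) :
  normal nu -> normal mu -> -1 < alpha -> normal_pair nu omega alpha ->
  in_H0 (fun z => (1 - normc z ^+ 2) * mu z) g -> self_map phi ->
  bounded_between (S_op g phi) (Hinf nu) (Hinf mu) ->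
  [<-> nuclear_between (S_op g phi) (H0 nu) (Hinf mu);
       nuclear_between (S_op g phi) (Hinf nu) (Hinf mu);
       nuclear_between (S_op g phi) (H0 nu) (H0 mu);
       nuclear_between (S_op g phi) (Hinf nu) (H0 mu);
       (disk_integral (fun zeta =>
          ereal_sup [set ((1 - normc z ^+ 2) * mu z * normc (g z) /
             normc (1 - zeta^* * phi z) `^ (alpha + 3))%:E | z in disk] *
          ((1 - normc zeta ^+ 2) `^ alpha / nu zeta)%:E) < +oo)%E].
Proof.
move=> nnu nmu _ [_ _ _ _ [beta beta_I beta_lt]] g_H0 phi_self Sb.
have ae := integral_of_nuclear nnu nmu beta_I beta_lt g_H0 phi_self.
have ed := nuclear_of_integral nnu nmu beta_I beta_lt g_H0 phi_self Sb.
have dc := @nuclear_between_restrict _ (S_op g phi) nu (H0 mu).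
have ba := @nuclear_between_restrict _ (S_op g phi) nu (Hinf mu).
have db := @nuclear_between_extend _ (S_op g phi) mu (Hinf nu).
have ca := @nuclear_between_extend _ (S_op g phi) mu (H0 nu).
(* The integral condition is the hub: [ae] and [ed] link it to the weakest and the strongest
   nuclearity, and the inclusions give the rest. *)
tfae.
- by move=> /ae/ed/db.
- by move=> /ba/ae/ed/dc.
- by move=> /ca/ae/ed.
- by move=> /db/ba/ae.
- by move=> /ed/db/ba.
Qed.
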